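(* Fix an integer $b\ge2$ and let $\beta_{\rm c}:=2\pi^2/\log b$. For all $\beta\in(0,\beta_{\rm c})$ there exist a constant $C>0$, a positive sequence $\{R_k\}_{k\ge1}$ with $\limsup_{k\to\infty}k^{-1}\log R_k<0$ and, for all natural $n\ge1$, there exists a coupling of the families $$\text{(i)}\ \{\xi_k^{\rm DG}(x)\colon k=0,\dots,n-1,\,x\in\Lambda_n\},\qquad\text{(ii)}\ \{\xi_k^{\rm GFF}(x)\colon k=0,\dots,n-1,\,x\in\Lambda_n\},$$ and a family of zero-one valued random variables $$\text{(iii)}\ \{B_k(x)\colon x\in\Lambda_{n-k},\,k=1,\dots,n-1\}$$ such that the following holds: (1) the random variables in (iii) are independent with $P(B_k(x)=1)=e^{-R_k}$ for all $x\in\Lambda_{n-k}$, $k=1,\dots,n-1$; (2) the families (ii) and (iii) are independent of each other; (3) for all $k=1,\dots,n-1$ and all $x\in\Lambda_n$, $\xi_k^{\rm DG}(x)=\xi_k^{\rm GFF}(x)$ on $\{B_k(m^k(x))=1\}$; (4) for all $k=0,\dots,n-1$ and all $x\in\Lambda_n$, $P\bigl(|\xi_k^{\rm DG}(x)-\xi_k^{\rm GFF}(x)|>C\bigr)=0$.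
   Context: Lattice: $\Lambda_n:=\{1,\dots,b\}^n$, with $\Lambda_0$ a singleton (the empty sequence). The map $m\colon\Lambda_n\to\Lambda_{n-1}$ drops the last coordinate, $m(x_1,\dots,x_n)=(x_1,\dots,x_{n-1})$, and $m^k$ is its $k$-th iterate. Effective potentials: for $\beta>0$, $v_0$ is defined by $e^{-v_0(z)}:=\sum_{n\in\mathbb Z}e^{-\frac\beta2(z-n)^2}$ and $v_1,v_2,\dots$ recursively by $e^{-v_{k+1}(z)}:=E(e^{-bv_k(z+\zeta)})$ with $\zeta$ distributed as $\mathcal N(0,1/\beta)$. Transition laws: writing $\mathfrak g_{1/\beta}$ for the law $\mathcal N(0,1/\beta)$ and $\#$ for the counting measure on $\mathbb Z$, for $\varphi\in\mathbb R$ let $\mathfrak q_k(d\zeta|\varphi):=e^{v_k(\varphi)-bv_{k-1}(\varphi+\zeta)}\mathfrak g_{1/\beta}(d\zeta)$ if $k\ge1$ and $\mathfrak q_0(d\zeta|\varphi):=e^{v_0(\varphi)-\frac\beta2\zeta^2}\#(\varphi+d\zeta)$ (so that $\mathfrak q_0(\cdot|\varphi)$ is supported on $\zeta\in-\varphi+\mathbb Z$). DG increments: let $\{\zeta_k(x)\colon x\in\Lambda_k,\,k=1,\dots,n\}$ have joint law $\bigotimes_{k=1}^n\bigotimes_{x\in\Lambda_k}\mathfrak q_{n-k}\bigl(d\zeta_k(x)\,|\,\varphi_{k-1}(m(x))\bigr)$ where $\varphi_0:=0$ and $\varphi_k(x):=\sum_{j=1}^k\zeta_j(m^{k-j}(x))$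 for $x\in\Lambda_k$ (i.e., conditionally on the variables with index less than $k$, the $\zeta_k(x)$, $x\in\Lambda_k$, are independent with the stated laws). For $x\in\Lambda_n$ and $k=0,\dots,n-1$ put $\xi_k^{\rm DG}(x):=\zeta_{n-k}(m^k(x))$. GFF increments: let $\{\zeta'_k(x)\colon x\in\Lambda_k,\,k=1,\dots,n\}$ be i.i.d. $\mathcal N(0,1/\beta)$ and put $\xi_k^{\rm GFF}(x):=\zeta'_{n-k}(m^k(x))$ for $x\in\Lambda_n$ and $k=0,\dots,n-1$. A coupling means a realization of all three families on one probability space in which families (i) and (ii) have the joint laws just described. *)

(* Defs.v *)
From HB Require Import structures.
From mathcomp Require Import all_boot all_order all_algebra.
From mathcomp Require Import finmap.
From mathcomp Require Import all_classical all_reals all_analysis.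

Set Implicit Arguments.
Unset Strict Implicit.
Unset Printing Implicit Defensive.

Import Order.TTheory GRing.Theory Num.Theory.
Import numFieldNormedType.Exports.

Local Open Scope classical_set_scope.
Local Open Scope ring_scope.

(* Lambda_k = {1, ..., b}^k is the set of sequences over 'I_b of size k (the
   alphabet is relabelled {0, ..., b - 1}). Families indexed by k and by
   x in Lambda_k are functions of k and of an arbitrary sequence; their values
   at (k, x) with size x <> k are never used. *)
Definition drop_last (T : Type) (x : seq T) : seq T := take (size x).-1 x.

Section potentials.
Context {R : realType}.
Variables (b : nat) (beta : R).

Definition beta_c : R := 2 * pi ^+ 2 / ln b%:R.

(* N(0, 1 / beta); the second argument of normal_prob is the standard
   deviation. *)
Definition gauss_law := normal_prob (0 : R) (Num.sqrt beta^-1).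

(* The sum and the expectations are finite and positive when 0 < beta, so fine
   and ln take none of their default values there. *)
Fixpoint eff_pot (k : nat) (z : R) : R :=
  if k is k'.+1 then
    - ln (fine 'E_gauss_law[fun zeta : R =>
                              expR (- (b%:R * eff_pot k' (z + zeta)))])
  else
    - ln (fine (\esum_(j in [set: int])
                  (expR (- (beta / 2 * (z - j%:~R) ^+ 2)))%:E)).

(* For k = 0 the measure #(phi + d zeta) puts mass one at each point
   zeta = j - phi, with j an integer. *)
Definition trans_law (k : nat) (phi : R) (A : set R) : \bar R :=
  if k is k'.+1 then
    (\int[gauss_law]_(zeta in A)
       (expR (eff_pot k phi - b%:R * eff_pot k' (phi + zeta)))%:E)%E
  else
    (\esum_(j in [set j : int | A (j%:~R - phi)%R])
       (expR (eff_pot 0 phi - beta / 2 * (j%:~R - phi) ^+ 2))%:E)%E.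

Definition partial_sum (zeta : nat -> seq 'I_b -> R) (k : nat) (x : seq 'I_b)
    : R :=
  \sum_(1 <= j < k.+1) zeta j (iter (k - j) (@drop_last 'I_b) x).

(* The pairs (k, x) with 1 <= k <= n and x in Lambda_k, by increasing k. *)
Definition vertices (n : nat) : seq (nat * seq 'I_b) :=
  [seq (k, tval x) | k <- iota 1 n, x <- enum {: k.-tuple 'I_b}].

Definition update (zeta : nat -> seq 'I_b -> R) (v : nat * seq 'I_b) (z : R)
    : nat -> seq 'I_b -> R :=
  fun k x => if (k, x) == v then z else zeta k x.

(* The mass that the iterated product of the laws
   trans_law (n - k) (partial_sum zeta k.-1 (drop_last x)), taken over the
   (k, x) of s in order, gives to the rectangle with sides A k x; zeta holds
   the values of the variables already integrated. *)
Fixpoint iterated_law (n : nat) (A : nat -> seq 'I_b -> set R)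
    (s : seq (nat * seq 'I_b)) (zeta : nat -> seq 'I_b -> R) : \bar R :=
  if s is (k, x) :: s' then
    (\int[trans_law (n - k) (partial_sum zeta k.-1 (drop_last x))]_(z in A k x)
       iterated_law n A s' (update zeta (k, x) z))%E
  else 1%E.

End potentials.

Section random_families.
Context {R : realType} {d : measure_display} {Omega : measurableType d}.
Variable P : probability Omega R.

Definition mutually_independent (I : choiceType) (d' : measure_display)
    (T : measurableType d') (D : set I) (X : I -> {RV P >-> T}) : Prop :=
  forall (J : {fset I}) (A : I -> set T),
    [set` J] `<=` D -> (forall i, measurable (A i)) ->
    P (\bigcap_(i in [set` J]) X i @^-1` A i) =
      (\prod_(i <- J) P (X i @^-1` A i))%E.

Definition sigma_family (I : Type) (d' : measure_display)
    (T : measurableType d') (D : set I) (X : I -> {RV P >-> T})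
    : set (set Omega) :=
  <<s \bigcup_(i in D) preimage_set_system setT (X i) measurable >>.

Definition independent_families (I1 I2 : Type) (d1 d2 : measure_display)
    (T1 : measurableType d1) (T2 : measurableType d2)
    (D1 : set I1) (X1 : I1 -> {RV P >-> T1})
    (D2 : set I2) (X2 : I2 -> {RV P >-> T2}) : Prop :=
  forall E F : set Omega, sigma_family D1 X1 E -> sigma_family D2 X2 F ->
    P (E `&` F) = (P E * P F)%E.

Variables (b : nat) (beta : R) (n : nat).
Implicit Type zeta : nat -> seq 'I_b -> {RV P >-> R}.

Definition tree_index : set (nat * seq 'I_b) :=
  [set v | (1 <= v.1 <= n)%N /\ size v.2 = v.1].

(* A law on a finite product of copies of R is determined by its values on
   measurable rectangles. *)
Definition has_dg_law zeta : Prop :=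
  forall A : nat -> seq 'I_b -> set R, (forall k x, measurable (A k x)) ->
    P [set w | forall k x, tree_index (k, x) -> A k x (zeta k x w)] =
      iterated_law beta n A (vertices b n) (fun _ _ => 0).

Definition has_gff_law zeta : Prop :=
  mutually_independent tree_index (fun v => zeta v.1 v.2) /\
  forall k x, tree_index (k, x) ->
    forall A : set R, measurable A ->
      distribution P (zeta k x) A = gauss_law beta A.

Definition increment zeta (k : nat) (x : seq 'I_b) : {RV P >-> R} :=
  zeta (n - k)%N (iter k (@drop_last 'I_b) x).

Definition increment_index : set (nat * seq 'I_b) :=
  [set v | (v.1 < n)%N /\ size v.2 = n].

Definition switch_index : set (nat * seq 'I_b) :=
  [set v | (1 <= v.1 < n)%N /\ size v.2 = (n - v.1)%N].

End random_families.

Arguments tree_index b n : clear implicits.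
Arguments increment_index b n : clear implicits.
Arguments switch_index b n : clear implicits.

(* Main.v *)
Require Import Defs.
From HB Require Import structures.
From mathcomp Require Import all_boot all_order all_algebra.
From mathcomp Require Import finmap ring lra zify.
From mathcomp Require Import all_classical all_reals all_analysis.
From mathcomp Require Import measurable_realfun.

Set Implicit Arguments.
Unset Strict Implicit.
Unset Printing Implicit Defensive.

Import Order.TTheory GRing.Theory Num.Theory.
Import numFieldNormedType.Exports.

Local Open Scope classical_set_scope.
Local Open Scope ring_scope.

(* Put f_k = exp (- v_k), a function of period 1. Its recursion
   f_{k+1} (z) = E [f_k (z + zeta) ^ b] multiplies the ratio of consecutive
   Fourier coefficients by at most b (from the power) times
   theta = exp (- 2 pi^2 / beta) (from the Gaussian average), and b theta < 1
   means beta < beta_c. As f_0 is approximated uniformly by Gaussian averages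
   of multiples of cos (pi z) ^ (2 N), whose coefficients are nonnegative and
   unimodal, the relative oscillation of f_k is O((b theta)^k). So for k >= 1
   the density of the k-th transition law with respect to N(0, 1 / beta) lies
   between exp (- r) and exp r with r = O((b theta)^k): with probability
   exp (- 2 r) the DG increment can be set equal to the Gaussian one.
   The part of the law that remains has a density bounded above and below
   relative to the Gaussian law, uniformly in k. A quantile transport between
   two such laws moves points by a bounded amount, because a bounded shift
   changes Gaussian tails by any given factor; the same holds for k = 0, where
   the law lives on a translate of the integers. The transports are applied
   along the tree to independent pairs of a Gaussian and a Bernoulli variable. *)

(** The constant C must serve all k, although the part of the law left after switching has mass
    tending to zero. Its normalized density stays bounded because the switch has probability exp (-
    2 r) and not exp (- r): a density between exp (- r) and exp r then keeps at least exp (- r) -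
    exp (- 2 r) everywhere, which is of the order of the remaining mass, whereas removing exp (- r)
    could leave zero at some points. The DG increments depend on the ancestors, while Gaussian
    variables and switches must be independent. So all randomness sits in independent pairs, one per
    vertex, and the ancestors enter only as a parameter phi of a deterministic map. Its bounds are
    uniform in phi; what has to be tracked is joint measurability. The approximation of f_0 comes
    from its being, up to a constant, the Gaussian average of the Dirac comb on the integers:
    normalized powers cos (pi z) ^ (2 N) tend to this comb, and their Fourier coefficients are
    binomial. With polynomials in place of Fourier series only finite sums occur. *)

Section integral_of_set_function.
Context d (T : measurableType d) (R : realType).
Local Open Scope ereal_scope.

Import HBNNSimple.

Lemma sintegral_ext_measurable (m1 m2 : set T -> \bar R) (h : {nnsfun T >-> R}) :
  (forall A, measurable A -> m1 A = m2 A) -> sintegral m1 h = sintegral m2 h.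
Proof. by move=> m12; apply: eq_fsbigr => r _; rewrite m12. Qed.

(** Simple functions query a set function only on their fibres, which are measurable. This gives
    access to the integrals in [iterated_law], taken against the bare set function [trans_law]. *)
Lemma integral_ext_measurable (m1 m2 : set T -> \bar R) (D : set T)
    (f : T -> \bar R) :
  (forall A, measurable A -> m1 A = m2 A) ->
  \int[m1]_(x in D) f x = \int[m2]_(x in D) f x.
Proof.
move=> m12; rewrite /integral; congr (ereal_sup _ - ereal_sup _);
  by apply/seteqP; split => _ [h hf <-]; exists h => //;
  apply: sintegral_ext_measurable => A mA; rewrite m12.
Qed.

End integral_of_set_function.

(* [gauss_law] lives on the copy of [R] that carries the Borel sets under the
   display of Lebesgue measure; random variables use the display of [R]. *)
Section gaussian_probability.
Context {R : realType} (beta : R).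

Definition gauss_prob : set R -> \bar R := gauss_law beta.

Let gauss_prob0 : gauss_prob set0 = 0%E.
Proof. exact: (measure0 (gauss_law beta)). Qed.

Let gauss_prob_ge0 A : (0 <= gauss_prob A)%E.
Proof. exact: (measure_ge0 (gauss_law beta)). Qed.

Let gauss_prob_sigma_additive : semi_sigma_additive gauss_prob.
Proof.
move=> F mF tF mUF.
exact: (@measure_semi_sigma_additive _ (measurableTypeR R) _ (gauss_law beta) F).
Qed.

HB.instance Definition _ := isMeasure.Build _ R R gauss_prob
  gauss_prob0 gauss_prob_ge0 gauss_prob_sigma_additive.

Let gauss_prob_setT : gauss_prob setT = 1%E.
Proof. exact: (probability_setT (gauss_law beta)). Qed.

HB.instance Definition _ :=
  Measure_isProbability.Build _ R R gauss_prob gauss_prob_setT.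

(** The identity is measurable between the two displays and pushes one law to the other, so this is
    a change of variables. *)
Lemma integral_gauss_prob (A : set R) (f : R -> \bar R) :
  measurable A -> measurable_fun setT f -> (forall x, 0 <= f x)%E ->
  (\int[gauss_prob]_(x in A) f x = \int[gauss_law beta]_(x in A) f x)%E.
Proof.
move=> mA mf f0.
have mid : measurable_fun setT (idfun : measurableTypeR R -> R).
  by move=> _ B mB; rewrite setTI.
rewrite -(@integral_ext_measurable _ R R (pushforward (gauss_law beta) (idfun : measurableTypeR R -> R)))//.
rewrite (ge0_integral_pushforward mid)//; exact: measurable_funTS.
Qed.

Lemma integral_gauss_probT (f : R -> \bar R) :
  measurable_fun setT f -> (forall x, 0 <= f x)%E ->
  (\int[gauss_prob]_x f x = \int[gauss_law beta]_x f x)%E.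
Proof. exact: integral_gauss_prob. Qed.

End gaussian_probability.

Section product_integral.
Context d1 d2 (T1 : measurableType d1) (T2 : measurableType d2) (R : realType).
Variables (P1 : probability T1 R) (P2 : probability T2 R).
Local Open Scope ereal_scope.

Lemma integral_product_mul (f : T1 -> \bar R) (g : T2 -> \bar R) :
  measurable_fun setT f -> measurable_fun setT g ->
  (forall x, 0 <= f x) -> (forall x, 0 <= g x) ->
  \int[P1 \x P2]_z (f z.1 * g z.2) = \int[P1]_x f x * \int[P2]_y g y.
Proof.
move=> mf mg f0 g0.
rewrite fubini_tonelli1/=; first last.
- by move=> z; rewrite mule_ge0.
- by apply: emeasurable_funM; apply: measurableT_comp.
under eq_integral => x _ do rewrite /fubini_F/= ge0_integralZl//.
by rewrite ge0_integralZr// integral_ge0.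
Qed.

Lemma integral_product_fst (f : T1 -> \bar R) :
  measurable_fun setT f -> (forall x, 0 <= f x) ->
  \int[P1 \x P2]_z f z.1 = \int[P1]_x f x.
Proof.
move=> mf f0; transitivity (\int[P1]_x f x * \int[P2]_y cst 1 y).
  rewrite -integral_product_mul//.
  by apply: eq_integral => z _; rewrite mule1.
by rewrite integral_cst//= probability_setT mule1 mule1.
Qed.

Lemma integral_product_snd (g : T2 -> \bar R) :
  measurable_fun setT g -> (forall x, 0 <= g x) ->
  \int[P1 \x P2]_z g z.2 = \int[P2]_y g y.
Proof.
move=> mg g0; transitivity (\int[P1]_x cst 1 x * \int[P2]_y g y).
  rewrite -integral_product_mul//.
  by apply: eq_integral => z _; rewrite mul1e.
by rewrite integral_cst//= probability_setT mule1 mul1e.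
Qed.

End product_integral.

(** * The probability space indexed by the tree *)

Lemma measurable_seq_forall d (T : measurableType d) (I : eqType) (s : seq I)
    (D : I -> T -> Prop) :
  (forall i, measurable [set w | D i w]) ->
  measurable [set w | forall i, i \in s -> D i w].
Proof.
move=> mD; elim: s => [|i s IH].
  by rewrite (_ : [set w | _] = setT)//; apply/seteqP; split.
rewrite (_ : [set w | _] =
    [set w | D i w] `&` [set w | forall j, j \in s -> D j w]).
  exact: measurableI.
apply/seteqP; split=> w /= => [h|[Di h] j].
  by split=> [|j js]; apply: h; rewrite inE ?eqxx// js orbT.
by rewrite inE => /predU1P[->//|]; exact: h.
Qed.

Section dg_recursion.
Context {R : realType} {b : nat} {S : Type}.
Variables (n : nat) (step : nat -> R -> S -> R).
Notation V := (nat * seq 'I_b)%type.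
Implicit Types (s : seq V) (v : V) (zeta : nat -> seq 'I_b -> R) (W : V -> S).

Definition vertex_step v zeta (a : S) : R :=
  step (n - v.1)%N (partial_sum zeta v.1.-1 (drop_last v.2)) a.

(** The recursion peels off vertices in the same order as [iterated_law], so that one induction on
    [s] computes the law of the field. *)
Fixpoint dg_field s zeta W : nat -> seq 'I_b -> R :=
  if s is v :: s' then dg_field s' (update zeta v (vertex_step v zeta (W v))) W
  else zeta.

Lemma dg_field_notin s zeta W v :
  v \notin s -> dg_field s zeta W v.1 v.2 = zeta v.1 v.2.
Proof.
elim: s zeta => //= u s IH zeta; rewrite inE negb_or => /andP[vu vs].
by rewrite IH// /update -surjective_pairing (negbTE vu).
Qed.

(** The sum at the parent is left unspecified: closeness to the Gaussian variable and the effect of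
    the switch hold for every [phi]. *)
Lemma dg_field_in s zeta W v : v \in s ->
  exists phi, dg_field s zeta W v.1 v.2 = step (n - v.1)%N phi (W v).
Proof.
elim: s zeta => //= u s IH zeta; have [vs _|vs] := boolP (v \in s).
  exact: IH.
rewrite inE (negbTE vs) orbF => /eqP vu; subst u.
rewrite dg_field_notin// /update -surjective_pairing eqxx.
by exists (partial_sum zeta v.1.-1 (drop_last v.2)).
Qed.

Lemma eq_dg_field s zeta W W' : {in s, W =1 W'} ->
  dg_field s zeta W = dg_field s zeta W'.
Proof.
elim: s zeta => //= u s IH zeta WW'; rewrite WW' ?mem_head//.
by apply: IH => v vs; apply: WW'; rewrite inE vs orbT.
Qed.

End dg_recursion.

Section measurable_dg_field.
Context {R : realType} {b : nat} d (S : measurableType d).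
Variables (n : nat) (step : nat -> R -> S -> R).
Hypothesis mstep :
  forall k, measurable_fun setT (fun y : R * S => step k y.1 y.2).
Notation V := (nat * seq 'I_b)%type.

(** The initial field may vary with [y] because peeling off a vertex makes its random value part of
    the initial field. *)
Lemma measurable_dg_field d' (Y : measurableType d') (s : seq V)
    (zeta : Y -> nat -> seq 'I_b -> R) (W : Y -> V -> S) :
  (forall k x, measurable_fun setT (fun y => zeta y k x)) ->
  (forall v, measurable_fun setT (fun y => W y v)) ->
  forall k x, measurable_fun setT (fun y => dg_field n step s (zeta y) (W y) k x).
Proof.
elim: s zeta => //= v s IH zeta mzeta mW; apply: IH => // k x.
rewrite /update; case: ((k, x) == v) => //.
rewrite /vertex_step.
apply: (measurableT_comp (f := fun y : R * S => step (n - v.1)%N y.1 y.2)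
  (g := fun y => (partial_sum (zeta y) v.1.-1 (drop_last v.2), W y v))) => //.
apply: measurable_fun_pair => //.
by rewrite /partial_sum; apply: measurable_sum => j; exact: mzeta.
Qed.

End measurable_dg_field.

Section tree_space.
Context {R : realType} {b : nat} (beta : R) (n : nat).
Context d1 d2 (S1 : measurableType d1) (S2 : measurableType d2).
Variables (P1 : probability S1 R) (P2 : nat -> probability S2 R).
Notation S := (S1 * S2)%type.
Variable step : nat -> R -> S -> R.
Hypothesis mstep :
  forall k, measurable_fun setT (fun y : R * S => step k y.1 y.2).
Hypothesis law_step : forall k phi A, measurable A ->
  (P1 \x P2 k)%E (step k phi @^-1` A) = trans_law b beta k phi A.
Notation V := (nat * seq 'I_b)%type.

Let mstep1 k phi : measurable_fun setT (step k phi).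
Proof.
apply: (measurableT_comp (f := fun y : R * S => step k y.1 y.2)
  (g := fun a => (phi, a))) => //.
exact: measurable_fun_pair.
Qed.

(* Independence is stated for measurable sets that depend on one of the two
   kinds of coordinates only: this class contains the generated sigma-algebra
   and passes to sections, which is what the induction needs. *)
Lemma tree_space (s : seq V) : uniq s ->
  exists (d : measure_display) (Om : measurableType d)
      (P : probability Om R) (W : V -> Om -> S),
  [/\ forall v, measurable_fun setT (W v),
      forall A : V -> set S, (forall v, measurable (A v)) ->
        P [set w | forall v, v \in s -> A v (W v w)] =
        (\prod_(v <- s) (P1 \x P2 (n - v.1)%N) (A v))%E,
      forall (A : nat -> seq 'I_b -> set R) zeta,
        (forall k x, measurable (A k x)) ->
        P [set w | forall v, v \in s ->
             A v.1 v.2 (dg_field n step s zeta (W^~ w) v.1 v.2)] =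
        iterated_law beta n A s zeta &
      forall E F : set Om, measurable E -> measurable F ->
        (forall w w', (forall v, (W v w).1 = (W v w').1) -> E w -> E w') ->
        (forall w w', (forall v, (W v w).2 = (W v w').2) -> F w -> F w') ->
        P (E `&` F) = (P E * P F)%E].
Proof.
elim: s => [_|v0 s IH /= /andP[v0s us]].
  exists _, unit, (@dirac _ unit tt R), (fun _ _ => (point, point)).
  split=> //=.
  - move=> A mA; rewrite big_nil (_ : [set w | _] = setT).
      by rewrite probability_setT.
    by apply/seteqP; split.
  - move=> A zeta mA; rewrite (_ : [set w | _] = setT).
      by rewrite probability_setT.
    by apply/seteqP; split.
  - move=> E F mE mF sE sF; rewrite !diracE.
    by rewrite in_setI; do 2!case: (_ \in _); rewrite ?(mule0, mul0e, mule1).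
have [d [Om [P [W [mW rectW lawW indW]]]]] := IH us.
pose mu := (P1 \x P2 (n - v0.1)%N)%E.
pose W' v (w : S * Om) := if v == v0 then w.1 else W v w.2.
have W'0 w : W' v0 w = w.1 by rewrite /W' eqxx.
have W's v w : v \in s -> W' v w = W v w.2.
  by rewrite /W'; case: eqP => // -> h; move: v0s; rewrite h.
have mW' v : measurable_fun setT (W' v).
  rewrite /W'; case: eqP => // _; exact: measurableT_comp.
exists _, (S * Om)%type, (mu \x P)%E, W'.
split=> // [A mA|A zeta mA|E F mE mF sE sF].
- rewrite big_cons -rectW//.
  rewrite -product_measure1E//; last first.
    apply: measurable_seq_forall => v; rewrite -[X in measurable X]setTI.
    exact: mW.
  congr (_ _); apply/seteqP; split=> [w /= h|w /= [h0 h] v].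
    split; first by rewrite -W'0; apply: h; rewrite mem_head.
    by move=> v vs; rewrite -W's//; apply: h; rewrite inE vs orbT.
  by rewrite inE => /predU1P[->|vs]; rewrite ?W'0// W's//; exact: h.
- set phi := partial_sum zeta v0.1.-1 (drop_last v0.2).
  pose H z := iterated_law beta n A s (update zeta v0 z).
  pose st := step (n - v0.1)%N phi.
  (* The induction hypothesis identifies [H z] with the probability of the section at z of one
     measurable set [G], and such probabilities are measurable in z. *)
  have mH : measurable_fun setT H.
    pose G : set (R * Om) := [set w | forall v, v \in s ->
      A v.1 v.2 (dg_field n step s (update zeta v0 w.1) (W^~ w.2) v.1 v.2)].
    have mG : measurable G.
      apply: measurable_seq_forall => v; rewrite -[X in measurable X]setTI.
      apply: measurable_dg_field => //.
        move=> k x; rewrite /update; case: ((k, x) == v0). by move=>*; exact: measurable_fst. by [].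
      by move=> u; exact: measurableT_comp.
    rewrite (_ : H = P \o xsection G); first exact: measurable_fun_xsection.
    apply/funext => z; rewrite /H -lawW//=; congr (P _).
    by apply/seteqP; split=> w; rewrite /xsection /= inE.
  have H0 z : (0 <= H z)%E by rewrite /H -lawW.
  (* By Fubini: once the noise a of [v0] is fixed, its own constraint becomes the restriction of [H]
     to [A v0.1 v0.2], and the remaining constraints have probability [H (st a)]. *)
  transitivity (\int[mu]_a ((H \_ (A v0.1 v0.2)) (st a)))%E.
    rewrite /product_measure1; apply: eq_integral => a _ /=.
    rewrite patchE; case: ifPn; rewrite (inE, notin_setE) => Ast.
      rewrite /H -lawW//; congr (P _); apply/seteqP; split=> w.
        rewrite /xsection/= inE/= => h v vs; have := h v _.
        rewrite inE vs orbT => /(_ isT); rewrite W'0/=.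
        rewrite -[update _ _ _]/(update zeta v0 (st a)).
        by rewrite (@eq_dg_field _ _ _ _ _ _ _ _ (W^~ w))// => u us'; rewrite W's.
      rewrite /xsection/= inE/= => h v; rewrite W'0/=.
      rewrite -[update _ _ _]/(update zeta v0 (st a)).
      rewrite (@eq_dg_field _ _ _ _ _ _ _ _ (W^~ w)); last first.
        by move=> u us'; rewrite W's.
      rewrite inE => /predU1P[->|]; last exact: h.
      by rewrite dg_field_notin// /update -surjective_pairing eqxx.
    rewrite [X in P X](_ : _ = set0) ?measure0//; apply/seteqP; split=> w //.
    rewrite /xsection/= inE/= => /(_ v0); rewrite mem_head => /(_ isT).
    rewrite dg_field_notin// /update -surjective_pairing eqxx W'0//.
  have mHA : measurable_fun setT (H \_ (A v0.1 v0.2)).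
    by apply/(measurable_restrictT _ _).1 => //; exact: measurable_funTS.
  have H00 : {in [set: R], forall z, (0 <= (H \_ (A v0.1 v0.2)) z)%E}.
    by move=> z _; exact: erestrict_ge0.
  rewrite -(ge0_integral_pushforward (mstep1 (n - v0.1)%N phi) mu measurableT mHA H00).
  rewrite -integral_mkcond.
  case: (v0) @phi @H @st {mH H0 H00 mHA W'0 W's mW' v0s} => k x phi H st /=.
  rewrite -/phi -/H.
  (* The pushforward of [mu] and [trans_law] are only known to agree on measurable sets. *)
  apply: integral_ext_measurable => B mB.
  by rewrite -law_step.
(* Saturation makes the section of [E] at a depend on [a.1] alone and that of [F] on [a.2] alone, so
   [point] is an arbitrary filler. The two section probabilities are then independent under [mu]. *)
- pose fE x := P (xsection E (x, point)).
  pose fF y := P (xsection F (point, y)).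
  have EfE a : xsection E a = xsection E (a.1, point).
    apply/seteqP; split=> w; rewrite /xsection/= !inE; apply: sE => v;
      by rewrite /W'; case: eqP.
  have FfF a : xsection F a = xsection F (point, a.2).
    apply/seteqP; split=> w; rewrite /xsection/= !inE; apply: sF => v;
      by rewrite /W'; case: eqP.
  have mfE : measurable_fun setT fE.
    apply: (measurableT_comp (measurable_fun_xsection P mE)).
    exact: measurable_fun_pair.
  have mfF : measurable_fun setT fF.
    apply: (measurableT_comp (measurable_fun_xsection P mF)).
    exact: measurable_fun_pair.
  rewrite /product_measure1.
  transitivity (\int[mu]_a (fE a.1 * fF a.2))%E.
    apply: eq_integral => a _ /=; rewrite xsectionI indW.
    - by rewrite EfE FfF.
    - exact: measurable_xsection.
    - exact: measurable_xsection.
    - move=> w w' ww'; rewrite /xsection/= !inE; apply: sE => v.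
      by rewrite /W'; case: eqP.
    - move=> w w' ww'; rewrite /xsection/= !inE; apply: sF => v.
      by rewrite /W'; case: eqP.
  rewrite integral_product_mul//; congr (_ * _)%E.
    rewrite -(@integral_product_fst _ _ _ _ _ P1 (P2 (n - v0.1)%N))//.
    by apply: eq_integral => a _ /=; rewrite EfE.
  rewrite -(@integral_product_snd _ _ _ _ _ P1 (P2 (n - v0.1)%N))//.
  by apply: eq_integral => a _ /=; rewrite FfF.
Qed.
End tree_space.

Section independence_from_rectangles.
Context {R : realType} d (Om : measurableType d) (P : probability Om R).
Context (I : choiceType) d' (T : measurableType d').
Variables (s : seq I) (X : I -> {RV P >-> T}) (m : I -> probability T R).
Hypothesis us : uniq s.
Hypothesis rectX : forall A : I -> set T, (forall i, measurable (A i)) ->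
  P [set w | forall i, i \in s -> A i (X i w)] = (\prod_(i <- s) m i (A i))%E.

Lemma law_of_rectangle i A : i \in s -> measurable A ->
  P (X i @^-1` A) = m i A.
Proof.
move=> is_ mA; pose B j := if j == i then A else setT.
have mB j : measurable (B j) by rewrite /B; case: eqP.
transitivity (P [set w | forall j, j \in s -> B j (X j w)]).
  congr (P _); apply/seteqP; split=> w /= h.
    by move=> j _; rewrite /B; case: eqP => // ->.
  by have := h i is_; rewrite /B eqxx.
rewrite rectX// (bigD1_seq i)//= big1 ?mule1 /B ?eqxx// => j /negbTE ->.
exact: probability_setT.
Qed.

Lemma independent_of_rectangle : mutually_independent [set` s] X.
Proof.
move=> J A Js mA; pose B j := if j \in J then A j else setT.
have mB j : measurable (B j) by rewrite /B; case: ifP.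
transitivity (P [set w | forall j, j \in s -> B j (X j w)]).
  congr (P _); apply/seteqP; split=> w /= h j.
    by move=> _; rewrite /B; case: ifPn => // jJ; exact: h.
  by move=> jJ; have := h j (Js _ jJ); rewrite /B jJ.
rewrite rectX// (bigID (mem J))/= [X in (_ * X)%E]big1 ?mule1; last first.
  by move=> j /negbTE jJ; rewrite /B jJ probability_setT.
rewrite -big_filter; have pJ : perm_eq [seq i <- s | i \in J] J.
  apply: uniq_perm; rewrite ?filter_uniq// => j; rewrite mem_filter.
  by have [jJ|//] := boolP (j \in J); rewrite (Js j jJ).
rewrite (perm_big _ pJ)/= big_seq [RHS]big_seq; apply: eq_bigr => j jJ.
by rewrite /B jJ law_of_rectangle//; exact: Js.
Qed.

End independence_from_rectangles.

Lemma sigma_family_sub {R : realType} d (Om : measurableType d)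
    (P : probability Om R) (I : Type) d' (T : measurableType d') (D : set I)
    (X : I -> {RV P >-> T}) (C : set (set Om)) :
  sigma_algebra setT C ->
  (forall i A, D i -> measurable A -> C (X i @^-1` A)) ->
  sigma_family D X `<=` C.
Proof.
move=> sC XC; apply: smallest_sub => // _ [i Di] [A mA <-].
by rewrite setTI; exact: XC.
Qed.

(** Saturation expresses that an event depends only on the coordinates compared by [eqv]; symmetry
    of [eqv] gives stability under complements. *)
Lemma sigma_algebra_saturated d (Om : measurableType d)
    (eqv : Om -> Om -> Prop) :
  (forall w w', eqv w w' -> eqv w' w) ->
  sigma_algebra setT [set E : set Om |
    measurable E /\ forall w w', eqv w w' -> E w -> E w'].
Proof.
move=> eqvC; split=> /=.
- by split.
- move=> A [mA sA]; split; first exact: measurableD.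
  move=> w w' ww' [_ nAw]; split=> // Aw'; apply: nAw; apply: sA Aw'.
  exact: eqvC.
- move=> F hF; split; first by apply: bigcup_measurable => k _; case: (hF k).
  move=> w w' ww' [k _ Fw]; exists k => //; exact: (hF k).2 Fw.
Qed.

Section vertices_theory.
Variable b : nat.

Lemma mem_vertices n (v : nat * seq 'I_b) :
  (v \in vertices b n) = (1 <= v.1 <= n)%N && (size v.2 == v.1).
Proof.
case: v => k x /=; apply/allpairsPdep/idP => [[j [t [jn _ [-> ->]]]]|].
  by rewrite size_tuple eqxx andbT; move: jn; rewrite mem_iota add1n ltnS.
case/andP => kn /eqP xk; exists k, (Tuple (introT eqP xk)); split=> //.
  by rewrite mem_iota add1n ltnS.
by rewrite mem_enum.
Qed.

Lemma vertices_uniq n : uniq (vertices b n).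
Proof.
apply: allpairs_uniq_dep; rewrite ?iota_uniq//.
- by move=> k _; exact: enum_uniq.
- case=> k t [k' t'] _ _ [kk' tt'] /=.
  by move: t t' tt'; rewrite kk' => t t' /val_inj ->.
Qed.

Lemma size_drop_last (T : Type) (x : seq T) : size (drop_last x) = (size x).-1.
Proof. by rewrite /drop_last size_take; case: (size x) => // k; rewrite ltnSn. Qed.

Lemma size_iter_drop_last (T : Type) k (x : seq T) :
  size (iter k (@drop_last T) x) = (size x - k)%N.
Proof. by elim: k => [|k IH]; rewrite ?subn0//= size_drop_last IH subnS. Qed.

End vertices_theory.

Section random_variable_of.
Context {R : realType} d (Om : measurableType d) (P : probability Om R).
Context d' (T : measurableType d') (f : Om -> T).
Hypothesis mf : measurable_fun setT f.

Definition rv_of : {RV P >-> T} :=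
  HB.pack_for {mfun Om >-> T} f (isMeasurableFun.Build _ _ _ _ f mf).

End random_variable_of.

(** * Assembly of the coupling from maps at single vertices *)

Section coupling.
Context {R : realType} {b : nat} (beta C : R) (r : nat -> R).
Variable step : nat -> R -> R * bool -> R.
Hypothesis mstep :
  forall k, measurable_fun setT (fun y : R * (R * bool) => step k y.1 y.2).
Hypothesis law_step : forall k phi A, measurable A ->
  (gauss_prob beta \x bernoulli_prob (expR (- r k)))%E (step k phi @^-1` A) =
  trans_law b beta k phi A.
Hypothesis step_near : forall k phi a, `|step k phi a - a.1| <= C.
Hypothesis step_switch :
  forall k phi z, (1 <= k)%N -> step k phi (z, true) = z.
Hypothesis r_gt0 : forall k, 0 < r k.

(** Reduces the theorem to a single vertex: the pair at a vertex of depth [n - k] feeds [step k],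
    and its two components serve as Gaussian increment and switch. *)
Lemma coupling_of_steps (n : nat) :
  exists (d : measure_display) (Om : measurableType d)
         (P : probability Om R)
         (zetaDG zetaGFF : nat -> seq 'I_b -> {RV P >-> R})
         (B : nat -> seq 'I_b -> {RV P >-> bool}),
    let xiDG := increment n zetaDG in
    let xiGFF := increment n zetaGFF in
    (has_dg_law beta n zetaDG /\ has_gff_law beta n zetaGFF) /\
    [/\ (mutually_independent (switch_index b n)
           (fun v => B v.1 v.2) /\
         forall (k : nat) (x : seq 'I_b),
           (1 <= k < n)%N -> size x = (n - k)%N ->
           P [set w | B k x w = true] = (expR (- r k))%:E),
        independent_families
          (increment_index b n) (fun v => xiGFF v.1 v.2)
          (switch_index b n) (fun v => B v.1 v.2),
        (forall (k : nat) (x : seq 'I_b),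
           (1 <= k < n)%N -> size x = n ->
           forall w : Om,
             B k (iter k (@drop_last 'I_b) x) w = true ->
             xiDG k x w = xiGFF k x w) &
        (forall (k : nat) (x : seq 'I_b),
           (k < n)%N -> size x = n ->
           P [set w | C < `|xiDG k x w - xiGFF k x w|] = 0%E)].
Proof.
have [d [Om [P [W [mW rectW lawW indW]]]]] :=
  tree_space n mstep law_step (vertices_uniq b n).
have mDG k x : measurable_fun setT (fun w =>
    dg_field n step (vertices b n) (fun _ _ => 0) (W^~ w) k x).
  exact: measurable_dg_field.
have mGFF k x : measurable_fun setT (fun w => (W (k, x) w).1).
  exact: measurableT_comp.
have mB k x : measurable_fun setT (fun w => (W ((n - k)%N, x) w).2).
  exact: measurableT_comp.
exists d, Om, P, (fun k x => rv_of P (mDG k x)), (fun k x => rv_of P (mGFF k x)),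
  (fun k x => rv_of P (mB k x)).
have tree_vertices : tree_index b n = [set` vertices b n].
  apply/seteqP; split=> v /=; rewrite mem_vertices.
    by case=> v1 /eqP v2; apply/andP.
  by case/andP => v1 /eqP v2; split.
(* Noises are indexed by depth, switches by the height k, which is n minus the depth. The bound
   [v.1 < n] drops the leaves, where k = 0 and the bit is no switch. *)
pose sB : seq (nat * seq 'I_b) :=
  [seq ((n - v.1)%N, v.2) | v <- vertices b n & (v.1 < n)%N].
have mem_sB v : (v \in sB) = (1 <= v.1 < n)%N && (size v.2 == (n - v.1)%N).
  apply/mapP/idP => [[u]|].
    rewrite mem_filter mem_vertices => /and3P[un u1 /eqP su] -> /=.
    by rewrite su; apply/andP; split; [lia|apply/eqP; lia].
  case: v => k x /= /andP[k1 /eqP sx]; exists ((n - k)%N, x) => /=.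
    by rewrite mem_filter mem_vertices /= sx eqxx andbT; lia.
  by congr (_, _); lia.
have switch_sB : switch_index b n = [set` sB].
  apply/seteqP; split=> v /=; rewrite mem_sB.
    by case=> v1 /eqP v2; apply/andP.
  by case/andP => v1 /eqP v2; split.
have usB : uniq sB.
  rewrite map_inj_in_uniq ?filter_uniq ?vertices_uniq// => -[k x] [k' x'].
  rewrite !mem_filter !mem_vertices /= => /and3P[kn k1 _] /and3P[k'n k'1 _] [].
  by move=> e ->; congr (_, _); lia.
have rectGFF (A : nat * seq 'I_b -> set R) : (forall v, measurable (A v)) ->
    P [set w | forall v, v \in vertices b n ->
       A v ((fun v => rv_of P (mGFF v.1 v.2)) v w)] =
    (\prod_(v <- vertices b n) gauss_prob beta (A v))%E.
  move=> mA; transitivity (P [set w | forall v, v \in vertices b n ->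
       (A v `*` setT) (W v w)]).
    congr (P _); apply/seteqP; split=> w /= h [k x] /h; first by move=> Ah; split.
    by case.
  rewrite (rectW (fun v => A v `*` setT)) => [|v]; last exact: measurableX.
  apply: eq_bigr => v _; rewrite product_measure1E//.
  by rewrite /= probability_setT mule1.
have rectB (A : nat * seq 'I_b -> set bool) : (forall v, measurable (A v)) ->
    P [set w | forall v, v \in sB ->
       A v ((fun v => rv_of P (mB v.1 v.2)) v w)] =
    (\prod_(v <- sB) bernoulli_prob (expR (- r v.1)) (A v))%E.
  move=> mA.
  (* Reindexed by depth, the constraints bear only on the bits of inner vertices; Gaussian
     components and leaves are free. *)
  pose A' v : set (R * bool) :=
    if (v.1 < n)%N then setT `*` A ((n - v.1)%N, v.2) else setT.
  transitivity (P [set w | forall v, v \in vertices b n -> A' v (W v w)]).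
    congr (P _); apply/seteqP; split=> w /= h [k x].
      move=> kx; rewrite /A'; case: ifP => //= kn; split=> //.
      have := h ((n - k)%N, x) _ => /=; rewrite (_ : (n - (n - k) = k)%N); last lia.
      by apply; apply/mapP; exists (k, x) => //; rewrite mem_filter kn.
    rewrite mem_sB /= => /andP[k1 /eqP sx].
    have := h ((n - k)%N, x); rewrite mem_vertices /= sx eqxx andbT /A' /=.
    rewrite ifT; last by lia.
    rewrite (_ : (n - (n - k) = k)%N); last lia.
    by case=> //; lia.
  rewrite (rectW A') => [|v]; last by rewrite /A'; case: ifP => // _; exact: measurableX.
  rewrite /sB big_map big_filter [RHS]big_mkcond/=.
  rewrite big_seq [RHS]big_seq; apply: eq_bigr => v.
  rewrite mem_vertices => /andP[v1 _]; rewrite /A'; case: ifP => vn.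
    rewrite product_measure1E//= [X in (X * _)%E]probability_setT mul1e//.
  exact: probability_setT.
have vertexP k x : (k < n)%N -> size x = n ->
    ((n - k)%N, iter k (@drop_last 'I_b) x) \in vertices b n.
  move=> kn sx; rewrite mem_vertices /= size_iter_drop_last sx eqxx andbT; lia.
have incrE k x w : (k < n)%N -> size x = n -> exists phi,
    dg_field n step (vertices b n) (fun _ _ => 0) (W^~ w) (n - k)%N
      (iter k (@drop_last 'I_b) x) =
    step k phi (W ((n - k)%N, iter k (@drop_last 'I_b) x) w).
  move=> kn sx; have [phi] := dg_field_in n step (fun _ _ => 0) (W^~ w) (vertexP _ _ kn sx).
  by move=> /= ->; exists phi; rewrite (_ : (n - (n - k) = k)%N)//; lia.
split; first split.
- move=> A mA; rewrite -lawW//; congr (P _); apply/seteqP; split=> w /= h.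
    by move=> [k x] kx; apply: h; rewrite tree_vertices.
  by move=> k x; rewrite tree_vertices => /h.
- split.
    rewrite tree_vertices.
    exact: (independent_of_rectangle (vertices_uniq b n) rectGFF).
  move=> k x; rewrite tree_vertices => kx A mA.
  exact: (law_of_rectangle (vertices_uniq b n) rectGFF kx mA).
- split.
  + split; first by rewrite switch_sB; exact: (independent_of_rectangle usB rectB).
    move=> k x k1 sx; have kx : (k, x) \in sB by rewrite mem_sB /= k1 sx eqxx.
    have mtrue : measurable [set true] by [].
    rewrite [LHS](law_of_rectangle usB rectB kx mtrue) /=.
    rewrite /bernoulli_prob ifT ?fsbig_set1//.
    by rewrite expR_ge0 -expR0 ler_expR oppr_le0 ltW.
  + move=> E F sE sF.
    (* Events of the first family are saturated for equality of all Gaussian components, those of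
       the second for equality of all bits, as [indW] requires. *)
    have [mE satE] : [set E : set Om | measurable E /\ forall w w',
        (forall v, (W v w).1 = (W v w').1) -> E w -> E w'] E.
      apply: sigma_family_sub sE.
        by apply: sigma_algebra_saturated => w w' h v; rewrite h.
      move=> [k x] A [/= kn sx] mA; split.
        by rewrite -[X in measurable X]setTI; exact: (mGFF _ _ measurableT).
      by move=> w w' h /=; rewrite h.
    have [mF satF] : [set E : set Om | measurable E /\ forall w w',
        (forall v, (W v w).2 = (W v w').2) -> E w -> E w'] F.
      apply: sigma_family_sub sF.
        by apply: sigma_algebra_saturated => w w' h v; rewrite h.
      move=> [k x] A [/= kn sx] mA; split.
        by rewrite -[X in measurable X]setTI; exact: (mB _ _ measurableT).
      by move=> w w' h /=; rewrite h.
    exact: indW.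
  + move=> k x /andP[k1 kn] sx w Bw.
    rewrite /increment /=; have [phi ->] := incrE k x w kn sx.
    move: Bw => /=.
    by case: (W _ w) => z [] //= _; rewrite step_switch.
  (* The exceptional event is empty, since [step_near] holds everywhere. *)
  + move=> k x kn sx; rewrite [X in P X](_ : _ = set0) ?measure0//.
    apply/seteqP; split=> w //=; rewrite /increment /=.
    have [phi ->] := incrE k x w kn sx.
    by rewrite ltNge step_near.
Qed.

End coupling.

(** * Transport by quantiles *)

Section lebesgue_shift.
Context {R : realType}.
Notation M := (@lebesgue_measure R).
Local Open Scope ereal_scope.

Lemma measurable_shift (c : R) :
  measurable_fun setT ((fun x => x + c)%R : measurableTypeR R -> measurableTypeR R).
Proof. exact: measurable_funD. Qed.

Lemma lebesgue_measure_shift (c : R) (A : set R) : measurable A ->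
  pushforward M ((fun x => x + c)%R : measurableTypeR R -> measurableTypeR R) A =
  M A.
Proof.
move=> mA; have mc := measurable_shift c.
apply/esym/(lebesgue_measure_unique (mu := pushforward M _)) => //.
move=> _ [[a b] _ <-].
transitivity (M `](a - c)%R, (b - c)%R]%classic); last first.
  congr (M _); apply/seteqP; split=> x /=;
    by rewrite !in_itv/= ltrBlDr lerBrDr.
rewrite !lebesgue_measure_itv/= !lte_fin ltrD2; case: ifP => // _.
by rewrite -!EFinD; congr EFin; ring.
Qed.

Lemma ge0_integral_shift (c : R) (D : set R) (f : R -> \bar R) :
  measurable D -> measurable_fun setT f -> (forall x, 0 <= f x) ->
  \int[M]_(x in D) f x = \int[M]_(x in [set x | D (x + c)%R]) f (x + c)%R.
Proof.
move=> mD mf f0; have mc := measurable_shift c.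
transitivity (\int[pushforward M
    ((fun x => x + c)%R : measurableTypeR R -> measurableTypeR R)]_(x in D) f x).
  apply: integral_ext_measurable => A mA.
  by rewrite lebesgue_measure_shift.
by rewrite (ge0_integral_pushforward mc)//; exact: measurable_funTS.
Qed.

Lemma ge0_integral_shiftT (c : R) (f : R -> \bar R) :
  measurable_fun setT f -> (forall x, 0 <= f x) ->
  \int[M]_x f (x + c)%R = \int[M]_x f x.
Proof. by move=> mf f0; rewrite [RHS](ge0_integral_shift c). Qed.

Lemma ge0_integral_oppr (f : R -> \bar R) :
  measurable_fun setT f -> (forall x, 0 <= f x) ->
  \int[M]_x f x = \int[M]_x f (- x)%R.
Proof.
move=> mf f0.
transitivity (\int[pushforward M (-%R : measurableTypeR R -> measurableTypeR R)]_x f x).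
  apply: integral_ext_measurable => A mA.
  exact/esym/lebesgue_measureN.
by rewrite (ge0_integral_pushforward)//.
Qed.

End lebesgue_shift.

Section distribution_function.
Context {R : realType} (P : probability R R).

Definition dfun (t : R) : R := fine (P `]-oo, t]%classic).

Lemma dfunE (t : R) : P `]-oo, t]%classic = (dfun t)%:E.
Proof. by rewrite fineK// fin_num_measure. Qed.

Lemma dfun_tail (t : R) : P `]t, +oo[%classic = (1 - dfun t)%:E.
Proof.
rewrite EFinB -dfunE -(probability_setC P)//; congr (P _).
by rewrite setCitvl.
Qed.

Lemma dfun_itv (s t : R) : s <= t -> P `]s, t]%classic = (dfun t - dfun s)%:E.
Proof.
move=> st; rewrite EFinB -!dfunE.
have -> : `]s, t]%classic = `]-oo, t]%classic `\` `]-oo, s]%classic.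
  apply/seteqP; split=> x /=; rewrite !in_itv/=.
    by case/andP => sx ->; split=> //; apply/negP; rewrite -ltNge.
  by move=> [-> /negP]; rewrite -ltNge => ->.
rewrite measureD// ?setIidr//; last by rewrite ltey_eq fin_num_measure.
by move=> x /=; rewrite !in_itv/= => /le_trans; exact.
Qed.

Lemma dfun_nondecreasing (s t : R) : s <= t -> dfun s <= dfun t.
Proof.
move=> st; rewrite -subr_ge0 -lee_fin -dfun_itv//; exact: measure_ge0.
Qed.

Lemma dfun_ge0 (t : R) : 0 <= dfun t.
Proof. exact: fine_ge0. Qed.

Lemma dfun_le1 (t : R) : dfun t <= 1.
Proof. by rewrite -lee_fin -dfunE probability_le1. Qed.

(** Right continuity in the closed form needed to see that the infimum in a quantile is attained. *)
Lemma dfun_right_continuous (x t : R) :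
  (forall s, t < s -> x <= dfun s) -> x <= dfun t.
Proof.
move=> xs; have mid : measurable_fun setT (@idfun R) by exact: measurable_id.
pose X := (HB.pack_for {mfun R >-> R} (@idfun R)
  (isMeasurableFun.Build _ _ _ _ (@idfun R) mid) : {RV P >-> R}).
have := @cdf_right_continuous _ _ _ P X t.
have -> : cdf X = EFin \o dfun by apply/funext => u; rewrite /= -dfunE.
move=> ct; rewrite -lee_fin; rewrite -[leRHS](cvg_lim _ ct)//.
apply: lime_ge; first by apply/cvg_ex; exists (dfun t)%:E.
by near=> s; rewrite /= lee_fin; apply: xs; near: s; exact: nbhs_right_gt.
Unshelve. all: end_near. Qed.

End distribution_function.

(** The rays []x, +oo[] are stable under intersection, generate the Borel sets and exhaust the
    line. *)
Lemma eq_probability_dfun {R : realType} (P Q : probability R R) :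
  dfun P =1 dfun Q -> forall A : set R, measurable A -> P A = Q A.
Proof.
move=> PQ A mA.
have setIG : setI_closed (@RGenOInfty.G R).
  move=> _ _ [x ->] [y ->]; exists (Order.max x y).
  by apply/seteqP; split=> z /=; rewrite !in_itv/= !andbT gt_max;
    [case=> -> ->|case/andP].
pose g n : set R := `](- n%:R), +oo[%classic.
have Gg n : @RGenOInfty.G R (g n) by exists (- n%:R).
have gT : \bigcup_k g k = setT.
  rewrite -subTset => x _; exists (Num.bound `|x|) => //; rewrite /g/=.
  rewrite in_itv/= andbT ltrNl.
  by apply: le_lt_trans (archi_boundP (normr_ge0 x)); rewrite -normrN ler_norm.
have PQG B : @RGenOInfty.G R B -> P B = Q B.
  by move=> [x ->]; rewrite !dfun_tail PQ.
have gfin k : (P (g k) < +oo)%E.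
  by rewrite ltey_eq fin_num_measure//; exact: measurable_itv.
refine (measure_unique _ g (RGenOInfty.measurableE R) setIG Gg gT _ _ PQG gfin A mA).
Qed.

Section gaussian_density.
Context {R : realType} (beta : R).
Hypothesis beta_gt0 : 0 < beta.
Notation M := (@lebesgue_measure R).
Notation gauss := (gauss_prob beta).

Definition gauss_dens (x : R) := normal_pdf 0 (Num.sqrt beta^-1) x.
Definition gauss_peak : R := normal_peak (Num.sqrt beta^-1).

Lemma sqrt_invr_neq0 : Num.sqrt beta^-1 != 0.
Proof. by rewrite sqrtr_eq0 -ltNge invr_gt0. Qed.

Lemma gauss_peak_gt0 : 0 < gauss_peak.
Proof. exact/normal_peak_gt0/sqrt_invr_neq0. Qed.

Lemma gauss_densE x : gauss_dens x = gauss_peak * expR (- (beta / 2 * x ^+ 2)).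
Proof.
rewrite /gauss_dens normal_pdfE ?sqrt_invr_neq0// /normal_fun subr0.
rewrite sqr_sqrtr ?invr_ge0 1?ltW// -mulr_natr; congr (_ * expR _).
by field; rewrite gt_eqF.
Qed.

Lemma gauss_dens_gt0 x : 0 < gauss_dens x.
Proof. by rewrite gauss_densE mulr_gt0 ?gauss_peak_gt0 ?expR_gt0. Qed.

Lemma gauss_dens_ge0 x : 0 <= gauss_dens x.
Proof. exact/ltW/gauss_dens_gt0. Qed.

Lemma gauss_dens_ub x : gauss_dens x <= gauss_peak.
Proof.
rewrite gauss_densE ler_piMr ?(ltW gauss_peak_gt0)// -expR0 ler_expR oppr_le0.
by rewrite mulr_ge0 ?divr_ge0 ?sqr_ge0 ?ltW.
Qed.

Lemma gauss_densN x : gauss_dens (- x) = gauss_dens x.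
Proof. by rewrite !gauss_densE sqrrN. Qed.

Lemma measurable_gauss_densE (D : set (measurableTypeR R)) :
  measurable_fun D (EFin \o gauss_dens).
Proof.
apply: measurable_funTS; apply/measurable_EFinP; exact: measurable_normal_pdf.
Qed.

Lemma measurable_gauss_dens_shift (c : R) (D : set (measurableTypeR R)) :
  measurable_fun D (fun x => (gauss_dens (x + c))%:E).
Proof.
apply: measurable_funTS; apply/measurable_EFinP.
apply: (measurableT_comp (f := gauss_dens : measurableTypeR R -> measurableTypeR R)).
  exact: measurable_normal_pdf.
exact: measurable_shift.
Qed.

Lemma gauss_probE A : gauss A = (\int[M]_(x in A) (gauss_dens x)%:E)%E.
Proof. by []. Qed.

Lemma gauss_prob_itvoc_ge (c s t : R) : s <= t -> 0 <= c ->
  (forall x, s <= x <= t -> c <= gauss_dens x) ->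
  ((c * (t - s))%:E <= gauss `]s, t]%classic)%E.
Proof.
move=> st c0 cg; rewrite gauss_probE.
apply: (@le_trans _ _ (\int[M]_(x in `]s, t]) (cst c%:E x))%E); last first.
  apply: ge0_le_integral => //=.
  - exact: measurable_gauss_densE.
  - move=> x; rewrite in_itv/= => /andP[sx xt].
    by rewrite lee_fin cg// ltW.
rewrite integral_cst//= lebesgue_measure_itv/= lte_fin.
move: st; rewrite le_eqVlt => /predU1P[->|->]; last by rewrite -EFinD -EFinM.
by rewrite ltxx mule0 subrr mulr0.
Qed.

Lemma gauss_prob_itvoc_le (s t : R) : s <= t ->
  (gauss `]s, t]%classic <= (gauss_peak * (t - s))%:E)%E.
Proof.
move=> st; rewrite gauss_probE.
apply: (@le_trans _ _ (\int[M]_(x in `]s, t]) (cst gauss_peak%:E x))%E).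
  apply: ge0_le_integral => //=.
  - by move=> x _; rewrite lee_fin gauss_dens_ge0.
  - exact: measurable_gauss_densE.
  - by move=> x _; rewrite lee_fin gauss_dens_ub.
rewrite integral_cst//= lebesgue_measure_itv/= lte_fin.
move: st; rewrite le_eqVlt => /predU1P[->|->]; last by rewrite -EFinD -EFinM.
by rewrite ltxx mule0 subrr mulr0.
Qed.

End gaussian_density.

Section gaussian_distribution_function.
Context {R : realType} (beta : R).
Hypothesis beta_gt0 : 0 < beta.
Notation M := (@lebesgue_measure R).
Notation gauss := (gauss_prob beta).
Notation Phi := (dfun (gauss_prob beta)).

(** Between s and t the density is at least its value at the end point of larger modulus, which is
    positive. *)
Lemma gauss_dfun_lt (s t : R) : s < t -> Phi s < Phi t.
Proof.
move=> st.
pose m := Num.max `|s| `|t|.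
pose c := gauss_peak beta * expR (- (beta / 2 * m ^+ 2)).
have c0 : 0 < c by rewrite mulr_gt0 ?gauss_peak_gt0 ?expR_gt0.
suff cg x : s <= x <= t -> c <= gauss_dens beta x.
  have := gauss_prob_itvoc_ge (ltW st) (ltW c0) cg.
  rewrite (dfun_itv _ (ltW st)) lee_fin -subr_gt0; apply: lt_le_trans.
  by rewrite mulr_gt0// subr_gt0.
move=> /andP[sx xt]; rewrite gauss_densE// ler_pM2l ?gauss_peak_gt0//.
rewrite ler_expR lerN2 ler_pM2l ?divr_gt0//.
rewrite -(real_normK (num_real x)) lerXn2r ?nnegrE ?normr_ge0//.
  by rewrite /m le_max normr_ge0.
rewrite ler_norml; apply/andP; split.
  rewrite lerNl; apply: le_trans (_ : - s <= _); first by rewrite lerN2.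
  by rewrite /m le_max -normrN ler_norm.
by apply: le_trans xt _; rewrite /m le_max ler_norm orbT.
Qed.

Lemma gauss_dfun_le (s t : R) : (Phi s <= Phi t) = (s <= t).
Proof.
apply/idP/idP; last exact: dfun_nondecreasing.
by apply: contraTT; rewrite -!ltNge => /gauss_dfun_lt.
Qed.

Lemma gauss_dfun_gt0 (t : R) : 0 < Phi t.
Proof.
by apply: le_lt_trans (dfun_ge0 gauss (t - 1)) (gauss_dfun_lt _); lra.
Qed.

Lemma gauss_dfun_lt1 (t : R) : Phi t < 1.
Proof.
by apply: lt_le_trans (gauss_dfun_lt _) (dfun_le1 gauss (t + 1)); lra.
Qed.

Lemma gauss_dfun_lipschitz (s t : R) : s <= t ->
  Phi t - Phi s <= gauss_peak beta * (t - s).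
Proof.
by move=> st; rewrite -lee_fin -dfun_itv//; exact: gauss_prob_itvoc_le.
Qed.

Lemma gauss_dfun_continuous : continuous Phi.
Proof.
move=> x; apply/cvgrPdist_le => /= e e0.
have p0 := gauss_peak_gt0 beta_gt0.
have d0 : 0 < e / gauss_peak beta by rewrite divr_gt0.
apply/nbhs_ballP; exists (e / gauss_peak beta) => //= y; rewrite /ball/= => xy.
wlog yx : x y xy / y <= x.
  move=> h; have [|/ltW] := leP y x; first exact: h.
  by rewrite distrC; apply: h; rewrite distrC.
rewrite ger0_norm ?subr_ge0 ?dfun_nondecreasing//.
apply: le_trans (gauss_dfun_lipschitz yx) _.
rewrite mulrC -ler_pdivlMr//; apply: le_trans (ltW xy); exact: ler_norm.
Qed.

Lemma gauss_dfunE (t : R) :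
  (Phi t)%:E = (\int[M]_(x in `]-oo, t]) (gauss_dens beta x)%:E)%E.
Proof. by rewrite -dfunE. Qed.

Lemma gauss_dfun_tailE (t : R) :
  (1 - Phi t)%:E = (\int[M]_(x in `]t, +oo[) (gauss_dens beta x)%:E)%E.
Proof. by rewrite -dfun_tail. Qed.

(** After a translation by D the densities compare pointwise, since (x - D) ^ 2 >= x ^ 2 + D ^ 2 for
    x <= 0. *)
Lemma gauss_dfun_left_tail (w D : R) : w <= 0 -> 0 <= D ->
  Phi (w - D) <= expR (- (beta / 2 * D ^+ 2)) * Phi w.
Proof.
move=> w0 D0; rewrite -lee_fin EFinM !gauss_dfunE.
rewrite (ge0_integral_shift (- D))//; last 2 first.
- exact: measurable_gauss_densE.
- by move=> x; rewrite lee_fin gauss_dens_ge0.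
rewrite (_ : [set x | `]-oo, w - D]%classic (x + - D)] = `]-oo, w]%classic); last first.
  by apply/seteqP; split=> x /=; rewrite !in_itv/=; lra.
rewrite -ge0_integralZl//=; last 2 first.
- exact: measurable_gauss_densE.
- by move=> x _; rewrite lee_fin gauss_dens_ge0.
apply: ge0_le_integral => //=.
- by move=> x _; rewrite lee_fin gauss_dens_ge0.
- exact: measurable_gauss_dens_shift.
- apply: measurable_funTS; apply/measurable_EFinP.
  by apply: measurable_funM => //; exact: measurable_normal_pdf.
move=> x; rewrite in_itv/= => xw; rewrite -EFinM lee_fin !gauss_densE//.
rewrite [leRHS]mulrCA ler_pM2l ?gauss_peak_gt0// -expRD ler_expR.
have : 0 <= beta * (D * - x).
  by rewrite mulr_ge0 ?(ltW beta_gt0)// mulr_ge0//; lra.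
nra.
Qed.

Lemma gauss_dfun_right_tail (w D : R) : 0 <= w -> 0 <= D ->
  1 - Phi (w + D) <= expR (- (beta / 2 * D ^+ 2)) * (1 - Phi w).
Proof.
move=> w0 D0; rewrite -lee_fin EFinM !gauss_dfun_tailE.
rewrite (ge0_integral_shift D)//; last 2 first.
- exact: measurable_gauss_densE.
- by move=> x; rewrite lee_fin gauss_dens_ge0.
rewrite (_ : [set x | `]w + D, +oo[%classic (x + D)] = `]w, +oo[%classic); last first.
  by apply/seteqP; split=> x /=; rewrite !in_itv/=; lra.
rewrite -ge0_integralZl//=; last 2 first.
- exact: measurable_gauss_densE.
- by move=> x _; rewrite lee_fin gauss_dens_ge0.
apply: ge0_le_integral => //=.
- by move=> x _; rewrite lee_fin gauss_dens_ge0.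
- exact: measurable_gauss_dens_shift.
- apply: measurable_funTS; apply/measurable_EFinP.
  by apply: measurable_funM => //; exact: measurable_normal_pdf.
move=> x; rewrite in_itv/= andbT => xw; rewrite -EFinM lee_fin !gauss_densE//.
rewrite [leRHS]mulrCA ler_pM2l ?gauss_peak_gt0// -expRD ler_expR.
have : 0 <= beta * (D * x).
  by rewrite mulr_ge0 ?(ltW beta_gt0)// mulr_ge0//; lra.
nra.
Qed.

(** The slack of one in the argument is the price of spreading lattice atoms over unit cells. Both
    tails are compared, as a factor K says little about a distribution function where it is close to
    1. *)
Definition comparable_dfun (K : R) (F : R -> R) := forall t,
  [/\ F t <= K * Phi (t + 1), Phi (t - 1) <= K * F t,
      1 - F t <= K * (1 - Phi (t - 1)) & 1 - Phi (t + 1) <= K * (1 - F t)].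

(* The tails of the Gaussian law are so thin that a shift by D in the outward
   direction gains any prescribed factor. *)
Lemma shift_of_comparable (K : R) : 0 < K -> exists2 C, 0 < C &
  forall F, comparable_dfun K F -> forall t, Phi (t - C) <= F t <= Phi (t + C).
Proof.
(* Chosen so that [K <= beta / 2 * D ^+ 2 <= expR (beta / 2 * D ^+ 2)]: an outward shift by D beats
   the factor K. *)
move=> K0; pose D := 2 * K / beta + 1.
have D1 : 1 <= D by rewrite /D lerDr divr_ge0 ?mulr_ge0 ?ltW.
have KD : expR (- (beta / 2 * D ^+ 2)) * K <= 1.
  rewrite expRN mulrC ler_pdivrMr ?expR_gt0// mul1r.
  apply: le_trans (expR_ge1Dx _).
  have : K <= beta / 2 * D.
    by rewrite /D mulrDr mulr1 (_ : beta / 2 * (2 * K / beta) = K);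
      [rewrite lerDl divr_ge0// ltW|field; rewrite gt_eqF].
  have : beta / 2 * D <= beta / 2 * D ^+ 2.
    by rewrite ler_pM2l ?divr_gt0// expr2 ler_peMr//; lra.
  lra.
pose c := expR (- (beta / 2 * D ^+ 2)).
have c0 : 0 < c by exact: expR_gt0.
have ltl w : w <= 0 -> Phi (w - D) * K <= Phi w.
  move=> w0; have := gauss_dfun_left_tail w0 (le_trans ler01 D1); rewrite -/c => h.
  apply: (@le_trans _ _ (c * Phi w * K)); first by rewrite ler_pM2r.
  by rewrite mulrAC ler_piMl ?dfun_ge0.
have rtl w : 0 <= w -> (1 - Phi (w + D)) * K <= 1 - Phi w.
  move=> w0; have := gauss_dfun_right_tail w0 (le_trans ler01 D1); rewrite -/c => h.
  apply: (@le_trans _ _ (c * (1 - Phi w) * K)); first by rewrite ler_pM2r.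
  by rewrite mulrAC ler_piMl// subr_ge0 dfun_le1.
(* In each bound, one tail with a shift of D + 1 settles the t beyond D + 1 on its side. For the
   other t a shift of D + 2 first reaches the side of the opposite tail, where D more is needed. *)
exists (2 * D + 2); first by lra.
move=> F hF t; have [h1 h2 h3 h4] := hF t; apply/andP; split.
- have [tD|tD] := leP (D + 1) t.
    have := rtl (t - 1 - D); rewrite subrK  => /(_ ltac:(lra)) h5.
    have := @dfun_nondecreasing _ gauss (t - (2 * D + 2)) (t - 1 - D) ltac:(lra).
    nra.
  have := ltl (t - D - 2) ltac:(lra).
  have := @dfun_nondecreasing _ gauss (t - D - 2) (t - 1) ltac:(lra).
  rewrite (_ : t - D - 2 - D = t - (2 * D + 2)); last by ring.
  move=> h6 h7; rewrite -(ler_pM2r K0) [F t * K]mulrC.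
  by apply: le_trans h7 (le_trans h6 h2).
- have [tD|tD] := leP t (- (D + 1)).
    have := ltl (t + 1 + D); rewrite addrK  => /(_ ltac:(lra)) h5.
    have := @dfun_nondecreasing _ gauss (t + 1 + D) (t + (2 * D + 2)) ltac:(lra).
    nra.
  have := rtl (t + D + 2) ltac:(lra).
  have := @dfun_nondecreasing _ gauss (t + 1) (t + D + 2) ltac:(lra).
  rewrite (_ : t + D + 2 + D = t + (2 * D + 2)); last by ring.
  move=> h6 h7; suff : (1 - Phi (t + (2 * D + 2))) * K <= (1 - F t) * K.
    by rewrite ler_pM2r// lerD2l lerN2.
  rewrite [leRHS]mulrC; apply: le_trans h7 (le_trans _ h4).
  by rewrite lerD2l lerN2.
Qed.

End gaussian_distribution_function.

Section quantile_transport.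
Context {R : realType} (beta C : R).
Hypothesis beta_gt0 : 0 < beta.
Notation Phi := (dfun (gauss_prob beta)).
Context d (Y : measurableType d) (F : Y -> R -> R).
Hypothesis mF : forall t, measurable_fun setT (F^~ t).
Hypothesis F_nd : forall y s t, s <= t -> F y s <= F y t.
Hypothesis F_rc : forall y x t, (forall s, t < s -> x <= F y s) -> x <= F y t.
Hypothesis F_near : forall y t, Phi (t - C) <= F y t <= Phi (t + C).

(** The monotone transport from the Gaussian law to the law with distribution function [F y]: a
    generalized inverse of [F y] applied to [Phi z]. *)
Definition quantile (y : Y) (z : R) : R := inf [set t | Phi z <= F y t].

Let quantile_set_shift y z : Phi z <= F y (z + C).
Proof. by have /andP[+ _] := F_near y (z + C); rewrite addrK. Qed.

Let quantile_set_lb y z t : Phi z <= F y t -> z - C <= t.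
Proof.
move=> zt; have /andP[_ /(le_trans zt)] := F_near y t.
by rewrite gauss_dfun_le// -lerBlDr.
Qed.

(** Right continuity makes the infimum a minimum, whence the Galois connection that yields both the
    measurability and the law of the quantile. *)
Lemma quantile_le y z t : (quantile y z <= t) = (Phi z <= F y t).
Proof.
apply/idP/idP => [qt|zt]; last first.
  by apply: ge_inf => //; exists (z - C) => s; exact: quantile_set_lb.
apply: F_rc => s ts; have hinf : has_inf [set u | Phi z <= F y u].
  split; first by exists (z + C); exact: quantile_set_shift.
  by exists (z - C) => u; exact: quantile_set_lb.
have st0 : 0 < s - t by rewrite subr_gt0.
have [u zu us] := inf_adherent st0 hinf.
apply: le_trans zu (F_nd _ _); apply: ltW; apply: lt_le_trans us _.
by rewrite -lerBrDr opprB addrC subrK.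
Qed.

Lemma quantile_near y z : `|quantile y z - z| <= C.
Proof.
rewrite ler_distl quantile_le quantile_set_shift andbT.
apply: lb_le_inf; first by exists (z + C); exact: quantile_set_shift.
by move=> t; exact: quantile_set_lb.
Qed.

(** By [quantile_le] the superlevel set at t is given by [Phi z > F y t], so measurability of [F] in
    y at each fixed t gives joint measurability. *)
Lemma measurable_quantile :
  measurable_fun setT (fun p : Y * R => quantile p.1 p.2).
Proof.
apply: (measurability _ (RGenOInfty.measurableE R)) => //.
move=> _ [_ [t ->] <-]; rewrite setTI.
rewrite (_ : _ @^-1` _ =
    (fun p : Y * R => Phi p.2 - F p.1 t) @^-1` `]0, +oo[%classic); last first.
  apply/seteqP; split=> p /=; rewrite !in_itv/= !andbT.
    by rewrite ltNge quantile_le -ltNge subr_gt0.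
  by rewrite subr_gt0 ltNge -quantile_le -ltNge.
rewrite -[X in measurable X]setTI; apply: measurable_funB => //.
  apply: (measurableT_comp (f := Phi)) => //.
  by apply: nondecreasing_measurable => // s t' st; exact: dfun_nondecreasing.
exact: (measurableT_comp (f := F^~ t)).
Qed.

Lemma quantile_law y (P : probability R R) : dfun P =1 F y ->
  forall A, measurable A -> gauss_prob beta (quantile y @^-1` A) = P A.
Proof.
move=> PF A mA.
have mq : measurable_fun setT (quantile y).
  apply: (measurableT_comp (f := fun p : Y * R => quantile p.1 p.2)
    (g := fun z => (y, z))) => //; first exact: measurable_quantile.
  exact: measurable_fun_pair.
pose X := rv_of (gauss_prob beta) mq.
rewrite -(eq_probability_dfun (P := distribution (gauss_prob beta) X))// => t.
rewrite PF; apply: EFin_inj; rewrite -dfunE.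
transitivity (gauss_prob beta [set z | Phi z <= F y t]).
  congr (gauss_prob beta _); apply/seteqP; split=> z /=;
    by rewrite in_itv/= quantile_le.
have /andP[Fl Fu] := F_near y t.
have tC : t - C <= t + C by rewrite -(gauss_dfun_le beta_gt0); exact: le_trans Fl Fu.
have bounds : Num.min (Phi (t - C)) (Phi (t + C)) <= F y t <=
    Num.max (Phi (t - C)) (Phi (t + C)) by rewrite ge_min Fl le_max Fu orbT.
(* By [F_near] and continuity, [F y t] is a value [Phi s], so the event is the ray []-oo, s]], of
   probability [F y t]. *)
have [s _ Fs] := IVT tC (continuous_subspaceT
  (gauss_dfun_continuous beta_gt0)) bounds.
rewrite -Fs -dfunE; congr (gauss_prob beta _); apply/seteqP; split=> z /=;
  by rewrite in_itv/= gauss_dfun_le.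
Qed.

End quantile_transport.

Section density_probability.
Context d (T : measurableType d) {R : realType} (P : {measure set T -> \bar R}).
Variable f : T -> R.
Hypothesis mf : measurable_fun setT f.
Hypothesis f0 : forall x, 0 <= f x.
Hypothesis f1 : (\int[P]_x (f x)%:E = 1)%E.

(** The hypotheses are arguments of the set function so that its measure and probability structures
    can recover them from the term. *)
Definition density_prob of measurable_fun setT f & (forall x, 0 <= f x) &
    (\int[P]_x (f x)%:E = 1)%E : set T -> \bar R :=
  fun A => (\int[P]_(x in A) (f x)%:E)%E.
Notation nu := (density_prob mf f0 f1).

Let nu0 : nu set0 = 0%E. Proof. exact: integral_set0. Qed.

Let nu_ge0 A : (0 <= nu A)%E.
Proof. by apply: integral_ge0 => x _; rewrite lee_fin. Qed.

Let nu_sigma_additive : semi_sigma_additive nu.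
Proof.
move=> F mF tF mUF; rewrite /density_prob ge0_integral_bigcup//.
- apply: is_cvg_ereal_nneg_natsum_cond => n _ _; exact: nu_ge0.
- by apply: measurable_funTS; exact/measurable_EFinP.
- by move=> x _; rewrite lee_fin.
Qed.

HB.instance Definition _ := isMeasure.Build _ _ _ nu nu0 nu_ge0 nu_sigma_additive.

HB.instance Definition _ := Measure_isProbability.Build _ _ _ nu f1.

End density_probability.

Section bernoulli_mixture.
Context {R : realType} (p : R).
Hypothesis p01 : 0 <= p <= 1.

Lemma bernoulli_prob_true : bernoulli_prob p [set true] = p%:E.
Proof. by rewrite /bernoulli_prob p01 fsbig_set1. Qed.

Lemma bernoulli_prob_false : bernoulli_prob p [set false] = (1 - p)%:E.
Proof. by rewrite /bernoulli_prob p01 fsbig_set1. Qed.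

Lemma product_bernoulli_if d (T : measurableType d) (P : probability T R)
    (f g : T -> R) (A : set R) :
  measurable_fun setT f -> measurable_fun setT g -> measurable A ->
  (P \x bernoulli_prob p)%E ((fun a => if a.2 then f a.1 else g a.1) @^-1` A) =
  (p%:E * P (f @^-1` A) + (1 - p)%:E * P (g @^-1` A))%E.
Proof.
move=> mf mg mA.
have mfA : measurable (f @^-1` A) by rewrite -[X in measurable X]setTI; exact: mf.
have mgA : measurable (g @^-1` A) by rewrite -[X in measurable X]setTI; exact: mg.
have mX : measurable ((f @^-1` A) `*` [set true]) by exact: measurableX.
have mY : measurable ((g @^-1` A) `*` [set false]) by exact: measurableX.
have XY0 : (f @^-1` A) `*` [set true] `&` (g @^-1` A) `*` [set false] = set0.
  by apply/seteqP; split=> -[x []] //= [[_ ?] [_ ?]].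
rewrite (_ : _ @^-1` A = (f @^-1` A) `*` [set true] `|` (g @^-1` A) `*` [set false]).
  rewrite (measureU _ mX mY XY0).
  congr (_ + _)%E; rewrite [LHS]product_measure1E// muleC; congr (_ * _)%E.
    exact: bernoulli_prob_true.
  exact: bernoulli_prob_false.
apply/seteqP; split=> -[x []] //=; [by left|by right|by case=> [[]|[]]|by case=> [[]|[]]].
Qed.

End bernoulli_mixture.

Section density_step.
Context {R : realType} (beta : R).
Hypothesis beta_gt0 : 0 < beta.
Notation gauss := (gauss_prob beta).
Notation Phi := (dfun (gauss_prob beta)).

(* The part p of the density h is transported by the identity, and the rest,
   whose normalized density w is within a factor K of 1, by the quantile map. *)
Lemma density_step (K : R) : 0 < K -> exists2 C, 0 < C &
  forall (p : R) (h : R -> R -> R), 0 < p < 1 ->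
    measurable_fun setT (fun y : R * R => h y.1 y.2) ->
    (forall phi, \int[gauss]_z (h phi z)%:E = 1)%E ->
    (forall phi z, (1 - p) / K <= h phi z - p <= K * (1 - p)) ->
  exists step : R -> R * bool -> R,
    [/\ measurable_fun setT (fun y : R * (R * bool) => step y.1 y.2),
        forall phi A, measurable A ->
          (gauss \x bernoulli_prob p)%E (step phi @^-1` A) =
          (\int[gauss]_(z in A) (h phi z)%:E)%E,
        forall phi a, `|step phi a - a.1| <= C &
        forall phi z, step phi (z, true) = z].
Proof.
move=> K0; have [C C0 near] := shift_of_comparable beta_gt0 K0.
exists C => // p h /andP[p0 p1] mh h1 hK.
have p01 : 0 <= p <= 1 by rewrite !ltW.
have q0 : 0 < 1 - p by rewrite subr_gt0.
pose w phi z := (h phi z - p) / (1 - p).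
have wlb phi z : K^-1 <= w phi z.
  by rewrite ler_pdivlMr// mulrC; have /andP[] := hK phi z.
have wub phi z : w phi z <= K.
  by rewrite ler_pdivrMr//; have /andP[] := hK phi z.
have w0 phi z : 0 <= w phi z by apply: le_trans (wlb phi z); rewrite invr_ge0 ltW.
have mhphi phi : measurable_fun setT (h phi).
  apply: (measurableT_comp (f := fun y : R * R => h y.1 y.2)
    (g := fun z => (phi, z))) => //; exact: measurable_fun_pair.
have mw2 : measurable_fun setT (fun y : R * R => w y.1 y.2).
  by apply: measurable_funM => //; apply: measurable_funB.
have mw phi : measurable_fun setT (w phi).
  by apply: measurable_funM => //; apply: measurable_funB.
have mwA phi A : measurable_fun A (fun z => (w phi z)%:E).
  by apply: measurable_funTS; apply/measurable_EFinP; exact: mw.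
have wE0 phi z : (0 <= (w phi z)%:E)%E by rewrite lee_fin.
have wmix phi A : measurable A ->
    (\int[gauss]_(z in A) (h phi z)%:E =
     p%:E * gauss A + (1 - p)%:E * \int[gauss]_(z in A) (w phi z)%:E)%E.
  move=> mA; rewrite -(ge0_integralZl gauss mA (mwA phi A) (fun z _ => wE0 phi z)); last first.
    by rewrite lee_fin ltW.
  rewrite -integral_cst// -ge0_integralD//.
  - apply: eq_integral => z _; rewrite /w -EFinM -EFinD mulrC divfK ?gt_eqF//.
    by rewrite addrC subrK.
  - by move=> z _; rewrite lee_fin ltW.
  - by move=> z _; rewrite mule_ge0// lee_fin// ltW.
  - apply: measurable_funTS; apply/measurable_EFinP.
    by apply: measurable_funM.
(* A priori this integral could be infinite; [wmix] on the whole line excludes it, the total mass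
   being 1. *)
have w1 phi : (\int[gauss]_z (w phi z)%:E = 1)%E.
  have := wmix phi setT measurableT; rewrite h1 probability_setT mule1.
  case: (integral _ _ _) => [x| |].
  - rewrite -EFinM -EFinD => -[] e; congr EFin.
    by apply: (mulfI (lt0r_neq0 q0)); rewrite mulr1 [X in _ = X - p]e addrAC subrr add0r.
  - by rewrite gt0_muley ?lte_fin// addey.
  - by rewrite gt0_muleNy ?lte_fin// addeNy.
pose nu phi := density_prob (mw phi) (w0 phi) (w1 phi).
pose F phi t := dfun (nu phi) t.
have nuE phi A : nu phi A = (\int[gauss]_(z in A) (w phi z)%:E)%E by [].
have nu_ub phi A : measurable A -> (nu phi A <= K%:E * gauss A)%E.
  move=> mA; rewrite nuE -integral_cst//; apply: ge0_le_integral => //.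
  by move=> z _; rewrite lee_fin.
have nu_lb phi A : measurable A -> (gauss A <= K%:E * nu phi A)%E.
  move=> mA; rewrite -lee_pdivrMl// nuE -integral_cst//; apply: ge0_le_integral => //.
  - by move=> z _; rewrite lee_fin invr_ge0 ltW.
  - by move=> z _; rewrite lee_fin.
(* Since w lies between 1 / K and K, both tails compare without any shift; monotonicity then inserts
   the unit slack of [comparable_dfun]. *)
have nearF phi : forall t, Phi (t - C) <= F phi t <= Phi (t + C).
  apply: near => t.
  have Phi_nd := @dfun_nondecreasing _ gauss.
  have h4' : F phi t <= K * Phi t.
    by rewrite -lee_fin EFinM -(dfunE (nu phi)) -(dfunE gauss); exact: nu_ub.
  have h3' : Phi t <= K * F phi t.
    by rewrite -lee_fin EFinM -(dfunE (nu phi)) -(dfunE gauss); exact: nu_lb.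
  have h2' : 1 - F phi t <= K * (1 - Phi t).
    by rewrite -lee_fin EFinM -(dfun_tail (nu phi)) -(dfun_tail gauss); exact: nu_ub.
  have h1' : 1 - Phi t <= K * (1 - F phi t).
    by rewrite -lee_fin EFinM -(dfun_tail (nu phi)) -(dfun_tail gauss); exact: nu_lb.
  have tm : Phi (t - 1) <= Phi t by apply: Phi_nd; rewrite gerBl.
  have tp : Phi t <= Phi (t + 1) by apply: Phi_nd; rewrite lerDl.
  split.
  - by apply: le_trans h4' _; rewrite ler_pM2l.
  - exact: le_trans tm h3'.
  - by apply: le_trans h2' _; rewrite ler_pM2l// lerD2l lerN2.
  - by apply: le_trans h1'; rewrite lerD2l lerN2.
(* The parameter enters through a partial integral of a jointly measurable function, hence
   measurably by Tonelli. *)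
have mF t : measurable_fun setT (F^~ t).
  have mG : measurable_fun setT (fun phi => nu phi `]-oo, t]%classic).
    rewrite (_ : (fun phi => _) = fubini_F gauss (fun y : R * R =>
        ((w y.1 y.2) * \1_(`]-oo, t]%classic) y.2)%:E)); last first.
      apply/funext => phi; rewrite /fubini_F nuE [LHS]integral_mkcond.
      apply: eq_integral => z _; rewrite patchE indicE/=.
      by case: ifP; rewrite ?mulr1 ?mulr0.
    apply: measurable_fun_fubini_tonelli_F.
      apply/measurable_EFinP; apply: measurable_funM => //.
      have m1 : measurable_fun setT (\1_(`]-oo, t]%classic) : R -> R).
        exact: measurable_indic.
      exact: (measurableT_comp m1).
    by move=> y; rewrite lee_fin mulr_ge0// indicE ler0n.
  apply: (measurableT_comp (f := @fine R) (g := fun phi => nu phi `]-oo, t]%classic)) => //.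
have F_nd phi s t : s <= t -> F phi s <= F phi t by exact: dfun_nondecreasing.
have F_rc phi x t : (forall s, t < s -> x <= F phi s) -> x <= F phi t.
  exact: dfun_right_continuous.
pose q := quantile beta F.
have mq : measurable_fun setT (fun y : R * R => q y.1 y.2).
  exact: (measurable_quantile beta_gt0 mF F_nd F_rc nearF).
have mqphi phi : measurable_fun setT (q phi).
  apply: (measurableT_comp (f := fun y : R * R => q y.1 y.2)
    (g := fun z => (phi, z))) => //; exact: measurable_fun_pair.
exists (fun phi a => if a.2 then a.1 else q phi a.1); split=> //.
- apply: measurable_fun_ifT => //.
  + exact: (measurableT_comp (f := snd)).
  + exact: (measurableT_comp (f := fst)).
  apply: (measurableT_comp (f := fun y : R * R => q y.1 y.2)
    (g := fun y : R * (R * bool) => (y.1, y.2.1))) => //.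
  apply: measurable_fun_pair => //; exact: (measurableT_comp (f := fst)).
- move=> phi A mA; rewrite wmix//.
  have PF : dfun (nu phi) =1 F phi by [].
  have ql := quantile_law beta_gt0 mF F_nd F_rc nearF PF mA.
  transitivity (p%:E * gauss A + (1 - p)%:E * gauss (q phi @^-1` A))%E.
    exact: (product_bernoulli_if p01 gauss (f := fun x => x)).
  by congr (_ + _ * _)%E; exact: ql.
- move=> phi [z []] /=; first by rewrite subrr normr0 ltW.
  exact: quantile_near.
Qed.

End density_step.

(** * The integer-valued transition law *)

Section sums_over_integers.
Context {R : realType}.
Notation M := (@lebesgue_measure R).
Local Open Scope ereal_scope.

(** Turns unordered sums over the integers into series, which commute with scaling and with
    integrals. *)
Definition int_enum (k : nat) : int := if odd k then Negz k./2 else Posz k./2.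

Lemma int_enum_bij : set_bij [set: nat] [set: int] int_enum.
Proof.
split=> // [k k' _ _|[n|n] _].
- rewrite /int_enum; case: ifP => o1; case: ifP => o2 // -[]; lia.
- by exists n.*2 => //; rewrite /int_enum odd_double doubleK.
- by exists n.*2.+1 => //; rewrite /int_enum/= odd_double/= uphalf_double.
Qed.

Lemma esum_int (a : int -> \bar R) : (forall j, 0 <= a j) ->
  \esum_(j in [set: int]) a j = \sum_(k <oo) a (int_enum k).
Proof.
move=> a0; rewrite (reindex_esum _ _ _ _ int_enum_bij) nneseries_esumT//.
Qed.

Lemma int_cell (s x : R) : exists j : int, (s <= x - j%:~R < s + 1)%R.
Proof.
exists (Num.floor (x - s)).
have /andP[] := floor_itv (x - s); rewrite intrD.
by move: (_%:~R) => u h1 h2; apply/andP; split; lra.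
Qed.

Lemma int_cell_uniq (s x : R) (i j : int) :
  (s <= x - i%:~R < s + 1)%R -> (s <= x - j%:~R < s + 1)%R -> i = j.
Proof.
move=> /andP[i1 i2] /andP[j1 j2].
have : (i < j + 1)%R by rewrite -(ltr_int R) intrD; lra.
have : (j < i + 1)%R by rewrite -(ltr_int R) intrD; lra.
lia.
Qed.

(** The translates of [[s, s + 1[] by j + c tile the line; s decides on which side of the point j +
    c its cell lies. *)
Lemma integral_unfold_cells (s c : R) (f : R -> \bar R) :
  measurable_fun setT f -> (forall x, 0 <= f x) ->
  \int[M]_x f x =
  \esum_(j in [set: int]) \int[M]_(x in `[s, (s + 1)%R[) f (x + (j%:~R + c))%R.
Proof.
move=> mf f0; rewrite esum_int; last first.
  by move=> j; apply: integral_ge0 => x _.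
pose F k : set R := [set x | `[s, (s + 1)%R[%classic (x + - ((int_enum k)%:~R + c))%R].
have FE k : F k = `[(s + ((int_enum k)%:~R + c))%R,
    (s + 1 + ((int_enum k)%:~R + c))%R[%classic.
  by apply/seteqP; split=> x; rewrite /F/= !in_itv/= lerBrDr ltrBlDr.
have mF k : measurable (F k) by rewrite FE.
have FT : \bigcup_k F k = setT.
  rewrite -subTset => x _; have [j hj] := int_cell s (x - c)%R.
  have [_ _ /(_ j I)[k _ kj]] := int_enum_bij.
  exists k => //; rewrite /F/= in_itv/= kj.
  by move: hj; rewrite opprD addrA [(x - c - _)%R]addrAC.
have tF : trivIset setT F.
  move=> k l _ _ [x []]; rewrite /F/= !in_itv/= !opprD !addrA.
  rewrite ![(x - _ - c)%R]addrAC => hk hl.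
  have [_ inj _] := int_enum_bij; apply: inj; rewrite ?inE//.
  exact: int_cell_uniq hk hl.
transitivity (\int[M]_(x in \bigcup_k F k) f x); first by rewrite FT.
rewrite ge0_integral_bigcup//; last first.
  by apply: measurable_funTS.
apply: eq_eseriesr => k _.
rewrite [LHS](ge0_integral_shift ((int_enum k)%:~R + c))//.
rewrite (_ : [set x | F k (x + ((int_enum k)%:~R + c))%R] =
  `[s, (s + 1)%R[%classic)//.
by apply/seteqP; split=> x; rewrite /F/= addrK.
Qed.

Lemma integral_unfold (s c : R) (f : R -> \bar R) :
  measurable_fun setT f -> (forall x, 0 <= f x) ->
  \int[M]_x f x =
  \int[M]_(x in `[s, (s + 1)%R[)
    \esum_(j in [set: int]) f (x + (j%:~R + c))%R.
Proof.
move=> mf f0; rewrite (integral_unfold_cells s c)// esum_int; last first.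
  by move=> j; apply: integral_ge0 => x _.
rewrite -integral_nneseries//; last first.
  move=> k; apply: measurable_funTS.
  by apply: (measurableT_comp mf); exact: measurable_shift.
by apply: eq_integral => x _; rewrite esum_int.
Qed.

(** Each cell has length one, so a constant below f on a cell is at most the integral of f over
    it. *)
Lemma esum_le_integral (s c : R) (f : R -> \bar R) (u : int -> R) :
  measurable_fun setT f -> (forall x, 0 <= f x) -> (forall j, (0 <= u j)%R) ->
  (forall j x, (s <= x < s + 1)%R -> (u j)%:E <= f (x + (j%:~R + c))%R) ->
  \esum_(j in [set: int]) (u j)%:E <= \int[M]_x f x.
Proof.
move=> mf f0 u0 uf; rewrite (integral_unfold_cells s c)//; apply: le_esum => j _.
rewrite -[leLHS]mule1; have -> : 1 = M `[s, (s + 1)%R[%classic.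
  by rewrite lebesgue_measure_itv/= lte_fin ltrDl ltr01 -EFinD addrAC subrr add0r.
rewrite -integral_cst//; apply: ge0_le_integral => //.
- by move=> x _; rewrite lee_fin.
- apply: measurable_funTS.
  by apply: (measurableT_comp mf); exact: measurable_shift.
- by move=> x; rewrite /= in_itv/= => /uf.
Qed.

Lemma integral_le_esum (s c : R) (f : R -> \bar R) (u : int -> R) :
  measurable_fun setT f -> (forall x, 0 <= f x) -> (forall j, (0 <= u j)%R) ->
  (forall j x, (s <= x < s + 1)%R -> f (x + (j%:~R + c))%R <= (u j)%:E) ->
  \int[M]_x f x <= \esum_(j in [set: int]) (u j)%:E.
Proof.
move=> mf f0 u0 fu; rewrite (integral_unfold_cells s c)//; apply: le_esum => j _.
rewrite -[leRHS]mule1; have -> : 1 = M `[s, (s + 1)%R[%classic.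
  by rewrite lebesgue_measure_itv/= lte_fin ltrDl ltr01 -EFinD addrAC subrr add0r.
rewrite -integral_cst//; apply: ge0_le_integral => //.
- apply: measurable_funTS.
  by apply: (measurableT_comp mf); exact: measurable_shift.
- by move=> x; rewrite /= in_itv/= => /fu.
Qed.

End sums_over_integers.

Section lattice_gaussian.
Context {R : realType} (beta : R).
Hypothesis beta_gt0 : 0 < beta.
Notation M := (@lebesgue_measure R).
Notation gauss := (gauss_prob beta).
Notation Phi := (dfun (gauss_prob beta)).

Definition gweight (y : R) : R := expR (- (beta / 2 * y ^+ 2)).

Lemma gweight_gt0 y : 0 < gweight y. Proof. exact: expR_gt0. Qed.

Lemma gweight_ge0 y : 0 <= gweight y. Proof. exact: expR_ge0. Qed.

Lemma measurable_gweight : measurable_fun setT gweight.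
Proof.
apply: (measurableT_comp (f := @expR R)) => //; apply: measurableT_comp => //.
by apply: measurable_funM => //; exact: measurable_funX.
Qed.

Definition lattice_mass (phi : R) (A : set R) : \bar R :=
  (\esum_(j in [set: int]) (gweight (j%:~R - phi) * \1_A (j%:~R - phi))%:E)%E.

Lemma lattice_mass_ge0 phi A : (0 <= lattice_mass phi A)%E.
Proof. by apply: esum_ge0 => j _; rewrite lee_fin indicE mulr_ge0 ?gweight_ge0. Qed.

Lemma lattice_massE phi A :
  lattice_mass phi A =
  (\esum_(j in [set j : int | A (j%:~R - phi)%R]) (gweight (j%:~R - phi))%:E)%E.
Proof.
rewrite esum_mkcond; apply: eq_esum => j _; rewrite indicE.
case: ifPn; rewrite (inE, notin_setE) /= => h.
  by rewrite (mem_set h) mulr1.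
by rewrite (memNset h) mulr0.
Qed.

Let integral_gauss_scaled (k : R) (A : set R) : 0 <= k -> measurable A ->
  (\int[M]_x (k * gauss_dens beta x * \1_A x)%:E = k%:E * gauss A)%E.
Proof.
move=> k0 mA; rewrite gauss_probE -ge0_integralZl//; last 2 first.
- exact: measurable_gauss_densE.
- by move=> x _; rewrite lee_fin gauss_dens_ge0.
rewrite [RHS]integral_mkcond; apply: eq_integral => x _.
by rewrite patchE indicE; case: ifP; rewrite ?mulr1 ?mulr0.
Qed.

Let measurable_gauss_scaled (k : R) (A : set R) : measurable A ->
  measurable_fun setT (fun x : measurableTypeR R =>
    (k * gauss_dens beta x * \1_A x)%:E).
Proof.
move=> mA; apply/measurable_EFinP; apply: measurable_funM.
  by apply: measurable_funM => //; exact: measurable_normal_pdf.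
exact: measurable_indic.
Qed.

(** Each atom y is spread evenly over its cell [[y + s, y + s + 1[], on which the Gaussian weight is
    at least 1 / K times that of the atom. *)
Lemma lattice_mass_le (s K phi : R) (A A' : set R) : 0 <= K -> measurable A' ->
  (forall y x, s <= x < s + 1 -> A y ->
     A' (x + y) /\ gweight y <= K * gweight (x + y)) ->
  (lattice_mass phi A <= (K / gauss_peak beta)%:E * gauss A')%E.
Proof.
move=> K0 mA' h; have p0 := gauss_peak_gt0 beta_gt0.
have k0 : 0 <= K / gauss_peak beta by rewrite divr_ge0// ltW.
rewrite -integral_gauss_scaled//.
apply: (@esum_le_integral _ s (- phi)).
- exact: measurable_gauss_scaled.
- by move=> x; rewrite lee_fin indicE mulr_ge0// mulr_ge0// gauss_dens_ge0.
- by move=> j; rewrite indicE mulr_ge0// gweight_ge0.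
move=> j x sx; rewrite lee_fin !indicE.
have [Ay|] := boolP (_ \in A); last first.
  by move=> _; rewrite mulr0 mulr_ge0// mulr_ge0// gauss_dens_ge0.
have [A'y le] := h _ _ sx (set_mem Ay).
rewrite mem_set// !mulr1 gauss_densE// mulrA divfK ?gt_eqF//.
Qed.

Lemma lattice_mass_ge (s K phi : R) (A A' : set R) : 0 <= K -> measurable A' ->
  (forall y x, s <= x < s + 1 -> A' (x + y) ->
     A y /\ gweight (x + y) <= K * gweight y) ->
  (gauss A' <= (K * gauss_peak beta)%:E * lattice_mass phi A)%E.
Proof.
move=> K0 mA' h; have p0 := gauss_peak_gt0 beta_gt0.
rewrite -[leLHS]mul1e -(@integral_gauss_scaled 1)//.
rewrite /lattice_mass esum_int; last first.
  by move=> j; rewrite lee_fin indicE mulr_ge0// gweight_ge0.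
rewrite -nneseriesZl; last first.
  by move=> j _; rewrite lee_fin indicE mulr_ge0// gweight_ge0.
have k0 y : 0 <= K * gauss_peak beta * (gweight y * \1_A y).
  by rewrite indicE !mulr_ge0// ltW// gweight_gt0.
rewrite -(@esum_int _ (fun j => (K * gauss_peak beta *
  (gweight (j%:~R - phi) * \1_A (j%:~R - phi)))%:E)); last first.
  by move=> j; rewrite lee_fin.
apply: (@integral_le_esum _ s (- phi)).
- exact: measurable_gauss_scaled.
- by move=> x; rewrite lee_fin indicE mulr_ge0// mulr_ge0// gauss_dens_ge0.
- by move=> j.
move=> j x sx; rewrite lee_fin mul1r !indicE.
have [Ay|] := boolP (_ \in A'); last by move=> _; rewrite mulr0 -indicE.
have [A'y le] := h _ _ sx (set_mem Ay).
rewrite (mem_set A'y) !mulr1 gauss_densE// -[leRHS]mulrA [leRHS]mulrCA.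
by rewrite ler_pM2l.
Qed.

Let cell_const := expR (2 * beta).

(** The bound 4 covers all four estimates below: moving a point of []-oo, 1]] to the right by at
    most one raises its square by at most 3, and symmetrically. *)
Let gweight_le (y z : R) : y ^+ 2 - z ^+ 2 <= 4 ->
  gweight z <= cell_const * gweight y.
Proof.
rewrite -expRD ler_expR -[_ <= 4]subr_ge0 => /(mulr_ge0 (ltW beta_gt0)); lra.
Qed.

Let K1 := cell_const / gauss_peak beta.
Let K2 := cell_const * gauss_peak beta.

(** Atoms of the left tail are spread to their right, toward the bulk; spread outward, the weight
    would drop by an unbounded factor. For the reverse bound the cell lies to the left of its
    atom. *)
Lemma lattice_mass_left_le (phi t : R) : t <= 1 ->
  (lattice_mass phi `]-oo, t]%classic <= (K1 * Phi (t + 1))%:E)%E.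
Proof.
move=> t1; rewrite EFinM -dfunE.
apply: (@lattice_mass_le 0); rewrite ?expR_ge0// => y x.
rewrite add0r /= !in_itv/= => /andP[x0 x1] yt; split; first lra.
by apply: gweight_le; nra.
Qed.

Lemma lattice_mass_left_ge (phi t : R) : t <= 1 ->
  ((Phi (t - 1))%:E <= K2%:E * lattice_mass phi `]-oo, t]%classic)%E.
Proof.
move=> t1; rewrite -dfunE.
apply: (@lattice_mass_ge (-1)); rewrite ?expR_ge0// => y x.
rewrite addNr /= !in_itv/= => /andP[x0 x1] yt; split; first lra.
by apply: gweight_le; nra.
Qed.

Lemma lattice_mass_right_le (phi t : R) : -1 <= t ->
  (lattice_mass phi `]t, +oo[%classic <= (K1 * (1 - Phi (t - 1)))%:E)%E.
Proof.
move=> t1; rewrite EFinM -dfun_tail.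
apply: (@lattice_mass_le (-1)); rewrite ?expR_ge0// => y x.
rewrite addNr /= !in_itv/= !andbT => /andP[x0 x1] yt; split; first lra.
by apply: gweight_le; nra.
Qed.

Lemma lattice_mass_right_ge (phi t : R) : -1 <= t ->
  ((1 - Phi (t + 1))%:E <= K2%:E * lattice_mass phi `]t, +oo[%classic)%E.
Proof.
move=> t1; rewrite -dfun_tail.
apply: (@lattice_mass_ge 0); rewrite ?expR_ge0// => y x.
rewrite add0r /= !in_itv/= !andbT => /andP[x0 x1] yt; split; first lra.
by apply: gweight_le; nra.
Qed.

End lattice_gaussian.

Lemma le_sum6 (R : realFieldType) (a b c d e f : R) :
  0 <= a -> 0 <= b -> 0 <= c -> 0 <= d -> 0 <= e -> 0 <= f ->
  let K := a + b + c + d + e + f in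
  a <= K /\ b <= K /\ c <= K /\ d <= K /\ e <= K /\ f <= K.
Proof. by move=> a0 b0 c0 d0 e0 f0 K; rewrite {}/K; do ?split; lra. Qed.

Section lattice_theta.
Context {R : realType} (beta : R).
Hypothesis beta_gt0 : 0 < beta.
Notation gauss := (gauss_prob beta).
Notation Phi := (dfun (gauss_prob beta)).
Notation G := (gweight beta).

Definition lattice_theta (phi : R) : R := fine (lattice_mass beta phi setT).

Let K1 := expR (2 * beta) / gauss_peak beta.

Let K1_gt0 : 0 < K1.
Proof. by rewrite divr_gt0 ?expR_gt0 ?gauss_peak_gt0. Qed.

Lemma lattice_mass_le_ub phi A :
  (lattice_mass beta phi A <= (2 * K1)%:E)%E.
Proof.
apply: (@le_trans _ _ (lattice_mass beta phi `]-oo, 0%R]%classic +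
    lattice_mass beta phi `]0%R, +oo[%classic)%E).
  rewrite /lattice_mass -esumD.
  - apply: le_esum => j _; rewrite -EFinD lee_fin -mulrDr ler_pM2l ?gweight_gt0//.
    rewrite !indicE !mem_setE !in_itv/= andbT.
    by case: (_ \in A); case: ltP; rewrite ?addr0 ?add0r.
  - by move=> j _; rewrite lee_fin indicE mulr_ge0// gweight_ge0.
  - by move=> j _; rewrite lee_fin indicE mulr_ge0// gweight_ge0.
rewrite mulrDl mul1r EFinD; apply: leeD.
  apply: le_trans (lattice_mass_left_le beta_gt0 _ _) _; first by rewrite ler01.
  by rewrite lee_fin ler_piMr ?(ltW K1_gt0)// dfun_le1.
apply: le_trans (lattice_mass_right_le beta_gt0 _ _) _; first by rewrite lerN10.
by rewrite lee_fin ler_piMr ?(ltW K1_gt0)// gerBl dfun_ge0.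
Qed.

Lemma lattice_mass_fin phi A : lattice_mass beta phi A \is a fin_num.
Proof.
rewrite ge0_fin_numE ?lattice_mass_ge0//.
exact: le_lt_trans (lattice_mass_le_ub _ _) (ltry _).
Qed.

Lemma lattice_thetaE phi : (lattice_theta phi)%:E = lattice_mass beta phi setT.
Proof. by rewrite fineK// lattice_mass_fin. Qed.

Lemma lattice_theta_ub phi : lattice_theta phi <= 2 * K1.
Proof. by rewrite -lee_fin lattice_thetaE lattice_mass_le_ub. Qed.

(** Some integer lies within distance one of [phi], and its term alone gives the bound. *)
Lemma lattice_theta_lb phi : expR (- (beta / 2)) <= lattice_theta phi.
Proof.
have [j /andP[j0 j1]] := int_cell 0 phi.
rewrite add0r in j1; rewrite -lee_fin lattice_thetaE.
apply: (@le_trans _ _ (\esum_(i in [set j]) (G (i%:~R - phi) * \1_setT (i%:~R - phi))%:E)%E).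
  rewrite esum_set1; last by rewrite lee_fin indicE mulr_ge0// gweight_ge0.
  rewrite indicT mulr1 lee_fin ler_expR lerN2 ler_piMr//.
    by rewrite divr_ge0// ltW.
  rewrite -sqrrN opprB; move: j0 j1; move: (phi - _) => u u0 u1.
  by rewrite expr_le1// ltW.
rewrite /lattice_mass (@esum_mkcond _ _ [set j]); apply: le_esum => i _.
case: ifP => // _; by rewrite lee_fin indicE mulr_ge0// gweight_ge0.
Qed.

Lemma lattice_theta_gt0 phi : 0 < lattice_theta phi.
Proof. exact: lt_le_trans (expR_gt0 _) (lattice_theta_lb phi). Qed.

Lemma eff_pot0E b phi : eff_pot b beta 0 phi = - ln (lattice_theta phi).
Proof.
rewrite /= /lattice_theta /lattice_mass; congr (- ln (fine _)).
apply: eq_esum => j _; rewrite indicT mulr1 /gweight; congr (expR (- (_ * _)))%:E.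
by rewrite -sqrrN opprB.
Qed.

Lemma trans_law0E b phi A : trans_law b beta 0 phi A =
  ((lattice_theta phi)^-1%:E * lattice_mass beta phi A)%E.
Proof.
have t0 := lattice_theta_gt0 phi.
rewrite lattice_massE /trans_law.
rewrite esum_mkcond [in RHS]esum_mkcond !esum_int.
- rewrite -nneseriesZl; last by move=> k _; case: ifP => // _; rewrite lee_fin gweight_ge0.
  apply: eq_eseriesr => k _; case: ifP => _; last by rewrite mule0.
  rewrite eff_pot0E -EFinM; congr EFin; rewrite expRD expRN lnK ?posrE//.
- by move=> j; case: ifP => // _; rewrite lee_fin gweight_ge0.
- by move=> j; case: ifP => // _; rewrite lee_fin expR_ge0.
Qed.

Lemma measurable_lattice_mass A : measurable A ->
  measurable_fun setT (fun phi => lattice_mass beta phi A).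
Proof.
move=> mA; pose f j phi := (G ((int_enum j)%:~R - phi) * \1_A ((int_enum j)%:~R - phi))%:E.
have f0 j phi : (0 <= f j phi)%E.
  by rewrite lee_fin indicE mulr_ge0// gweight_ge0.
rewrite (_ : (fun phi => _) = (fun phi => \sum_(j <oo) f j phi)%E); last first.
  apply/funext => phi; rewrite /lattice_mass esum_int// => j.
  by rewrite lee_fin indicE mulr_ge0// gweight_ge0.
apply: ge0_emeasurable_sum => // j _; apply/measurable_EFinP.
have ms (c : R) : measurable_fun setT (fun phi : R => c - phi).
  exact: measurable_funB.
apply: measurable_funM.
  exact: (measurableT_comp (measurable_gweight beta)).
have m1 : measurable_fun setT (\1_A : R -> R) by exact: measurable_indic.
exact: (measurableT_comp m1).
Qed.

Definition lattice_law (phi : R) : set R -> \bar R :=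
  fun A => ((lattice_theta phi)^-1%:E * lattice_mass beta phi A)%E.

Section lattice_law_probability.
Variable phi : R.

Let law0 : lattice_law phi set0 = 0%E.
Proof.
rewrite /lattice_law /lattice_mass esum1 ?mule0// => j _.
by rewrite indic0 mulr0.
Qed.

Let law_ge0 A : (0 <= lattice_law phi A)%E.
Proof.
by rewrite mule_ge0 ?lattice_mass_ge0// lee_fin invr_ge0 ltW// lattice_theta_gt0.
Qed.

Let law_sigma_additive : semi_sigma_additive (lattice_law phi).
Proof.
move=> F mF tF mUF.
have E : lattice_law phi (\bigcup_k F k) = (\sum_(k <oo) lattice_law phi (F k))%E.
  rewrite /lattice_law nneseriesZl => [|k _]; last exact: lattice_mass_ge0.
  congr (_ * _)%E; rewrite lattice_massE.
  rewrite (_ : [set j : int | _] =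
    \bigcup_k [set j : int | F k (j%:~R - phi)]); last first.
    by apply/seteqP; split=> j [k _ Fk]; exists k.
  rewrite esum_bigcupT; last 2 first.
  - by move=> k l _ _ [j [Fk Fl]]; apply: (tF k l) => //; exists (j%:~R - phi).
  - by move=> j; rewrite lee_fin gweight_ge0.
  rewrite nneseries_esumT => [|k]; last exact: lattice_mass_ge0.
  by apply: eq_esum => k _; rewrite lattice_massE.
rewrite E; apply: is_cvg_ereal_nneg_natsum_cond => k _ _; exact: law_ge0.
Qed.

HB.instance Definition _ := isMeasure.Build _ R R (lattice_law phi)
  law0 law_ge0 law_sigma_additive.

Let law_setT : lattice_law phi setT = 1%E.
Proof.
by rewrite /lattice_law -lattice_thetaE -EFinM mulVf// gt_eqF// lattice_theta_gt0.
Qed.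

HB.instance Definition _ :=
  Measure_isProbability.Build _ R R (lattice_law phi) law_setT.

End lattice_law_probability.

(** The left tail estimates need t <= 1 and the right ones t >= -1. For other t the mass on the
    larger side is bounded away from zero, and a constant factor is enough. *)
Lemma lattice_law_comparable :
  exists2 K, 0 < K & forall phi, comparable_dfun beta K (dfun (lattice_law phi)).
Proof.
have p0 := gauss_peak_gt0 beta_gt0.
pose m := expR (- (beta / 2)); have m0 : 0 < m by exact: expR_gt0.
(* The constants u and l below transfer the upper and lower bounds on masses to the normalized law,
   through the lower and upper bounds on [lattice_theta]. *)
pose K2 := expR (2 * beta) * gauss_peak beta.
have K20 : 0 < K2 by rewrite mulr_gt0// expR_gt0.
pose u := K1 / m; pose l := K2 * (2 * K1).
have u0 : 0 < u by rewrite divr_gt0 ?K1_gt0.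
have l0 : 0 < l by rewrite mulr_gt0// mulr_gt0 ?K1_gt0.
have P2 := gauss_dfun_gt0 beta_gt0 2; have P0 := gauss_dfun_gt0 beta_gt0 0.
have Q2 : 0 < 1 - Phi (- 2) by rewrite subr_gt0 gauss_dfun_lt1.
have Q0 : 0 < 1 - Phi 0 by rewrite subr_gt0 gauss_dfun_lt1.
have Pn := @dfun_nondecreasing _ gauss.
(* The last four terms handle the t outside the range of the tail estimates. *)
pose K := u + l + (Phi 2)^-1 + (1 - Phi (- 2))^-1 + l / Phi 0 + l / (1 - Phi 0).
have [hu [hl [h1 [h2 [h3 h4]]]]] : u <= K /\ l <= K /\ (Phi 2)^-1 <= K /\
    (1 - Phi (- 2))^-1 <= K /\ l / Phi 0 <= K /\ l / (1 - Phi 0) <= K.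
  by apply: le_sum6; rewrite ?invr_ge0; try apply: divr_ge0; exact: ltW.
have K0 : 0 < K by apply: lt_le_trans hu.
exists K => // phi t.
have t0 := lattice_theta_gt0 phi.
have tlb := lattice_theta_lb phi; have tub := lattice_theta_ub phi.
pose F := dfun (lattice_law phi).
have FE s : (F s)%:E = lattice_law phi `]-oo, s]%classic by rewrite -dfunE.
have FTE s : (1 - F s)%:E = lattice_law phi `]s, +oo[%classic by rewrite -dfun_tail.
have Fn s s' : s <= s' -> F s <= F s' by exact: dfun_nondecreasing.
have lawub A x : 0 <= x -> (lattice_mass beta phi A <= (K1 * x)%:E)%E ->
    (lattice_law phi A <= (u * x)%:E)%E.
  move=> x0 h; rewrite /lattice_law.
  apply: le_trans (lee_wpmul2l _ h) _; first by rewrite lee_fin invr_ge0 ltW.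
  rewrite -EFinM lee_fin /u [leRHS]mulrAC [leRHS]mulrC.
  apply: ler_wpM2r; first by rewrite mulr_ge0// ltW// K1_gt0.
  by rewrite lef_pV2// posrE.
have lawlb A x : (x%:E <= K2%:E * lattice_mass beta phi A)%E ->
    (x%:E <= l%:E * lattice_law phi A)%E.
  move=> h; apply: le_trans h _; rewrite /l [(K2 * _)%:E]EFinM -[leRHS]muleA.
  apply: lee_wpmul2l; first by rewrite lee_fin ltW.
  rewrite /lattice_law muleA -EFinM -[leLHS]mul1e.
  apply: lee_wpmul2r; first exact: lattice_mass_ge0.
  by rewrite lee_fin ler_pdivlMr// mul1r.
have lK x : 0 <= x -> l * x <= K * x by move=> x0; rewrite ler_wpM2r.
have uK x : 0 <= x -> u * x <= K * x by move=> x0; rewrite ler_wpM2r.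
have F1 s : F s <= 1 by exact: dfun_le1.
have F0 s : 0 <= F s by exact: dfun_ge0.
have P1 s : Phi s <= 1 by exact: dfun_le1.
have PP0 s : 0 <= Phi s by exact: dfun_ge0.
have left_lb s : s <= 1 -> Phi (s - 1) <= l * F s.
  by move=> s1; rewrite -lee_fin EFinM FE; apply: lawlb; exact: lattice_mass_left_ge.
have right_lb s : -1 <= s -> 1 - Phi (s + 1) <= l * (1 - F s).
  by move=> s1; rewrite -lee_fin EFinM FTE; apply: lawlb; exact: lattice_mass_right_ge.
split; rewrite -/F.
- have [t1|t1] := leP t 1.
    apply: le_trans (uK _ (PP0 _)); rewrite -lee_fin FE.
    by apply: lawub => //; exact: lattice_mass_left_le.
  apply: le_trans (F1 t) _; rewrite -ler_pdivrMr ?gauss_dfun_gt0//.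
  rewrite mul1r; apply: le_trans h1; rewrite lef_pV2 ?posrE ?gauss_dfun_gt0//.
  by apply: Pn; lra.
- have [t1|t1] := leP t 1.
    by apply: le_trans (lK _ (F0 _)); exact: left_lb.
  apply: le_trans (P1 _) _; apply: (@le_trans _ _ (K * F 1)); last first.
    by rewrite ler_pM2l// Fn// ltW.
  apply: (@le_trans _ _ (l / Phi 0 * F 1)); last by rewrite ler_wpM2r.
  by rewrite mulrAC ler_pdivlMr// mul1r -[in leLHS](subrr 1) left_lb.
- have [t1|t1] := leP (-1) t.
    apply: le_trans (uK _ _); last by rewrite subr_ge0.
    rewrite -lee_fin FTE; apply: lawub; first by rewrite subr_ge0.
    exact: lattice_mass_right_le.
  apply: (@le_trans _ _ 1); first by rewrite gerBl.
  rewrite -ler_pdivrMr ?subr_gt0 ?gauss_dfun_lt1//.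
  rewrite mul1r; apply: le_trans h2; rewrite lef_pV2 ?posrE ?subr_gt0 ?gauss_dfun_lt1//.
  by rewrite lerD2l lerN2; apply: Pn; lra.
- have [t1|t1] := leP (-1) t.
    by apply: le_trans (lK _ _); [exact: right_lb|rewrite subr_ge0].
  apply: (@le_trans _ _ 1); first by rewrite gerBl.
  apply: (@le_trans _ _ (K * (1 - F (- 1)))); last first.
    by rewrite ler_pM2l// lerD2l lerN2 Fn// ltW.
  apply: (@le_trans _ _ (l / (1 - Phi 0) * (1 - F (- 1)))); last first.
    by rewrite ler_wpM2r// subr_ge0.
  by rewrite mulrAC ler_pdivlMr// mul1r -[in leLHS](addNr 1) right_lb.
Qed.

(** The bit is ignored, since no agreement is required for k = 0; hence its law Q is arbitrary. *)
Lemma discrete_step b : exists2 C, 0 < C & forall Q : probability bool R,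
  exists step : R -> R * bool -> R,
    [/\ measurable_fun setT (fun y : R * (R * bool) => step y.1 y.2),
        forall phi A, measurable A ->
          (gauss \x Q)%E (step phi @^-1` A) = trans_law b beta 0 phi A &
        forall phi a, `|step phi a - a.1| <= C].
Proof.
have [K K0 comp] := lattice_law_comparable.
have [C C0 near] := shift_of_comparable beta_gt0 K0.
exists C => // Q; pose F phi t := dfun (lattice_law phi) t.
have nearF phi : forall t, Phi (t - C) <= F phi t <= Phi (t + C).
  by apply: near; exact: comp.
have mF t : measurable_fun setT (F^~ t).
  have mt : measurable_fun setT lattice_theta.
    apply: (measurableT_comp (f := @fine R)) => //.
    exact: measurable_lattice_mass.
  apply: (measurableT_comp (f := @fine R)
    (g := fun phi => lattice_law phi `]-oo, t]%classic)) => //.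
  apply: emeasurable_funM; last exact: measurable_lattice_mass.
  rewrite (_ : (fun phi => _) = (fun phi => (expR (- ln (lattice_theta phi)))%:E)).
    apply/measurable_EFinP/measurableT_comp => //; apply: measurableT_comp => //.
    by apply: (measurableT_comp (@measurable_ln R)).
  by apply/funext => phi; rewrite expRN lnK// posrE lattice_theta_gt0.
have F_nd phi s t : s <= t -> F phi s <= F phi t by exact: dfun_nondecreasing.
have F_rc phi x t : (forall s, t < s -> x <= F phi s) -> x <= F phi t.
  exact: dfun_right_continuous.
pose q := quantile beta F.
have mq : measurable_fun setT (fun y : R * R => q y.1 y.2).
  exact: (measurable_quantile beta_gt0 mF F_nd F_rc nearF).
have mqphi phi : measurable_fun setT (q phi).
  apply: (measurableT_comp (f := fun y : R * R => q y.1 y.2)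
    (g := fun z => (phi, z))) => //; exact: measurable_fun_pair.
exists (fun phi a => q phi a.1); split.
- apply: (measurableT_comp (f := fun y : R * R => q y.1 y.2)
    (g := fun y : R * (R * bool) => (y.1, y.2.1))) => //.
  apply: measurable_fun_pair => //; exact: (measurableT_comp (f := fst)).
- move=> phi A mA; rewrite trans_law0E.
  have PF : dfun (lattice_law phi) =1 F phi by [].
  have ql := quantile_law beta_gt0 mF F_nd F_rc nearF PF mA.
  transitivity (gauss (q phi @^-1` A) * Q setT)%E; last first.
    by rewrite probability_setT mule1; exact: ql.
  rewrite -product_measure1E//; last first.
    by rewrite -[X in measurable X]setTI; exact: mqphi.
  by congr (_ _); apply/seteqP; split=> a //= [].
- by move=> phi a; exact: quantile_near.
Qed.

End lattice_theta.

(** * Gaussian averages of trigonometric polynomials *)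

Section real_lebesgue_shift.
Context {R : realType}.
Notation M := (@lebesgue_measure R).

Lemma integral_shift (c : R) (f : R -> \bar R) : measurable_fun setT f ->
  (\int[M]_x f (x + c)%R = \int[M]_x f x)%E.
Proof.
move=> mf; rewrite [LHS]integralE [RHS]integralE; congr (_ - _)%E.
  rewrite -[RHS](ge0_integral_shiftT c (measurable_funepos mf))//.
  by apply: eq_integral => x _; rewrite !funepos.unlock.
rewrite -[RHS](ge0_integral_shiftT c (measurable_funeneg mf))//.
by apply: eq_integral => x _; rewrite !funeneg.unlock.
Qed.

Lemma Rintegral_shift (c : R) (f : R -> R) : measurable_fun setT f ->
  \int[M]_x f (x + c) = \int[M]_x f x.
Proof.
move=> mf; rewrite /Rintegral (integral_shift c (f := EFin \o f))//.
exact/measurable_EFinP.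
Qed.

Lemma integrable_shift (c : R) (f : R -> R) :
  M.-integrable setT (EFin \o f) ->
  M.-integrable setT (EFin \o (fun x => f (x + c))).
Proof.
move=> /integrableP[mf fi]; apply/integrableP; split.
  apply: (measurableT_comp (f := EFin \o f : measurableTypeR R -> _)) => //.
  exact: measurable_shift.
apply: le_lt_trans fi; rewrite le_eqVlt; apply/orP; left; apply/eqP.
rewrite -[RHS](integral_shift c)//; exact: measurableT_comp.
Qed.

Lemma Rintegral_oppr (f : R -> R) : M.-integrable setT (EFin \o f) ->
  \int[M]_x f x = \int[M]_x f (- x).
Proof.
move=> /integrableP[mf _]; rewrite /Rintegral; congr fine.
rewrite [LHS]integralE [RHS]integralE; congr (_ - _)%E.
  rewrite [LHS](ge0_integral_oppr (measurable_funepos mf))//.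
  by apply: eq_integral => x _; rewrite !funepos.unlock.
rewrite [LHS](ge0_integral_oppr (measurable_funeneg mf))//.
by apply: eq_integral => x _; rewrite !funeneg.unlock.
Qed.

End real_lebesgue_shift.

Section gaussian_characteristic_function.
Context {R : realType} (beta : R).
Hypothesis beta_gt0 : 0 < beta.
Notation M := (@lebesgue_measure R).
Notation g := (gauss_dens beta).

Lemma integrable_gauss_dominated (gamma D : R) (f : R -> R) : 0 < gamma ->
  measurable_fun setT f -> (forall x, `|f x| <= D * gauss_dens gamma x) ->
  M.-integrable setT (EFin \o f).
Proof.
move=> gamma0 mf fD.
have iD : M.-integrable setT (fun x => (D * gauss_dens gamma x)%:E).
  have := integrable_normal_pdf (0 : R) (Num.sqrt gamma^-1).
  by move=> /(integrableZl measurableT D); apply: eq_integrable => // x _.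
apply: (le_integrable measurableT _ _ iD); first exact/measurable_EFinP.
move=> x _ /=; rewrite lee_fin; apply: le_trans (fD x) _; exact: ler_norm.
Qed.

(** Provides a dominating function, uniform under shifts by at most one, for differentiation under
    the integral and for sums of differences over the integers. The wider Gaussian has twice the
    standard deviation. *)
Lemma gauss_dens_widen (c : R) : exists2 D : R, 0 <= D &
  forall x h, `|h| <= 1 ->
    (c + `|x + h|) * g (x + h) <= D * gauss_dens (beta / 4) x.
Proof.
have p0 := gauss_peak_gt0 beta_gt0.
have b4 : 0 < beta / 4 by rewrite divr_gt0.
have q0 := gauss_peak_gt0 b4.
pose K : R := `|c| + 1 + 4 / beta.
have K0 : 0 <= K by rewrite !addr_ge0 ?normr_ge0// divr_ge0// ltW.
exists (gauss_peak beta * K * expR (beta / 4) / gauss_peak (beta / 4)).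
  by rewrite divr_ge0 ?(ltW q0)// !mulr_ge0 ?expR_ge0// ltW.
move=> x h h1; rewrite (gauss_densE beta_gt0) (gauss_densE b4).
set y := x + h; have y2 : x ^+ 2 / 2 - 1 <= y ^+ 2.
  have : h ^+ 2 <= 1 by rewrite -real_normK ?num_real// expr_le1.
  have := sqr_ge0 (x + 2 * h); rewrite /y; nra.
(* Half of the exponent [beta / 2 * y ^+ 2] absorbs the linear factor; the other half, by [y2],
   yields the wider Gaussian. *)
have yK : c + `|y| <= K * (1 + beta / 4 * y ^+ 2).
  have e4 : 4 / beta * (beta / 4 * y ^+ 2) = y ^+ 2 by field; rewrite gt_eqF.
  have : `|y| <= 1 + y ^+ 2.
    rewrite -(real_normK (num_real y)); have := sqr_ge0 (`|y| - 1).
    have := normr_ge0 y; nra.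
  have : 0 <= (`|c| + 1) * (beta / 4 * y ^+ 2).
    apply: mulr_ge0; first by rewrite addr_ge0.
    by apply: mulr_ge0; [exact: ltW|exact: sqr_ge0].
  have := ler_norm c; have : 0 <= 4 / beta by rewrite divr_ge0// ltW.
  move: e4; rewrite /K; move: (`|c|) (`|y|) (4 / beta) (beta / 4 * _) => A B D F.
  lra.
have step1 : K * (1 + beta / 4 * y ^+ 2) <= K * expR (beta / 4 * y ^+ 2).
  by apply: ler_wpM2l => //; exact: expR_ge1Dx.
apply: (@le_trans _ _ (K * expR (beta / 4 * y ^+ 2) *
    (gauss_peak beta * expR (- (beta / 2 * y ^+ 2))))).
  apply: ler_wpM2r; first by rewrite mulr_ge0 ?expR_ge0// ltW.
  exact: le_trans yK step1.
have -> : K * expR (beta / 4 * y ^+ 2) *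
    (gauss_peak beta * expR (- (beta / 2 * y ^+ 2))) =
    gauss_peak beta * K * expR (- (beta / 4 * y ^+ 2)).
  rewrite mulrACA [K * _]mulrC -expRD; congr (_ * expR _).
  by field.
apply: (@le_trans _ _ (gauss_peak beta * K *
    expR (beta / 4 - beta / 4 / 2 * x ^+ 2))); last first.
  rewrite le_eqVlt; apply/orP; left; apply/eqP.
  rewrite expRD -!mulrA; congr (_ * (_ * (_ * _))).
  by rewrite mulKf// gt_eqF.
apply: ler_wpM2l; first by rewrite mulr_ge0// ltW.
rewrite ler_expR; have : 0 <= beta / 4 * (y ^+ 2 - (x ^+ 2 / 2 - 1)).
  by rewrite mulr_ge0 ?subr_ge0// ltW.
lra.
Qed.

Definition gauss_char (c : R) : R := \int[M]_x (cos (c * x) * g x).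

Let measurable_dens : measurable_fun setT (g : R -> R).
Proof. exact: measurable_normal_pdf. Qed.

Let measurable_cosM (c : R) : measurable_fun setT (fun x : R => cos (c * x)).
Proof.
apply: (measurableT_comp (f := @cos R)); last exact: measurable_funM.
apply: continuous_measurable_fun; exact: continuous_cos.
Qed.

Let measurable_sinM (c : R) : measurable_fun setT (fun x : R => sin (c * x)).
Proof.
apply: (measurableT_comp (f := @sin R)); last exact: measurable_funM.
apply: continuous_measurable_fun; exact: continuous_sin.
Qed.

Lemma integrable_bounded_dens (u : R -> R) (K : R) : measurable_fun setT u ->
  (forall x, `|u x| <= K) -> M.-integrable setT (EFin \o (fun x => u x * g x)).
Proof.
move=> mu uK; apply: (@integrable_gauss_dominated beta K) => //.
  exact: measurable_funM.
move=> x; rewrite normrM (ger0_norm (gauss_dens_ge0 beta_gt0 _)).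
by rewrite ler_wpM2r ?gauss_dens_ge0.
Qed.

Lemma integrable_cos_dens c : M.-integrable setT (EFin \o (fun x => cos (c * x) * g x)).
Proof.
by apply: (integrable_bounded_dens (measurable_cosM c)) => x; exact: cos_max.
Qed.

Lemma integrable_sin_dens c : M.-integrable setT (EFin \o (fun x => sin (c * x) * g x)).
Proof.
by apply: (integrable_bounded_dens (measurable_sinM c)) => x; exact: sin_max.
Qed.

Lemma is_derive_gauss_dens (x : R) : is_derive x 1 g (- (beta * x) * g x).
Proof.
have -> : g = (fun x => gauss_peak beta * expR (- (beta / 2 * x ^+ 2))).
  by apply/funext => y; exact: gauss_densE.
apply: is_derive_eq; rewrite /GRing.scale /=.
by move: (expR _) (gauss_peak _) => E p; lra.
Qed.

Let sin_dens (c x : R) := x * sin (c * x) * g x.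

Let sin_dens_le : exists2 D : R, 0 <= D &
  forall c x, `|sin_dens c x| <= D * gauss_dens (beta / 4) x.
Proof.
have [D D0 h] := gauss_dens_widen 0; exists D => // c x.
have := h x 0; rewrite normr0 addr0 add0r => /(_ ler01); apply: le_trans.
rewrite /sin_dens !normrM (ger0_norm (gauss_dens_ge0 beta_gt0 _)).
rewrite ler_wpM2r ?gauss_dens_ge0// ler_piMr//; exact: sin_max.
Qed.

Let measurable_sin_dens c : measurable_fun setT (sin_dens c).
Proof.
by apply: measurable_funM => //; exact: measurable_funM.
Qed.

Lemma integrable_sin_dens1 c : M.-integrable setT (EFin \o sin_dens c).
Proof.
have [D D0 h] := sin_dens_le.
apply: (@integrable_gauss_dominated (beta / 4) D); rewrite ?divr_gt0//.
Qed.

Let integrable_dominating (D : R) :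
  M.-integrable setT (EFin \o (fun x => D * gauss_dens (beta / 4) x)).
Proof.
have b4 : 0 < beta / 4 by rewrite divr_gt0.
apply: (@integrable_gauss_dominated (beta / 4) `|D|) => //.
  by apply: measurable_funM => //; exact: measurable_normal_pdf.
move=> x; rewrite normrM; apply: ler_wpM2l => //.
by rewrite ger0_norm ?lexx ?gauss_dens_ge0.
Qed.

Lemma is_derive_gauss_char (c : R) :
  is_derive c 1 gauss_char (- \int[M]_x sin_dens c x).
Proof.
have [D D0 h] := sin_dens_le.
pose f (a : R) (x : measurableTypeR R) := cos (a * x) * g x.
have df (a x : R) : is_derive a 1 (f ^~ x) (- sin_dens a x).
  by apply: is_derive_eq; rewrite /sin_dens /GRing.scale/=; ring.
have d1 (a x : R) : partial1of2 f a x = - sin_dens a x.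
  by rewrite partial1of2E; exact: derive_val.
have Ic : `]c - 1, c + 1[%classic c by rewrite /= in_itv/= gtrBl ltrDl ltr01.
have intf a : `]c - 1, c + 1[%classic a -> M.-integrable setT (EFin \o f a).
  by move=> _; exact: integrable_cos_dens.
have der a x : `]c - 1, c + 1[%classic a -> setT x -> derivable (f ^~ x) a 1.
  by move=> _ _; exact: ex_derive.
have G0 x : 0 <= D * gauss_dens (beta / 4) x.
  by rewrite mulr_ge0// gauss_dens_ge0// divr_gt0.
have Gub a x : `]c - 1, c + 1[%classic a -> setT x ->
    `|partial1of2 f a x| <= D * gauss_dens (beta / 4) x.
  by move=> _ _; rewrite d1 normrN.
have dd := derivable_under_integral measurableT Ic intf der G0
  (integrable_dominating D) Gub.
have dv := differentiation_under_integral measurableT Ic intf der G0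
  (integrable_dominating D) Gub.
apply: (@DeriveDef _ _ _ _ _ gauss_char); first exact: dd.
rewrite -derive1E; apply: etrans dv _.
under eq_Rintegral => x _ do rewrite d1 -mulN1r.
by rewrite RintegralZl ?mulN1r//; exact: integrable_sin_dens1.
Qed.

(* The integral of the derivative of sin (c x) g x vanishes, since shifting
   that function does not change its integral. *)
Lemma gauss_char_parts (c : R) :
  beta * \int[M]_x sin_dens c x = c * gauss_char c.
Proof.
have [D D0 h] := gauss_dens_widen (`|c| / beta).
pose u (y : R) := sin (c * y) * g y.
pose u' (y : R) := c * (cos (c * y) * g y) - beta * sin_dens c y.
pose f (a : R) (x : measurableTypeR R) := u (x + a).
have du (y : R) : is_derive y 1 u (u' y).
  have dg := is_derive_gauss_dens y.
  apply: is_derive_eq; rewrite /u' /sin_dens /GRing.scale/=; ring.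
have df (a x : R) : is_derive a 1 (f ^~ x) (u' (x + a)).
  have := du (x + a) => dux.
  by apply: is_derive_eq; rewrite /GRing.scale/= add0r mulr1.
have d1 (a x : R) : partial1of2 f a x = u' (x + a).
  by rewrite partial1of2E; exact: derive_val.
have I0 : `](-1), 1[%classic (0 : R) by rewrite /= in_itv/= ltrN10 ltr01.
have mu_ : measurable_fun setT u by exact: measurable_funM.
have iu : M.-integrable setT (EFin \o u) by exact: integrable_sin_dens.
have intf a : `](-1), 1[%classic a -> M.-integrable setT (EFin \o f a).
  by move=> _; exact: (integrable_shift a iu).
have der a x : `](-1), 1[%classic a -> setT x -> derivable (f ^~ x) a 1.
  by move=> _ _; exact: ex_derive.
have G0 x : 0 <= beta * D * gauss_dens (beta / 4) x.
  by rewrite mulr_ge0// ?mulr_ge0// ?gauss_dens_ge0 ?divr_gt0// ltW.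
have Gub a x : `](-1), 1[%classic a -> setT x ->
    `|partial1of2 f a x| <= beta * D * gauss_dens (beta / 4) x.
  rewrite /= in_itv/= => a1 _; rewrite d1 -mulrA.
  have ha : `|a| <= 1 by rewrite ler_norml; case/andP: a1 => /ltW -> /ltW ->.
  apply: le_trans (ler_wpM2l (ltW beta_gt0) (h x a ha)).
  rewrite /u' /sin_dens; move: (x + a) => y.
  apply: le_trans (ler_normB _ _) _.
  have -> : beta * ((`|c| / beta + `|y|) * g y) = `|c| * g y + beta * (`|y| * g y).
    by field; rewrite gt_eqF.
  have gy := gauss_dens_ge0 beta_gt0 y.
  apply: lerD; rewrite !normrM (ger0_norm gy).
    apply: ler_wpM2l => //; apply: ler_piMl => //; exact: cos_max.
  rewrite (gtr0_norm beta_gt0); apply: ler_wpM2l; first exact: ltW.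
  apply: ler_wpM2r => //; apply: ler_piMr => //; exact: sin_max.
have := differentiation_under_integral measurableT I0 intf der G0
  (integrable_dominating (beta * D)) Gub.
rewrite (_ : (fun a => \int[M]_x f a x) = cst (\int[M]_x u x)); last first.
  by apply/funext => a; rewrite /f Rintegral_shift.
rewrite derive1_cst; under eq_Rintegral => x _ do rewrite d1 addr0.
rewrite RintegralB//; last 2 first.
- have := integrableZl measurableT c (integrable_cos_dens c).
  by apply: eq_integrable => // x _.
- have := integrableZl measurableT beta (integrable_sin_dens1 c).
  by apply: eq_integrable => // x _.
rewrite RintegralZl//; last exact: integrable_cos_dens.
rewrite RintegralZl//; last exact: integrable_sin_dens1.
by move/esym/eqP; rewrite subr_eq0 => /eqP ->.
Qed.

Lemma gauss_char0 : gauss_char 0 = 1.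
Proof.
rewrite /gauss_char /Rintegral.
under eq_integral => x _ do rewrite mul0r cos0 mul1r.
by rewrite [X in fine X]integral_normal_pdf.
Qed.

(** By [is_derive_gauss_char] and [gauss_char_parts] the function solves u' = - (c / beta) u, so its
    product with the inverse of the claimed solution has derivative zero. *)
Lemma gauss_charE (c : R) : gauss_char c = expR (- (c ^+ 2 / (2 * beta))).
Proof.
pose k (a : R) := gauss_char a * expR (a ^+ 2 / (2 * beta)).
have dk (a : R) : is_derive a 1 k 0.
  have dchar := is_derive_gauss_char a.
  apply: is_derive_eq; rewrite /GRing.scale/=.
  have /(congr1 (fun t => t / beta)) := gauss_char_parts a.
  rewrite mulrAC divff ?gt_eqF// mul1r => ->.
  move: (expR _) (gauss_char a) => E p; field; rewrite gt_eqF//.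
have := @is_derive_0_is_cst _ k c 0 dk.
rewrite /k gauss_char0 expr0n/= mul0r expR0 mulr1 => kc.
apply: (mulIf (lt0r_neq0 (expR_gt0 (c ^+ 2 / (2 * beta))))).
by rewrite kc -expRD addNr expR0.
Qed.

Lemma gauss_char_sin (c : R) : \int[M]_x (sin (c * x) * g x) = 0.
Proof.
have := Rintegral_oppr (integrable_sin_dens c).
have -> : \int[M]_x (sin (c * - x) * g (- x)) = -1 * \int[M]_x (sin (c * x) * g x).
  rewrite -RintegralZl//; last exact: integrable_sin_dens.
  have h (y : R) : sin (c * - y) * g (- y) = -1 * (sin (c * y) * g y).
    by rewrite gauss_densN// mulrN sinN mulN1r mulNr.
  by apply: eq_Rintegral => x _; exact: h.
by move: (Rintegral _ _ _) => I; lra.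
Qed.

End gaussian_characteristic_function.

Section trigonometric_polynomials.
Context {R : realType}.
Implicit Types (p q : {poly R}) (a t z e : R) (n m i j : nat).

(** [cos_poly] and [sin_poly] are the real and imaginary parts of e^(ia) p(e^(it)); the phase a
    shifts the frequencies, so that ordinary polynomials encode Laurent polynomials. *)
Definition cos_poly a t p : R := \sum_(i < size p) p`_i * cos (a + i%:R * t).
Definition sin_poly a t p : R := \sum_(i < size p) p`_i * sin (a + i%:R * t).

Lemma cos_poly_wide m a t p : (size p <= m)%N ->
  cos_poly a t p = \sum_(i < m) p`_i * cos (a + i%:R * t).
Proof.
move=> pm; rewrite /cos_poly (big_ord_widen m (fun i => p`_i * cos (a + i%:R * t)))//.
rewrite big_mkcond; apply: eq_bigr => i _; case: ltnP => // ip.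
by rewrite nth_default// mul0r.
Qed.

Lemma sin_poly_wide m a t p : (size p <= m)%N ->
  sin_poly a t p = \sum_(i < m) p`_i * sin (a + i%:R * t).
Proof.
move=> pm; rewrite /sin_poly (big_ord_widen m (fun i => p`_i * sin (a + i%:R * t)))//.
rewrite big_mkcond; apply: eq_bigr => i _; case: ltnP => // ip.
by rewrite nth_default// mul0r.
Qed.

Lemma cos_polyD a t p q : cos_poly a t (p + q) = cos_poly a t p + cos_poly a t q.
Proof.
pose m := maxn (size p) (size q).
rewrite !(@cos_poly_wide m) ?leq_maxl ?leq_maxr ?size_polyD// -big_split.
by apply: eq_bigr => i _; rewrite coefD mulrDl.
Qed.

Lemma sin_polyD a t p q : sin_poly a t (p + q) = sin_poly a t p + sin_poly a t q.
Proof.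
pose m := maxn (size p) (size q).
rewrite !(@sin_poly_wide m) ?leq_maxl ?leq_maxr ?size_polyD// -big_split.
by apply: eq_bigr => i _; rewrite coefD mulrDl.
Qed.

Lemma cos_polyZ a t c p : cos_poly a t (c *: p) = c * cos_poly a t p.
Proof.
rewrite !(@cos_poly_wide (size p)) ?size_scale_leq// big_distrr/=.
by apply: eq_bigr => i _; rewrite coefZ mulrA.
Qed.

Lemma sin_polyZ a t c p : sin_poly a t (c *: p) = c * sin_poly a t p.
Proof.
rewrite !(@sin_poly_wide (size p)) ?size_scale_leq// big_distrr/=.
by apply: eq_bigr => i _; rewrite coefZ mulrA.
Qed.

Lemma cos_polyC a t c : cos_poly a t c%:P = c * cos a.
Proof.
rewrite (@cos_poly_wide 1) ?size_polyC_leq1// big_ord1 coefC eqxx.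
by rewrite mul0r addr0.
Qed.

Lemma sin_polyC a t c : sin_poly a t c%:P = c * sin a.
Proof.
rewrite (@sin_poly_wide 1) ?size_polyC_leq1// big_ord1 coefC eqxx.
by rewrite mul0r addr0.
Qed.

Lemma cos_polyMX a t p : cos_poly a t (p * 'X) = cos_poly (a + t) t p.
Proof.
have sp : (size (p * 'X)%R <= (size p).+1)%N.
  by have [->|p0] := eqVneq p 0; rewrite ?mul0r ?size_poly0// size_mulX.
rewrite (cos_poly_wide _ _ sp) big_ord_recl coefMX eqxx mul0r add0r.
apply: eq_bigr => i _; rewrite coefMX/= mulrSr mulrDl mul1r; congr (_ * cos _).
by ring.
Qed.

Lemma sin_polyMX a t p : sin_poly a t (p * 'X) = sin_poly (a + t) t p.
Proof.
have sp : (size (p * 'X)%R <= (size p).+1)%N.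
  by have [->|p0] := eqVneq p 0; rewrite ?mul0r ?size_poly0// size_mulX.
rewrite (sin_poly_wide _ _ sp) big_ord_recl coefMX eqxx mul0r add0r.
apply: eq_bigr => i _; rewrite coefMX/= mulrSr mulrDl mul1r; congr (_ * sin _).
by ring.
Qed.

Lemma cos_poly_rot a b t p :
  cos_poly (a + b) t p = cos a * cos_poly b t p - sin a * sin_poly b t p.
Proof.
rewrite /cos_poly /sin_poly !big_distrr -sumrB/=; apply: eq_bigr => i _.
by rewrite -addrA [cos (a + _)]cosD; ring.
Qed.

Lemma sin_poly_rot a b t p :
  sin_poly (a + b) t p = sin a * cos_poly b t p + cos a * sin_poly b t p.
Proof.
rewrite /cos_poly /sin_poly !big_distrr -big_split/=; apply: eq_bigr => i _.
by rewrite -addrA [sin (a + _)]sinD; ring.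
Qed.

(** Complex multiplication in real form. The phase a varies in the induction because a factor ['X]
    is absorbed into it. *)
Lemma trig_polyM a b t p q :
  cos_poly (a + b) t (p * q) =
    cos_poly a t p * cos_poly b t q - sin_poly a t p * sin_poly b t q /\
  sin_poly (a + b) t (p * q) =
    sin_poly a t p * cos_poly b t q + cos_poly a t p * sin_poly b t q.
Proof.
elim/poly_ind: p a => [|p c IH] a.
  rewrite mul0r /cos_poly /sin_poly size_poly0 !big_ord0.
  by split; ring.
have [hc hs] := IH (a + t).
rewrite mulrDl mul_polyC -mulrA ['X * q]mulrC mulrA.
rewrite !(cos_polyD, sin_polyD, cos_polyMX, sin_polyMX, cos_polyZ, sin_polyZ,
  cos_polyC, sin_polyC).
rewrite ![a + b + t]addrAC hc hs (cos_poly_rot a b t q) (sin_poly_rot a b t q).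
by split; ring.
Qed.

(** The index n is meant to carry the frequency zero. With e = 1 this is unimodality, the case of
    binomial coefficients. *)
Definition decays e n p := [/\ forall i, 0 <= p`_i,
  forall i, (n <= i)%N -> p`_i.+1 <= e * p`_i &
  forall i, (i < n)%N -> p`_i <= e * p`_i.+1].

(** In the coefficient of index i + 1 with i >= n + m, every product p_j q_l has j > n or l > m.
    Lowering that index by one costs e1 or e2 and lands in the coefficient of index i, of which each
    of the two groups uses every term at most once. Below n + m the argument is mirrored. *)
Lemma decaysM e1 e2 n m p q : 0 <= e1 -> 0 <= e2 ->
  decays e1 n p -> decays e2 m q -> decays (e1 + e2) (n + m) (p * q).
Proof.
move=> e10 e20 [p0 pr pl] [q0 qr ql]; split=> [i|i ni|i ni].
- by rewrite coefM; apply: sumr_ge0 => j _; rewrite mulr_ge0.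
- rewrite mulrDl !coefM.
  have pq0 (j k : nat) : 0 <= p`_j * q`_k by rewrite mulr_ge0.
  pose A (j : nat) := if (j > n)%N then p`_j * q`_(i.+1 - j) else 0.
  pose B (j : nat) := if (j > n)%N then 0 else p`_j * q`_(i.+1 - j).
  have -> : \sum_(j < i.+2) p`_j * q`_(i.+1 - j) =
      \sum_(j < i.+2) A j + \sum_(j < i.+2) B j.
    rewrite -big_split; apply: eq_bigr => j _ /=; rewrite /A /B;
      by case: ltnP => _; rewrite ?addr0 ?add0r.
  apply: lerD; rewrite big_distrr/=.
    rewrite big_ord_recl {1}/A ltn0 add0r; apply: ler_sum => j _.
    rewrite /A /= /bump add1n subSS; case: ltnP => nj; last by rewrite mulr_ge0.
    by rewrite mulrA ler_wpM2r// pr.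
  rewrite big_ord_recr/= {2}/B ltnS (leq_trans _ ni) ?leq_addr// addr0.
  apply: ler_sum => j _; rewrite /B; case: ltnP => nj; first by rewrite mulr_ge0.
  have ji := ltn_ord j; rewrite ltnS in ji.
  rewrite mulrCA; apply: ler_wpM2l => //; rewrite subSn//; apply: qr.
  by move: ni nj ji; move: (nat_of_ord j) => k; lia.
- rewrite mulrDl !coefM.
  have pq0 (j k : nat) : 0 <= p`_j * q`_k by rewrite mulr_ge0.
  pose A (j : nat) := if (j < n)%N then p`_j * q`_(i - j) else 0.
  pose B (j : nat) := if (j < n)%N then 0 else p`_j * q`_(i - j).
  have -> : \sum_(j < i.+1) p`_j * q`_(i - j) =
      \sum_(j < i.+1) A j + \sum_(j < i.+1) B j.
    rewrite -big_split; apply: eq_bigr => j _ /=; rewrite /A /B;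
      by case: ltnP => _; rewrite ?addr0 ?add0r.
  apply: lerD; rewrite big_distrr/=.
    rewrite [leRHS]big_ord_recl; apply: ler_wpDl; first by rewrite mulr_ge0.
    apply: ler_sum => j _; rewrite /A /= /bump add1n subSS.
    case: ltnP => nj; last by rewrite mulr_ge0.
    by rewrite mulrA ler_wpM2r// pl.
  rewrite [leRHS]big_ord_recr/=; apply: ler_wpDr; first by rewrite mulr_ge0.
  apply: ler_sum => j _; rewrite /B; case: ltnP => nj; first by rewrite mulr_ge0.
  have ji := ltn_ord j; rewrite ltnS in ji.
  rewrite mulrCA; apply: ler_wpM2l => //; rewrite subSn//; apply: ql.
  by move: ni nj ji; move: (nat_of_ord j) => k; lia.
Qed.

Lemma decays1 : decays 0 0 (1 : {poly R}).
Proof.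
split=> [i|i _|//]; rewrite !coef1 ?ler0n// mul0r.
by rewrite lexx.
Qed.

Lemma decaysX e n p k : 0 <= e -> decays e n p -> decays (k%:R * e) (k * n) (p ^+ k).
Proof.
move=> e0 dp; elim: k => [|k IH]; first by rewrite mul0r mul0n expr0; exact: decays1.
rewrite mulSn exprS mulrSr [(_ + 1) * e]mulrDl mul1r addrC.
by apply: decaysM => //; rewrite mulr_ge0.
Qed.

(** A one-sided sum S satisfies S <= e (S + p_n) by a shift of one step toward n; hence S <= e / (1
    - e) p_n, and there are two sides. *)
Lemma decays_sum e n p : 0 <= e < 1 -> decays e n p ->
  \sum_(i < size p | i != n :> nat) p`_i <= 2 * e / (1 - e) * p`_n.
Proof.
move=> /andP[e0 e1] [p0 pr pl]; have d0 : 0 < 1 - e by rewrite subr_gt0.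
pose N := maxn (size p) n.
have nN : (n <= N)%N by rewrite leq_maxr.
pose L := \sum_(0 <= i < n) p`_i; pose U := \sum_(n.+1 <= i < N.+1) p`_i.
have LU : \sum_(i < size p | i != n :> nat) p`_i <= L + U.
  rewrite (big_ord_widen_cond N.+1 (fun i => i != n) (fun i => p`_i)); last first.
    by rewrite leqW// leq_maxl.
  apply: (@le_trans _ _ (\sum_(i < N.+1 | i != n :> nat) p`_i)).
    rewrite [leRHS]big_mkcond [leLHS]big_mkcond; apply: ler_sum => i _.
    by case: (_ != n) => //=; case: ifP.
  rewrite -(big_mkord (fun i => i != n) (fun i => p`_i)).
  rewrite (@big_cat_nat _ _ _ n)//=; last by rewrite leqW.
  rewrite (@big_ltn_cond _ _ _ n) ?eqxx/=; last by rewrite ltnS.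
  by apply: lerD; rewrite big_mkcond; apply: ler_sum => i _; case: ifP.
have hL : (1 - e) * L <= e * p`_n.
  have S1 : \sum_(0 <= i < n) p`_i.+1 <= L + p`_n.
    rewrite /L -(@big_nat_recr _ _ _ n 0 (fun i => p`_i))//=.
    by rewrite [leRHS]big_nat_recl// lerDr.
  have S2 : L <= \sum_(0 <= i < n) e * p`_i.+1.
    by rewrite /L !big_mkord; apply: ler_sum => i _; exact: pl.
  have : L <= e * (L + p`_n).
    apply: le_trans S2 _; rewrite -big_distrr/=; exact: ler_wpM2l.
  lra.
have hU : (1 - e) * U <= e * p`_n.
  have S1 : \sum_(n <= i < N) p`_i <= p`_n + U.
    rewrite /U -(@big_ltn _ _ _ n N.+1 (fun i => p`_i)) ?ltnS//.
    by rewrite [leRHS]big_nat_recr//= lerDl.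
  have S2 : U <= \sum_(n <= i < N) e * p`_i.
    by rewrite /U big_add1/=; apply: ler_sum_nat => i /andP[ni _]; exact: pr.
  have : U <= e * (p`_n + U).
    apply: le_trans S2 _; rewrite -big_distrr/=; exact: ler_wpM2l.
  lra.
apply: le_trans LU _; rewrite mulrAC ler_pdivlMr//.
by move: hL hU; move: L U (p`_n) => a b c; lra.
Qed.

Lemma cos_poly_near e n p a t : 0 <= e < 1 -> decays e n p ->
  a + n%:R * t = 0 ->
  `|cos_poly a t p - p`_n| <= 2 * e / (1 - e) * p`_n.
Proof.
move=> e01 dp an; apply: le_trans (decays_sum e01 dp).
have [p0 _ _] := dp.
have -> : cos_poly a t p - p`_n =
    \sum_(i < size p | i != n :> nat) p`_i * cos (a + i%:R * t).
  have [np|np] := ltnP n (size p).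
    rewrite /cos_poly (bigD1 (Ordinal np))//= an cos0 mulr1 addrAC subrr add0r.
    by apply: eq_bigl => i; rewrite -val_eqE.
  rewrite nth_default// subr0 /cos_poly [RHS]big_mkcond; apply: eq_bigr => i _.
  by case: eqP => // ine; move: (ltn_ord i); rewrite ine ltnNge np.
apply: le_trans (ler_norm_sum _ _ _) _; apply: ler_sum => i _.
by rewrite normrM (ger0_norm (p0 i)) ler_piMr// cos_max.
Qed.

(** The Fourier side of Gaussian averaging, where the frequency j = i - n is damped by th ^ (j ^
    2). *)
Definition theta_poly (th : R) n p : {poly R} :=
  \poly_(i < size p) (p`_i * th ^+ (`|i - n|%N ^ 2)).

(** The exponent grows by at least one per step, as (j + 1) ^ 2 >= j ^ 2 + 1, whence one more factor
    th in the ratio. *)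
Lemma decays_theta e th n p : 0 <= e -> 0 <= th <= 1 -> decays e n p ->
  decays (e * th) n (theta_poly th n p).
Proof.
move=> e0 /andP[t0 t1] [p0 pr pl].
have cE i : (theta_poly th n p)`_i = p`_i * th ^+ (`|i - n|%N ^ 2).
  rewrite coef_poly; case: ltnP => // ip; by rewrite nth_default// mul0r.
have thX i j : (i.+1 <= j)%N -> th ^+ j <= th * th ^+ i.
  by move=> ij; rewrite -exprS; apply: ler_wiXn2l.
split=> [i|i ni|i ni]; rewrite !cE.
- by rewrite mulr_ge0 ?exprn_ge0.
- rewrite mulrACA; apply: ler_pM; rewrite ?p0 ?exprn_ge0 ?pr//.
  apply: thX; rewrite (_ : `|i - n|%N = (i - n)%N); last by lia.
  rewrite (_ : `|i.+1 - n|%N = (i - n).+1); last by lia.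
  by rewrite ltn_exp2r.
- rewrite mulrACA; apply: ler_pM; rewrite ?p0 ?exprn_ge0 ?pl//.
  apply: thX; rewrite (_ : `|i - n|%N = (n - i)%N); last by lia.
  rewrite (_ : `|i.+1 - n|%N = (n - i).-1); last by lia.
  rewrite ltn_exp2r//; lia.
Qed.

Lemma trig_polyX k a t p : sin_poly a t p = 0 ->
  cos_poly (k%:R * a) t (p ^+ k) = cos_poly a t p ^+ k /\
  sin_poly (k%:R * a) t (p ^+ k) = 0.
Proof.
move=> s0; elim: k => [|k [hc hs]].
  rewrite !expr0 mul0r (_ : (1 : {poly R}) = 1%:P)//.
  by rewrite cos_polyC sin_polyC cos0 sin0 mulr1 mulr0.
rewrite !exprS mulrSr mulrDl mul1r [_ + a]addrC.
have [-> ->] := trig_polyM a (k%:R * a) t p (p ^+ k).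
by rewrite hc hs s0; split; ring.
Qed.

(** With phase - N t this encodes cos (t / 2) ^ (2 N), since (1 + e^(it)) / 2 = e^(it/2) cos (t /
    2). *)
Definition cos_power (N : nat) : {poly R} := (2^-1 *: (1 + 'X)) ^+ (2 * N).

Lemma coef_cos_power N i : (cos_power N)`_i = 2^-1 ^+ (2 * N) * ('C(2 * N, i))%:R.
Proof.
rewrite /cos_power exprZn coefZ; congr (_ * _).
have -> : (1 + 'X : {poly R}) ^+ (2 * N) =
    \poly_(j < (2 * N).+1) ('C(2 * N, j))%:R.
  rewrite exprDn poly_def; apply: eq_bigr => j _.
  by rewrite expr1n mul1r scaler_nat.
by rewrite coef_poly; case: ltnP => // ij; rewrite bin_small.
Qed.

Lemma decays_cos_power N : decays 1 N (cos_power N).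
Proof.
have half0 : 0 <= 2^-1 ^+ (2 * N) :> R by rewrite exprn_ge0// invr_ge0.
split=> [i|i Ni|i Ni]; rewrite !coef_cos_power ?mul1r.
- by rewrite mulr_ge0.
- apply: ler_wpM2l => //; rewrite ler_nat -(leq_pmul2l (ltn0Sn i)).
  have -> : (i.+1 * 'C(2 * N, i.+1) = (2 * N - i) * 'C(2 * N, i))%N.
    by rewrite mul_bin_left.
  by apply: leq_mul => //; lia.
- apply: ler_wpM2l => //; rewrite ler_nat -(leq_pmul2l (ltn0Sn i)).
  have -> : (i.+1 * 'C(2 * N, i.+1) = (2 * N - i) * 'C(2 * N, i))%N.
    by rewrite mul_bin_left.
  by apply: leq_mul => //; lia.
Qed.

Lemma trig_cos_power N t :
  cos_poly (- (N%:R * t)) t (cos_power N) = cos (t / 2) ^+ (2 * N) /\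
  sin_poly (- (N%:R * t)) t (cos_power N) = 0.
Proof.
have t2 : - (t / 2) + t = t / 2 by lra.
have hc : cos_poly (- (t / 2)) t (2^-1 *: (1 + 'X)) = cos (t / 2).
  rewrite cos_polyZ cos_polyD -['X]mul1r cos_polyMX -polyC1 !cos_polyC t2 cosN.
  lra.
have hs : sin_poly (- (t / 2)) t (2^-1 *: (1 + 'X)) = 0.
  rewrite sin_polyZ sin_polyD -['X]mul1r sin_polyMX -polyC1 !sin_polyC t2 sinN.
  lra.
have -> : - (N%:R * t) = (2 * N)%:R * - (t / 2) by rewrite natrM; lra.
by have [-> ->] := trig_polyX (2 * N) hs; rewrite hc.
Qed.

(* Even real trigonometric polynomials of period 1, with nonnegative Fourier
   coefficients that decay geometrically; n is the index of the frequency 0. *)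
Definition decaying_trig e (T : R -> R) := exists n p, decays e n p /\
  forall z, cos_poly (- (n%:R * (2 * pi * z))) (2 * pi * z) p = T z /\
            sin_poly (- (n%:R * (2 * pi * z))) (2 * pi * z) p = 0.

Lemma decaying_trigX e k T : 0 <= e -> decaying_trig e T ->
  decaying_trig (k%:R * e) (fun z => T z ^+ k).
Proof.
move=> e0 [n [p [dp hT]]]; exists (k * n)%N, (p ^+ k); split; first exact: decaysX.
move=> z; have [hc hs] := hT z; rewrite natrM -mulrA -mulrN.
by have [-> ->] := trig_polyX k hs; rewrite hc.
Qed.

Lemma decaying_trigZ e c T : 0 <= c -> decaying_trig e T ->
  decaying_trig e (fun z => c * T z).
Proof.
move=> c0 [n [p [[p0 pr pl] hT]]]; exists n, (c *: p); split.
  split=> [i|i ni|i ni]; rewrite !coefZ ?mulr_ge0// mulrCA ler_wpM2l//.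
    exact: pr.
  exact: pl.
by move=> z; rewrite cos_polyZ sin_polyZ; have [-> ->] := hT z; rewrite mulr0.
Qed.

Lemma decaying_trig_cos N : decaying_trig 1 (fun z => cos (pi * z) ^+ (2 * N)).
Proof.
exists N, (cos_power N); split; first exact: decays_cos_power.
move=> z; have [-> ->] := trig_cos_power N (2 * pi * z).
by rewrite (_ : 2 * pi * z / 2 = pi * z)//; lra.
Qed.

Lemma decaying_trig_near e T : 0 <= e < 1 -> decaying_trig e T ->
  exists2 c, 0 <= c & forall z, `|T z - c| <= 2 * e / (1 - e) * c.
Proof.
move=> e01 [n [p [dp hT]]]; exists p`_n; first by have [] := dp.
move=> z; have [<- _] := hT z; apply: cos_poly_near => //; lra.
Qed.

End trigonometric_polynomials.

Section gaussian_average.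
Context {R : realType} (beta : R).
Hypothesis beta_gt0 : 0 < beta.
Notation M := (@lebesgue_measure R).
Notation g := (gauss_dens beta).

Definition gauss_avg (f : R -> R) (z : R) : R := \int[M]_x (f (z + x) * g x).

(** This is [gauss_char beta] at 2 pi, the damping of the first harmonic. *)
Definition heat_factor : R := expR (- (2 * pi ^+ 2 / beta)).

Lemma Rintegral_sum m (F : nat -> R -> R) :
  (forall i, M.-integrable setT (EFin \o F i)) ->
  M.-integrable setT (EFin \o (fun x => \sum_(i < m) F i x)) /\
  \int[M]_x (\sum_(i < m) F i x) = \sum_(i < m) \int[M]_x F i x.
Proof.
move=> iF; elim: m => [|m [im IH]].
  rewrite big_ord0; split.
    apply: (eq_integrable measurableT (cst 0%E)) => [x _|].
      by rewrite /= big_ord0.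
    exact: integrable0.
  by rewrite /Rintegral; under eq_integral do rewrite big_ord0; rewrite integral0.
have e : (fun x => \sum_(i < m.+1) F i x) = (fun x => \sum_(i < m) F i x + F m x).
  by apply/funext => x; rewrite big_ord_recr.
rewrite e; split.
  have := integrableD measurableT im (iF m).
  by apply: eq_integrable => // x _; rewrite /= EFinD.
by rewrite RintegralD// big_ord_recr/= IH.
Qed.

Lemma gauss_avg_cos (c z : R) :
  \int[M]_x (cos (c * (z + x)) * g x) = cos (c * z) * gauss_char beta c.
Proof.
have ic := integrable_cos_dens beta_gt0 c.
have is_ := integrable_sin_dens beta_gt0 c.
transitivity (\int[M]_x (cos (c * z) * (cos (c * x) * g x) -
    sin (c * z) * (sin (c * x) * g x))).
  apply: eq_Rintegral => x _.
  by rewrite [c * (z + x)]mulrDr cosD mulrBl !mulrA.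
rewrite RintegralB//; last 2 first.
- have := integrableZl measurableT (cos (c * z)) ic.
  by apply: eq_integrable => // x _.
- have := integrableZl measurableT (sin (c * z)) is_.
  by apply: eq_integrable => // x _.
by rewrite !RintegralZl// gauss_char_sin// mulr0 subr0.
Qed.

Lemma gauss_avg_sin (c z : R) :
  \int[M]_x (sin (c * (z + x)) * g x) = sin (c * z) * gauss_char beta c.
Proof.
have ic := integrable_cos_dens beta_gt0 c.
have is_ := integrable_sin_dens beta_gt0 c.
transitivity (\int[M]_x (sin (c * z) * (cos (c * x) * g x) +
    cos (c * z) * (sin (c * x) * g x))).
  apply: eq_Rintegral => x _.
  by rewrite [c * (z + x)]mulrDr sinD mulrDl !mulrA.
rewrite RintegralD//; last 2 first.
- have := integrableZl measurableT (sin (c * z)) ic.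
  by apply: eq_integrable => // x _.
- have := integrableZl measurableT (cos (c * z)) is_.
  by apply: eq_integrable => // x _.
by rewrite !RintegralZl// gauss_char_sin// mulr0 addr0.
Qed.

Let freq (n i : nat) : R := (i%:R - n%:R) * (2 * pi).

Let freqE (n i : nat) (z : R) :
  - (n%:R * (2 * pi * z)) + i%:R * (2 * pi * z) = freq n i * z.
Proof. by rewrite /freq; ring. Qed.

Let char_freq (n i : nat) :
  gauss_char beta (freq n i) = heat_factor ^+ (`|i - n|%N ^ 2).
Proof.
rewrite gauss_charE// /heat_factor -expRM_natl; congr expR.
have -> : (`|i - n|%N ^ 2)%:R = (i%:R - n%:R) ^+ 2 :> R.
  rewrite natrX; have [ni|ni] := leqP n i.
    by rewrite (_ : `|i - n|%N = (i - n)%N) ?natrB//; lia.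
  rewrite (_ : `|i - n|%N = (n - i)%N) ?natrB ?(ltnW ni)//; last by lia.
  by rewrite -sqrrN opprB.
by rewrite /freq; field; rewrite gt_eqF.
Qed.

Let integrable_freq (F : R -> R) (c z k : R) : measurable_fun setT F ->
  (forall x, `|F x| <= 1) ->
  M.-integrable setT (EFin \o (fun x => k * (F (c * (z + x)) * g x))).
Proof.
move=> mF F1; apply: (@integrable_gauss_dominated _ beta `|k|) => //.
  apply: measurable_funM => //; apply: measurable_funM.
    apply: (measurableT_comp mF); apply: measurable_funM => //.
    exact: measurable_funD.
  exact: measurable_normal_pdf.
move=> x; rewrite normrM; apply: ler_wpM2l => //.
rewrite normrM (ger0_norm (gauss_dens_ge0 beta_gt0 _)).
by apply: ler_piMl => //; exact: gauss_dens_ge0.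
Qed.

(** Averaging multiplies each harmonic by the characteristic function at its frequency and keeps its
    phase, as the sine integrals vanish. *)
Lemma decaying_trig_avg e T : 0 <= e -> decaying_trig e T ->
  decaying_trig (e * heat_factor) (gauss_avg T).
Proof.
move=> e0 [n [p [dp hT]]]; exists n, (theta_poly heat_factor n p).
have h01 : 0 <= heat_factor <= 1.
  rewrite expR_ge0 -expR0 ler_expR oppr_le0.
  by rewrite divr_ge0 ?(ltW beta_gt0)// mulr_ge0// sqr_ge0.
split; first exact: decays_theta.
have mcos : measurable_fun setT (@cos R).
  by apply: continuous_measurable_fun; exact: continuous_cos.
have msin : measurable_fun setT (@sin R).
  by apply: continuous_measurable_fun; exact: continuous_sin.
have sp : (size (theta_poly heat_factor n p) <= size p)%N by exact: size_poly.
move=> z; rewrite (cos_poly_wide _ _ sp) (sin_poly_wide _ _ sp); split.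
- rewrite /gauss_avg.
  transitivity (\int[M]_x (\sum_(i < size p) p`_i *
      (cos (freq n i * (z + x)) * g x))); last first.
    apply: eq_Rintegral => x _; have [<- _] := hT (z + x).
    by rewrite /cos_poly big_distrl/=; apply: eq_bigr => i _; rewrite freqE mulrA.
  have [_ ->] := @Rintegral_sum (size p) (fun i x => p`_i *
    (cos (freq n i * (z + x)) * g x)) (fun i =>
    integrable_freq (freq n i) z p`_i mcos (@cos_max R)).
  apply: eq_bigr => i _; rewrite coef_poly ltn_ord freqE.
  have /= iq := integrable_freq (freq n i) z 1 mcos (@cos_max R).
  rewrite RintegralZl//; last by apply: eq_integrable iq => // x _; rewrite /= mul1r.
  by rewrite gauss_avg_cos char_freq; ring.
- transitivity (\int[M]_x (\sum_(i < size p) p`_i *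
      (sin (freq n i * (z + x)) * g x))); last first.
    transitivity (\int[M]_x (0 : R)); last by rewrite Rintegral_cst// mul0r.
    apply: eq_Rintegral => x _; have [_ /(congr1 (fun t => t * g x))] := hT (z + x).
    rewrite mul0r /sin_poly big_distrl/= => s0; rewrite -[RHS]s0.
    by apply: eq_bigr => i _; rewrite freqE mulrA.
  have [_ ->] := @Rintegral_sum (size p) (fun i x => p`_i *
    (sin (freq n i * (z + x)) * g x)) (fun i =>
    integrable_freq (freq n i) z p`_i msin (@sin_max R)).
  apply: eq_bigr => i _; rewrite coef_poly ltn_ord freqE.
  have /= iq := integrable_freq (freq n i) z 1 msin (@sin_max R).
  rewrite RintegralZl//; last by apply: eq_integrable iq => // x _; rewrite /= mul1r.
  by rewrite gauss_avg_sin char_freq; ring.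
Qed.

End gaussian_average.

(** * Uniform approximation of the lattice theta function *)

Section theta_regularity.
Context {R : realType} (beta : R).
Hypothesis beta_gt0 : 0 < beta.
Notation M := (@lebesgue_measure R).
Notation g := (gauss_dens beta).
Notation Theta := (lattice_theta beta).

Let b4 : 0 < beta / 4. Proof. by rewrite divr_gt0. Qed.

(** The tangent inequality for exp bounds the increase by the decrease of the exponent times the
    shifted weight. The linear growth of that decrease is absorbed by a wider Gaussian, whose sum
    over the integers is finite. *)
Let gweight_shift : exists2 L : R, 0 <= L & forall y h : R, `|h| <= 1 ->
  gweight beta (y + h) <= gweight beta y + `|h| * L * gweight (beta / 4) y.
Proof.
have [D D0 widen] := gauss_dens_widen beta_gt0 1.
have p0 := gauss_peak_gt0 beta_gt0; have p4 := gauss_peak_gt0 b4.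
exists (beta * (D / gauss_peak beta * gauss_peak (beta / 4))).
  by rewrite mulr_ge0 ?(ltW beta_gt0)// mulr_ge0 ?divr_ge0// ltW.
move=> y h h1.
pose a := beta / 2 * (y + h) ^+ 2; pose b := beta / 2 * y ^+ 2.
have e1 : gweight beta (y + h) <= gweight beta y + (b - a) * gweight beta (y + h).
  rewrite /gweight -/a -/b.
  have : expR (- a) * (1 + (a - b)) <= expR (- a) * expR (a - b).
    by apply: ler_wpM2l; [exact: expR_ge0|exact: expR_ge1Dx].
  by rewrite -expRD (_ : - a + (a - b) = - b); [lra|ring].
have e2 : b - a <= beta * `|h| * (1 + `|y + h|).
  have h2 : y ^+ 2 - (y + h) ^+ 2 = - h * (2 * (y + h) - h) by ring.
  have h3 : - h * (2 * (y + h) - h) <= `|h| * (2 * (1 + `|y + h|)).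
    apply: le_trans (ler_norm _) _; rewrite normrM normrN; apply: ler_wpM2l => //.
    apply: le_trans (ler_normB _ _) _; rewrite normrM ger0_norm//.
    by move: (`|y + h|) (normr_ge0 (y + h)) h1 => u u0 h1; lra.
  have := ler_wpM2l (ltW beta_gt0) h3; rewrite -h2 /a /b.
  by move: (`|y + h|) (y ^+ 2) ((y + h) ^+ 2) (`|h|) => u v w x; lra.
apply: le_trans e1 _; rewrite lerD2l.
apply: (@le_trans _ _ (beta * `|h| * ((1 + `|y + h|) * gweight beta (y + h)))).
  by rewrite mulrA ler_wpM2r// gweight_ge0.
have := widen y h h1; rewrite !gauss_densE// -/(gweight beta _) -/(gweight (beta / 4) _) => w.
have w' : (1 + `|y + h|) * gweight beta (y + h) <=
    D / gauss_peak beta * gauss_peak (beta / 4) * gweight (beta / 4) y.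
  rewrite -(ler_pM2l p0); apply: le_trans (_ : _ <= D * (gauss_peak (beta / 4) * gweight (beta / 4) y)) _.
    by rewrite mulrCA.
  rewrite le_eqVlt; apply/orP; left; apply/eqP; field; rewrite gt_eqF//.
have := ler_wpM2l (mulr_ge0 (ltW beta_gt0) (normr_ge0 h)) w'.
move/le_trans; apply; rewrite le_eqVlt; apply/orP; left; apply/eqP; ring.
Qed.

Lemma lattice_theta_lipschitz : exists2 L : R, 0 <= L & forall x y : R, `|x - y| <= 1 ->
  `|Theta x - Theta y| <= L * `|x - y|.
Proof.
have [L L0 h] := gweight_shift.
pose U := 2 * (expR (2 * (beta / 4)) / gauss_peak (beta / 4)).
have U0 : 0 <= U.
  by rewrite mulr_ge0// divr_ge0 ?expR_ge0// ltW// gauss_peak_gt0.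
exists (L * U); first by rewrite mulr_ge0.
suff main x y : `|x - y| <= 1 -> Theta x <= Theta y + L * U * `|x - y|.
  move=> x y xy; rewrite ler_distlC; apply/andP; split.
    by rewrite lerBlDr main// distrC.
  by have := main y x; rewrite distrC => /(_ xy).
move=> xy; rewrite -lee_fin EFinD !lattice_thetaE//.
apply: (@le_trans _ _ (\esum_(j in [set: int]) ((gweight beta (j%:~R - y))%:E +
    (`|x - y| * L * gweight (beta / 4) (j%:~R - y))%:E))%E).
  apply: le_esum => j _; rewrite indicT mulr1 -EFinD lee_fin.
  have := h (j%:~R - y) (y - x); rewrite distrC => /(_ xy).
  by rewrite addrA subrK.
rewrite esumD; last 2 first.
- by move=> j _; rewrite lee_fin gweight_ge0.
- by move=> j _; rewrite lee_fin !mulr_ge0// gweight_ge0.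
apply: leeD; first by apply: le_esum => j _; rewrite indicT mulr1.
rewrite esum_int; last by move=> j; rewrite lee_fin !mulr_ge0// gweight_ge0.
under eq_eseriesr do rewrite EFinM.
rewrite nneseriesZl; last by move=> j _; rewrite lee_fin gweight_ge0.
rewrite -(@esum_int _ (fun j => (gweight (beta / 4) (j%:~R - y))%:E)); last first.
  by move=> j; rewrite lee_fin gweight_ge0.
have := lattice_mass_le_ub b4 y setT; rewrite lattice_massE -/U => hU.
have xL : (0 <= (`|x - y| * L)%:E)%E by rewrite lee_fin mulr_ge0.
apply: le_trans (lee_wpmul2l xL hU) _.
by rewrite -EFinM lee_fin le_eqVlt; apply/orP; left; apply/eqP; ring.
Qed.

End theta_regularity.

Section cosine_kernel.
Context {R : realType}.
Notation M := (@lebesgue_measure R).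
Let cell : set R := `[(- 2^-1), (- 2^-1 + 1)[%classic.

(** Nonnegative, of period one and, when normalized, an approximation of the Dirac comb on the
    integers. *)
Definition cos_kernel (N : nat) (x : R) : R := cos (pi * x) ^+ (2 * N).

Lemma cos_kernel_ge0 N x : 0 <= cos_kernel N x.
Proof. by rewrite /cos_kernel exprM exprn_ge0// sqr_ge0. Qed.

Lemma cos_kernel_le1 N x : cos_kernel N x <= 1.
Proof.
by rewrite /cos_kernel exprM exprn_ile1 ?sqr_ge0// cos2_le1.
Qed.

Lemma cos_kernelDint N (x : R) (j : int) : cos_kernel N (x + j%:~R) = cos_kernel N x.
Proof.
rewrite /cos_kernel !exprM; congr (_ ^+ N).
have hn n (y : R) : cos (pi * (y + n%:R)) ^+ 2 = cos (pi * y) ^+ 2.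
  elim: n y => [|n IH] y; first by rewrite addr0.
  by rewrite mulrSr addrA mulrDr mulr1 cosDpi sqrrN IH.
case: j => n; first exact: hn.
by rewrite NegzE mulrNz -(hn n.+1 (x - n.+1%:R)) subrK.
Qed.

Lemma measurable_cos_kernel N : measurable_fun setT (cos_kernel N).
Proof.
apply: measurable_funX; apply: (measurableT_comp (f := @cos R)).
  by apply: continuous_measurable_fun; exact: continuous_cos.
exact: measurable_funM.
Qed.

Lemma measurable_cos_kernelE N (D : set (measurableTypeR R)) :
  measurable_fun D (EFin \o cos_kernel N).
Proof.
apply: measurable_funTS; apply/measurable_EFinP; exact: measurable_cos_kernel.
Qed.

Lemma cos_kernel_anti N (x y : R) : `|x| <= `|y| -> `|y| <= 2^-1 ->
  cos_kernel N y <= cos_kernel N x.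
Proof.
move=> xy y2; have pi0 := pi_gt0 R.
have cabs (u : R) : cos (pi * u) = cos (pi * `|u|).
  by have [//|u0] := ger0P u; rewrite mulrN cosN.
rewrite /cos_kernel cabs [cos (pi * x)]cabs.
have y2' : pi * `|y| <= pi / 2 by rewrite ler_pM2l.
have cy0 : 0 <= cos (pi * `|y|).
  apply: cos_ge0_pihalf; rewrite y2' andbT.
  by apply: (@le_trans _ _ 0); rewrite ?oppr_le0 ?mulr_ge0 ?divr_ge0// ltW.
have cc : cos (pi * `|y|) <= cos (pi * `|x|).
  rewrite leNgt; apply/negP; rewrite ltr_cos.
  - by rewrite ltNge ler_pM2l// xy.
  - rewrite in_itv/= mulr_ge0 ?(ltW pi0)//=; lra.
  - rewrite in_itv/= mulr_ge0 ?(ltW pi0)//=.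
    by apply: (@le_trans _ _ (pi * `|y|)); [rewrite ler_pM2l|lra].
by rewrite lerXn2r ?nnegrE//; exact: le_trans cc.
Qed.

Lemma measure_cell : M cell = 1%E.
Proof. by rewrite lebesgue_measure_itv/= lte_fin ltrDl ltr01 -EFinD addrAC subrr add0r. Qed.

Lemma cell_norm (x : R) : cell x -> `|x| <= 2^-1.
Proof. by rewrite /cell/= in_itv/= ler_norml => /andP[]; lra. Qed.

Lemma integrable_cell (f : R -> R) (K : R) : measurable_fun setT f ->
  (forall x, cell x -> `|f x| <= K) -> M.-integrable cell (EFin \o f).
Proof.
move=> mf fK; apply: (@measurable_bounded_integrable _ _ _ M) => //.
- exact: measurable_itv.
- exact: (eq_ind_r (fun t => (t < +oo)%E) (ltry 1) measure_cell).
- exact: measurable_funTS.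
- by exists K; split; rewrite ?num_real// => x Kx y cy; apply: le_trans (fK y cy) (ltW Kx).
Qed.

Lemma measurable_cell : measurable (cell : set (measurableTypeR R)).
Proof. exact: measurable_itv. Qed.

Lemma integrable_cell_cst (k : R) : M.-integrable cell (EFin \o cst k).
Proof. by apply: (@integrable_cell _ `|k|). Qed.

Definition cos_mass N : R := \int[M]_(x in cell) cos_kernel N x.

Lemma integrable_cos_kernel N : M.-integrable cell (EFin \o cos_kernel N).
Proof.
apply: (@integrable_cell _ 1); first exact: measurable_cos_kernel.
by move=> x _; rewrite ger0_norm ?cos_kernel_ge0// cos_kernel_le1.
Qed.

Lemma integrable_cos_kernelM N (f : R -> R) (K : R) : measurable_fun setT f ->
  (forall x, cell x -> `|f x| <= K) ->
  M.-integrable cell (EFin \o (fun x => cos_kernel N x * f x)).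
Proof.
move=> mf fK; apply: (@integrable_cell _ K).
  by apply: measurable_funM => //; exact: measurable_cos_kernel.
move=> x cx; rewrite normrM (ger0_norm (cos_kernel_ge0 _ _)).
apply: le_trans (fK x cx); apply: ler_piMl => //; exact: cos_kernel_le1.
Qed.

Lemma cos_mass_ge N (d : R) : 0 < d <= 2^-1 ->
  d / 2 * cos_kernel N (d / 2) <= cos_mass N.
Proof.
move=> /andP[d0 d2]; rewrite -lee_fin /cos_mass /Rintegral fineK; last first.
  exact: (integrable_fin_num measurable_cell (integrable_cos_kernel N)).
pose J : set R := `[0%R, (d / 2)[%classic.
have JI : J `<=` cell.
  by move=> x; rewrite /J /cell/= !in_itv/= => /andP[x0 xd]; apply/andP; split; lra.
apply: (@le_trans _ _ (\int[M]_(x in J) (cos_kernel N x)%:E)%E); last first.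
  apply: ge0_subset_integral => //.
  - exact: measurable_itv.
  - exact: measurable_cell.
  - exact: measurable_cos_kernelE.
  - by move=> x _; rewrite lee_fin cos_kernel_ge0.
apply: (@le_trans _ _ (\int[M]_(x in J) (cst (cos_kernel N (d / 2))%:E x))%E).
  have mJ : measurable (J : set (measurableTypeR R)) by exact: measurable_itv.
  have MJ : M J = (d / 2)%:E.
    by rewrite lebesgue_measure_itv/= lte_fin divr_gt0// -EFinD subr0.
  rewrite (integral_cst M mJ) [d / 2 * _]mulrC EFinM.
  by apply: lee_wpmul2l; [rewrite lee_fin cos_kernel_ge0|rewrite le_eqVlt; apply/orP; left; apply/eqP; exact/esym/MJ].
apply: ge0_le_integral => //.
- exact: measurable_itv.
- by move=> x _; rewrite lee_fin cos_kernel_ge0.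
- exact: measurable_cos_kernelE.
- move=> x; rewrite /J/= in_itv/= => /andP[x0 xd]; rewrite lee_fin.
  by apply: cos_kernel_anti; rewrite !ger0_norm//; lra.
Qed.

(** For |x| > d the kernel is at most a ^ N with a = cos (pi d) ^ 2, while its mass is at least d /
    2 times c ^ N with c = cos (pi d / 2) ^ 2 > a; the quotient tends to zero. *)
Lemma cos_kernel_concentrates (eps : R) : 0 < eps -> exists N, 0 < cos_mass N /\
  \int[M]_(x in cell) (cos_kernel N x * `|x|) <= eps * cos_mass N.
Proof.
(* The part |x| <= d of the integral costs at most d times the mass, half of the allowance; the rest
   of the cell gets the other half. *)
move=> eps0; pose d := Num.min (eps / 2) (2^-1).
have d0 : 0 < d by rewrite lt_min divr_gt0//=.
have d2 : d <= 2^-1 by rewrite ge_min lexx orbT.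
have de : d <= eps / 2 by rewrite ge_min lexx.
pose a := cos (pi * d) ^+ 2; pose c := cos (pi * (d / 2)) ^+ 2.
have pi0 := pi_gt0 R.
have c0 : 0 < c.
  rewrite exprn_gt0// cos_gt0_pihalf//; apply/andP; split.
    by apply: (@lt_trans _ _ 0); rewrite ?oppr_lt0 ?mulr_gt0 ?divr_gt0.
  by rewrite ltr_pM2l//; lra.
have cd0 : 0 <= cos (pi * d).
  rewrite cos_ge0_pihalf//; apply/andP; split.
    by apply: (@le_trans _ _ 0); rewrite ?oppr_le0 ?mulr_ge0 ?divr_ge0// ltW.
  by rewrite ler_pM2l.
have cdd : cos (pi * d) < cos (pi * (d / 2)).
  have hin (u : R) : 0 <= u <= 2^-1 -> pi * u \in `[0, pi]%R.
    move=> /andP[u0 u1]; rewrite in_itv/= mulr_ge0 ?(ltW pi0)//=.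
    by rewrite -[leRHS]mulr1 ler_pM2l//; lra.
  by rewrite ltr_cos ?hin ?ltr_pM2l//; try (apply/andP; split); lra.
have ac : a < c by rewrite /a /c !expr2 ltr_pM.
have a0 : 0 <= a by exact: sqr_ge0.
have q1 : `|a / c| < 1 by rewrite ger0_norm ?divr_ge0 ?(ltW c0)// ltr_pdivrMr ?mul1r.
have eta0 : 0 < eps / 2 * (d / 2) by rewrite mulr_gt0 ?divr_gt0.
have [N qN] : exists N, (a / c) ^+ N <= eps / 2 * (d / 2).
  have /cvgr0_norm_le/(_ _ eta0)[N _ hN] := cvg_expr q1.
  by exists N; apply: le_trans (ler_norm _) (hN N _); rewrite /=.
have cN : d / 2 * c ^+ N <= cos_mass N.
  rewrite -exprM; apply: cos_mass_ge; exact/andP.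
have dc0 : 0 < d / 2 * c ^+ N.
  by apply: mulr_gt0; [exact: divr_gt0|exact: exprn_gt0].
exists N; split; first exact: lt_le_trans cN.
have aN : a ^+ N <= eps / 2 * cos_mass N.
  move: qN; rewrite expr_div_n (ler_pdivrMr _ _ (exprn_gt0 N c0)) => /le_trans; apply.
  by rewrite -[leLHS]mulrA; apply: ler_wpM2l => //; apply: ltW; exact: divr_gt0.
apply: (@le_trans _ _ (\int[M]_(x in cell) (d * cos_kernel N x + a ^+ N))).
  apply: le_Rintegral; first exact: measurable_cell.
  - apply: (@integrable_cos_kernelM N (fun x => `|x|) (2^-1)) => //.
    by move=> x /cell_norm; rewrite normr_id.
  - apply: (@integrable_cell _ (d + a ^+ N)).
      apply: measurable_funD => //; apply: measurable_funM => //.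
      exact: measurable_cos_kernel.
    move=> x _; have dk : 0 <= d * cos_kernel N x.
      by rewrite mulr_ge0 ?cos_kernel_ge0// ltW.
    rewrite ger0_norm ?addr_ge0 ?exprn_ge0// lerD2r.
    by rewrite ler_piMr ?cos_kernel_le1// ltW.
  - move=> x xc; have [xd|xd] := leP `|x| d.
      rewrite [d * _]mulrC; apply: (@le_trans _ _ (cos_kernel N x * d)).
        by apply: ler_wpM2l => //; exact: cos_kernel_ge0.
      by rewrite lerDl exprn_ge0.
    apply: (@le_trans _ _ (a ^+ N)); last first.
      by rewrite lerDr mulr_ge0 ?cos_kernel_ge0// ltW.
    apply: (@le_trans _ _ (cos_kernel N x)).
      rewrite ler_piMr ?cos_kernel_ge0//; have := cell_norm xc; lra.
    have -> : a ^+ N = cos_kernel N d by rewrite /a -exprM.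
    by apply: cos_kernel_anti; rewrite ?cell_norm// ger0_norm ?ltW.
have id : M.-integrable cell (EFin \o (fun x => d * cos_kernel N x)).
  have := integrableZl measurable_cell d (integrable_cos_kernel N).
  by apply: eq_integrable => //; exact: measurable_cell.
rewrite (RintegralD measurable_cell id (integrable_cell_cst _)).
rewrite (RintegralZl _ measurable_cell (integrable_cos_kernel N)) -/(cos_mass N).
rewrite Rintegral_cst; last exact: measurable_cell.
have -> : fine (M cell) = 1 by rewrite [M cell]measure_cell.
rewrite mulr1; apply: le_trans (lerD (lexx _) aN) _.
rewrite -mulrDl ler_wpM2r//; last lra.
exact: ltW (lt_le_trans dc0 cN).
Qed.

End cosine_kernel.

Section theta_approximation.
Context {R : realType} (beta : R).
Hypothesis beta_gt0 : 0 < beta.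
Notation M := (@lebesgue_measure R).
Notation g := (gauss_dens beta).
Notation Theta := (lattice_theta beta).
Notation cell := (`[(- 2^-1)%R, (- 2^-1 + 1)%R[%classic : set R).

Lemma measurable_lattice_theta : measurable_fun setT Theta.
Proof.
apply: (measurableT_comp (f := @fine R)) => //.
exact: measurable_lattice_mass.
Qed.

Lemma lattice_theta_norm x :
  `|Theta x| <= 2 * (expR (2 * beta) / gauss_peak beta).
Proof. by rewrite ger0_norm ?lattice_theta_ub// ltW// lattice_theta_gt0. Qed.

(* Unfolding the integral over the periods of the kernel. *)
Lemma gauss_avg_cos_kernel N z : gauss_avg beta (cos_kernel N) z =
  gauss_peak beta * \int[M]_(x in cell) (cos_kernel N x * Theta (z - x)).
Proof.
have p0 := gauss_peak_gt0 beta_gt0.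
have mT : measurable_fun setT (fun x : R => Theta (z - x)).
  apply: (measurableT_comp measurable_lattice_theta); exact: measurable_funB.
have bT x : cell x -> `|Theta (z - x)| <= 2 * (expR (2 * beta) / gauss_peak beta).
  by move=> _; exact: lattice_theta_norm.
rewrite -RintegralZl; [|exact: measurable_itv|exact: integrable_cos_kernelM mT bT].
rewrite /gauss_avg /Rintegral; congr fine.
pose f (x : R) : \bar R := (cos_kernel N x * g (x - z))%:E.
have mf : measurable_fun setT f.
  apply/measurable_EFinP; apply: measurable_funM; first exact: measurable_cos_kernel.
  by apply: (measurableT_comp (f := g)); [exact: measurable_normal_pdf|exact: measurable_funB].
have f0 x : (0 <= f x)%E by rewrite lee_fin mulr_ge0 ?cos_kernel_ge0 ?gauss_dens_ge0.
transitivity (\int[M]_x f x)%E.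
  rewrite -(ge0_integral_shiftT z mf f0); apply: eq_integral => x _.
  by rewrite /f addrK addrC.
rewrite (integral_unfold (- 2^-1) 0 mf f0); apply: eq_integral => x _.
transitivity (\esum_(j in [set: int]) ((cos_kernel N x * gauss_peak beta)%:E *
    (gweight beta (j%:~R - (z - x)))%:E))%E.
  apply: eq_esum => j _; rewrite /f addr0 cos_kernelDint gauss_densE// -EFinM.
  rewrite -/(gweight beta _) -mulrA; congr (_ * (_ * gweight beta _))%:E; ring.
have k0 : 0 <= cos_kernel N x * gauss_peak beta.
  by rewrite mulr_ge0 ?cos_kernel_ge0// ltW.
rewrite esum_int; last by move=> j; rewrite mule_ge0 ?lee_fin ?gweight_ge0.
rewrite nneseriesZl; last by move=> j _; rewrite lee_fin gweight_ge0.
rewrite -(@esum_int _ (fun j => (gweight beta (j%:~R - (z - x)))%:E)); last first.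
  by move=> j; rewrite lee_fin gweight_ge0.
rewrite mulrCA mulrA [in RHS]EFinM lattice_thetaE// lattice_massE; congr (_ * _)%E.
Qed.

(** Up to normalization, averaging the kernel gives the mean of [Theta (z - x)] for a probability
    density concentrated near x = 0, so the Lipschitz bound controls the error. *)
Lemma lattice_theta_approx (eps : R) : 0 < eps ->
  exists T, decaying_trig (heat_factor beta) T /\
    forall z, `|Theta z - T z| <= eps.
Proof.
move=> eps0; have [L L0 lip] := lattice_theta_lipschitz beta_gt0.
(* Dividing by L + 1 instead of L covers L = 0. *)
have L1 : 0 < L + 1 by lra.
have [N [m0 conc]] := cos_kernel_concentrates (divr_gt0 eps0 L1).
have p0 := gauss_peak_gt0 beta_gt0.
pose k := (gauss_peak beta * cos_mass N)^-1.
have k0 : 0 <= k by rewrite invr_ge0 mulr_ge0// ltW.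
exists (fun z => k * gauss_avg beta (cos_kernel N) z); split.
  apply: decaying_trigZ => //; rewrite -[heat_factor beta]mul1r.
  by apply: decaying_trig_avg => //; exact: decaying_trig_cos.
move=> z; rewrite gauss_avg_cos_kernel /k invfM.
have mcell : measurable (cell : set (measurableTypeR R)) by exact: measurable_itv.
have mT : measurable_fun setT (fun x : R => Theta (z - x)).
  apply: (measurableT_comp measurable_lattice_theta); exact: measurable_funB.
have bT x : cell x -> `|Theta (z - x)| <= 2 * (expR (2 * beta) / gauss_peak beta).
  by move=> _; exact: lattice_theta_norm.
have i1 := integrable_cos_kernelM N mT bT.
have i2 : M.-integrable cell (EFin \o (fun x => cos_kernel N x * Theta z)).
  apply: (@integrable_cos_kernelM _ N (cst (Theta z)) `|Theta z|) => //.
set I := \int[M]_(x in cell) (cos_kernel N x * Theta (z - x)).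
have -> : Theta z - (gauss_peak beta)^-1 * (cos_mass N)^-1 * (gauss_peak beta * I) =
    (Theta z * cos_mass N - I) / cos_mass N.
  by field; rewrite !gt_eqF.
rewrite normrM normfV (gtr0_norm m0) ler_pdivrMr//.
have -> : Theta z * cos_mass N - I =
    \int[M]_(x in cell) (cos_kernel N x * Theta z - cos_kernel N x * Theta (z - x)).
  rewrite RintegralB// RintegralZr//; last exact: integrable_cos_kernel.
  by rewrite mulrC.
apply: le_trans (le_normr_Rintegral _ _) _ => //.
  by have := integrableB mcell i2 i1; apply: eq_integrable.
have i3 : M.-integrable cell (EFin \o (fun x => cos_kernel N x * `|x|)).
  apply: (@integrable_cos_kernelM _ N (fun x => `|x|) (2^-1)) => //.
  by move=> x /cell_norm; rewrite normr_id.
apply: (@le_trans _ _ (\int[M]_(x in cell) (L * (cos_kernel N x * `|x|)))).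
  apply: le_Rintegral => //.
  - by have := integrable_norm (integrableB mcell i2 i1); apply: eq_integrable.
  - by have := integrableZl mcell L i3; apply: eq_integrable.
  - move=> x cx; rewrite -mulrBr normrM (ger0_norm (cos_kernel_ge0 _ _)) mulrCA.
    apply: ler_wpM2l; first exact: cos_kernel_ge0.
    have e : z - (z - x) = x by ring.
    have := lip z (z - x); rewrite e; apply.
    by have := cell_norm cx; lra.
rewrite RintegralZl//.
apply: le_trans (ler_wpM2l L0 conc) _.
rewrite mulrA; apply: ler_wpM2r; first exact: ltW.
by rewrite mulrCA ler_piMr ?(ltW eps0)// ler_pdivrMr// mul1r; lra.
Qed.

End theta_approximation.

(** * Gaussian averages of bounded functions *)

Section integral_of_density.
Context d (T : measurableType d) (R : realType).
Variables (mu nu : {measure set T -> \bar R}) (w : T -> R).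
Hypothesis mw : measurable_fun setT w.
Hypothesis w0 : forall x, 0 <= w x.
Hypothesis nuE : forall A, measurable A -> nu A = (\int[mu]_(x in A) (w x)%:E)%E.
Local Open Scope ereal_scope.

Import HBNNSimple.

Let mwE : measurable_fun setT (EFin \o w).
Proof. exact/measurable_EFinP. Qed.

Let integral_density_nnsfun (f : {nnsfun T >-> R}) :
  \int[nu]_x (f x)%:E = \int[mu]_x ((f x)%:E * (w x)%:E).
Proof.
under [LHS]eq_integral do rewrite fimfunE -fsumEFin//.
rewrite [LHS]ge0_integral_fsum//; last 2 first.
  - by move=> r; exact/measurable_EFinP/measurableT_comp.
  - by move=> n x _; rewrite EFinM nnfun_muleindic_ge0.
under [RHS]eq_integral.
  move=> x xD; rewrite fimfunE -fsumEFin// ge0_mule_fsuml; last first.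
    by move=> r; rewrite EFinM nnfun_muleindic_ge0.
  over.
rewrite [RHS]ge0_integral_fsum//; last 2 first.
  - move=> r; apply: emeasurable_funM => //.
    by apply/measurable_EFinP; apply/measurableT_comp.
  - move=> n x _; apply: mule_ge0; last by rewrite lee_fin.
    by rewrite EFinM nnfun_muleindic_ge0.
apply: eq_fsbigr => r _.
rewrite integralZl_indic_nnsfun// integral_indic// setIT nuE//.
under [RHS]eq_integral do rewrite EFinM -muleA.
have [r0|r0] := leP 0%R r.
  rewrite ge0_integralZl//.
  - rewrite integral_mkcond; congr (_ * _); apply: eq_integral => x _.
    by rewrite patchE indicE; case: ifP; rewrite ?mul1e ?mul0e.
  - apply: emeasurable_funM => //; apply/measurable_EFinP; exact: measurable_indic.
  - by move=> x _; rewrite mule_ge0 ?lee_fin.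
have A0 : f @^-1` [set r] = set0.
  apply/seteqP; split => x //= fxr.
  by move: r0; rewrite -fxr ltNge fun_ge0.
rewrite A0 integral_set0 mule0 [RHS]integral0_eq// => x _.
by rewrite indic0 mul0e mule0.
Qed.

(** For simple functions this is [nuE] on the fibres; monotone convergence does the rest. *)
Lemma integral_density (f : T -> \bar R) :
  measurable_fun setT f -> (forall x, 0 <= f x) ->
  \int[nu]_x f x = \int[mu]_x (f x * (w x)%:E).
Proof.
move=> mf f0; pose f_ := nnsfun_approx measurableT mf.
transitivity (limn (fun n => \int[nu]_x (f_ n x)%:E)).
  rewrite -monotone_convergence//=.
  - apply: eq_integral => ? /[!inE] xD; apply/esym/cvg_lim => //=.
    exact: cvg_nnsfun_approx.
  - by move=> n; exact/measurable_EFinP/measurable_funTS.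
  - by move=> n ? _; rewrite lee_fin.
  - by move=> ? _ ? ? mn; rewrite lee_fin; exact/lefP/nd_nnsfun_approx.
transitivity (limn (fun n => \int[mu]_x ((f_ n x)%:E * (w x)%:E))).
  by apply: congr_lim; apply/funext => n; exact: integral_density_nnsfun.
rewrite -monotone_convergence//=.
- apply: eq_integral => x _; apply/cvg_lim => //.
  apply: cvgeZr => //; exact: cvg_nnsfun_approx.
- move=> n; apply: emeasurable_funM => //.
  by apply/measurable_EFinP; exact: measurable_funTS.
- by move=> n x _; rewrite mule_ge0// lee_fin.
- move=> x _ m n mn; apply: lee_wpmul2r; rewrite lee_fin//.
  exact/lefP/nd_nnsfun_approx.
Qed.

End integral_of_density.

Section gaussian_average_bounded.
Context {R : realType} (beta : R).
Hypothesis beta_gt0 : 0 < beta.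
Notation M := (@lebesgue_measure R).
Notation g := (gauss_dens beta).
Notation avg := (gauss_avg beta).
Implicit Types (f : R -> R) (z : R).

Let measurable_translate f z : measurable_fun setT f ->
  measurable_fun setT (fun x : R => f (z + x)).
Proof. by move=> mf; apply: (measurableT_comp mf); exact: measurable_funD. Qed.

Let integrable_translate f K z : measurable_fun setT f -> (forall x, `|f x| <= K) ->
  M.-integrable setT (EFin \o (fun x => f (z + x) * g x)).
Proof.
move=> mf fK; apply: (integrable_bounded_dens beta_gt0 (K := K)) => //.
exact: measurable_translate.
Qed.

Lemma gauss_avg_cst (c : R) z : avg (fun=> c) z = c.
Proof.
have h := gauss_charE beta_gt0 0.
rewrite expr0n mul0r oppr0 expR0 /gauss_char in h.
rewrite /gauss_avg RintegralZl//; last first.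
  by have := integrable_cos_dens beta_gt0 0; apply: eq_integrable => // x _;
    rewrite /= mul0r cos0 mul1r.
rewrite -[RHS]mulr1 -h; congr (_ * _); apply: eq_Rintegral => x _.
by rewrite mul0r cos0 mul1r.
Qed.

Lemma le_gauss_avg f1 f2 K1 K2 z :
  measurable_fun setT f1 -> (forall x, `|f1 x| <= K1) ->
  measurable_fun setT f2 -> (forall x, `|f2 x| <= K2) ->
  (forall x, f1 x <= f2 x) -> avg f1 z <= avg f2 z.
Proof.
move=> m1 b1 m2 b2 f12; apply: le_Rintegral => //.
- exact: (integrable_translate (K := K1)).
- exact: (integrable_translate (K := K2)).
- by move=> x _; rewrite ler_wpM2r ?gauss_dens_ge0.
Qed.

Lemma gauss_avg_itv f (m K : R) z : measurable_fun setT f ->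
  (forall x, m <= f x <= K) -> m <= avg f z <= K.
Proof.
move=> mf fK; have bf x : `|f x| <= `|m| + `|K|.
  have /andP[h1 h2] := fK x; rewrite ler_norml.
  have := ler_norm K; have := lerNnormlW (lexx `|m|); have := normr_ge0 m.
  have := normr_ge0 K; lra.
apply/andP; split.
  rewrite -[leLHS](gauss_avg_cst _ z); apply: (le_gauss_avg (K1 := `|m|) _ _ _ mf bf) => //.
  by move=> x; have /andP[] := fK x.
rewrite -[leRHS](gauss_avg_cst _ z); apply: (le_gauss_avg (K2 := `|K|) _ mf bf) => //.
by move=> x; have /andP[] := fK x.
Qed.

Lemma gauss_avg_dist f1 f2 (K1 K2 eps : R) z :
  measurable_fun setT f1 -> (forall x, `|f1 x| <= K1) ->
  measurable_fun setT f2 -> (forall x, `|f2 x| <= K2) ->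
  (forall x, `|f1 x - f2 x| <= eps) -> `|avg f1 z - avg f2 z| <= eps.
Proof.
move=> m1 b1 m2 b2 f12.
have -> : avg f1 z - avg f2 z = avg (f1 \- f2) z.
  rewrite /gauss_avg -RintegralB//.
  - by apply: eq_Rintegral => x _; rewrite mulrBl.
  - exact: (integrable_translate (K := K1)).
  - exact: (integrable_translate (K := K2)).
rewrite ler_norml; apply: gauss_avg_itv; first exact: measurable_funB.
by move=> x; have := f12 x; rewrite ler_norml.
Qed.

Lemma integral_gauss_translate f (K : R) z : measurable_fun setT f ->
  (forall x, 0 <= f x <= K) ->
  (\int[gauss_prob beta]_x (f (z + x))%:E = (avg f z)%:E)%E.
Proof.
move=> mf fK; have mfz := measurable_translate z mf.
have f0 x : 0 <= f x by have /andP[] := fK x.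
rewrite integral_gauss_probT//; last 2 first.
- exact/measurable_EFinP.
- by move=> x; rewrite lee_fin.
rewrite (@integral_density _ (measurableTypeR R) R M (gauss_law beta) g)//.
- rewrite fineK//; apply: integrable_fin_num => //.
  apply: (integrable_translate (K := K)) => // x.
  by rewrite ger0_norm//; have /andP[] := fK x.
- exact: measurable_normal_pdf.
- by move=> x; exact: gauss_dens_ge0.
- exact/measurable_EFinP.
- by move=> x; rewrite lee_fin.
Qed.

Lemma measurable_gauss_avg f (K : R) : measurable_fun setT f ->
  (forall x, 0 <= f x <= K) -> measurable_fun setT (avg f).
Proof.
move=> mf fK; apply/measurable_EFinP.
have -> : EFin \o avg f =
    fubini_F (gauss_prob beta) (fun y : R * R => (f (y.1 + y.2))%:E).
  by apply/funext => z; rewrite /fubini_F/= (integral_gauss_translate z mf fK).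
apply: measurable_fun_fubini_tonelli_F => [|y].
  apply/measurable_EFinP; apply: (measurableT_comp mf).
  exact: measurable_funD.
by rewrite lee_fin; have /andP[] := fK (y.1 + y.2).
Qed.

End gaussian_average_bounded.

(** * Contraction of the effective potentials *)

Section approximable_functions.
Context {R : realType} (beta : R).
Hypothesis beta_gt0 : 0 < beta.
Implicit Types (f T : R -> R) (e z : R).

Definition bounded_positive f := measurable_fun setT f /\
  exists m K : R, 0 < m /\ forall z, m <= f z <= K.

(* A substitute for nonnegative geometrically decaying Fourier coefficients of
   [f] that does not refer to the Fourier series of [f]. *)
Definition decaying_approx e f := forall eps, 0 < eps ->
  exists T, decaying_trig e T /\ forall z, `|f z - T z| <= eps.

Lemma measurable_decaying_trig e T : decaying_trig e T -> measurable_fun setT T.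
Proof.
move=> [n [p [_ hT]]].
rewrite (_ : T = fun z => \sum_(i < size p)
    p`_i * cos (- (n%:R * (2 * pi * z)) + i%:R * (2 * pi * z))); last first.
  by apply/funext => z; have [<- _] := hT z.
apply: measurable_sum => i; apply: measurable_funM => //.
apply: (measurableT_comp (f := @cos R)).
  apply: continuous_measurable_fun; exact: continuous_cos.
rewrite (_ : (fun x => _) = (fun x => (i%:R - n%:R) * (2 * pi) * x)); last first.
  by apply/funext => x; ring.
exact: measurable_funM.
Qed.

Lemma dist_exprn_le (x y K : R) k : `|x| <= K -> `|y| <= K ->
  `|x ^+ k - y ^+ k| <= k%:R * K ^+ k.-1 * `|x - y|.
Proof.
move=> xK yK; rewrite subrXX normrM mulrC; apply: ler_wpM2r => //.
apply: le_trans (ler_norm_sum _ _ _) _.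
apply: (@le_trans _ _ (\sum_(i < k) K ^+ k.-1)); last first.
  by rewrite sumr_const card_ord -[leLHS]mulr_natl.
apply: ler_sum => i _; rewrite normrM !normrX.
have -> : K ^+ k.-1 = K ^+ (k.-1 - i) * K ^+ i.
  by rewrite -exprD subnK//; have := ltn_ord i; lia.
by apply: ler_pM; rewrite ?exprn_ge0// lerXn2r// nnegrE (le_trans _ xK).
Qed.

Lemma bounded_positiveX k f : bounded_positive f -> bounded_positive (fun z => f z ^+ k).
Proof.
move=> [mf [m [K [m0 fK]]]]; split; first exact: measurable_funX.
exists (m ^+ k), (K ^+ k); split; first exact: exprn_gt0.
move=> z; have /andP[h1 h2] := fK z.
by rewrite !lerXn2r// nnegrE ?(le_trans (ltW m0))// (le_trans h1).
Qed.

Lemma bounded_positive_avg f : bounded_positive f -> bounded_positive (gauss_avg beta f).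
Proof.
move=> [mf [m [K [m0 fK]]]]; split.
  apply: (measurable_gauss_avg beta_gt0 (K := K) mf) => z.
  by have /andP[h1 ->] := fK z; rewrite (le_trans (ltW m0)).
exists m, K; split=> // z; exact: gauss_avg_itv.
Qed.

Lemma decaying_approxX e k f : 0 <= e -> bounded_positive f ->
  decaying_approx e f -> decaying_approx (k%:R * e) (fun z => f z ^+ k).
Proof.
move=> e0 [_ [m [K [m0 fK]]]] af eps eps0.
have K0 : 0 <= K by have /andP[h1 h2] := fK 0; rewrite (le_trans (ltW m0))// (le_trans h1).
(* On [[- (K + 1), K + 1]] the power is Lipschitz with constant at most D. The cap 1 in [eps1] keeps
   T in that interval, and the last summand keeps D positive. *)
pose D := k%:R * (K + 1) ^+ k.-1 + 1.
have D0 : 0 < D by rewrite ltr_wpDl// mulr_ge0// exprn_ge0// addr_ge0.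
pose eps1 := Num.min 1 (eps / D).
have eps10 : 0 < eps1 by rewrite lt_min ltr01 divr_gt0.
have [T [dT fT]] := af _ eps10.
exists (fun z => T z ^+ k); split; first exact: decaying_trigX.
move=> z; have fz : `|f z| <= K.
  by have /andP[h1 h2] := fK z; rewrite ger0_norm// (le_trans (ltW m0)).
have fT1 : `|f z - T z| <= 1 by apply: le_trans (fT z) _; rewrite ge_min lexx.
have Tz : `|T z| <= K + 1.
  have -> : T z = f z - (f z - T z) by rewrite opprB addrCA subrr addr0.
  by apply: le_trans (ler_normB _ _) _; exact: lerD.
have fz1 : `|f z| <= K + 1 by apply: le_trans fz _; rewrite lerDl.
apply: le_trans (dist_exprn_le k fz1 Tz) _.
apply: (@le_trans _ _ (D * (eps / D))); last by rewrite mulrC divfK// gt_eqF.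
apply: ler_pM => //; first by rewrite mulr_ge0// exprn_ge0// addr_ge0.
  by rewrite lerDl.
by apply: le_trans (fT z) _; rewrite ge_min lexx orbT.
Qed.

Lemma decaying_approx_avg e f : 0 <= e -> bounded_positive f ->
  decaying_approx e f -> decaying_approx (e * heat_factor beta) (gauss_avg beta f).
Proof.
move=> e0 [mf [m [K [m0 fK]]]] af eps eps0.
have [T [dT fT]] := af _ eps0.
exists (gauss_avg beta T); split; first exact: decaying_trig_avg.
have fz z : `|f z| <= K.
  by have /andP[h1 h2] := fK z; rewrite ger0_norm// (le_trans (ltW m0)).
have Tz z : `|T z| <= K + eps.
  have -> : T z = f z - (f z - T z) by rewrite opprB addrCA subrr addr0.
  by apply: le_trans (ler_normB _ _) _; exact: lerD.
move=> z; apply: (gauss_avg_dist beta_gt0 z mf fz _ Tz) => //.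
exact: measurable_decaying_trig dT.
Qed.

(** Up to a small error, f lies between (1 - d) c and (1 + d) c; cross-multiplying eliminates c,
    which depends on the approximation. *)
Lemma decaying_approx_oscillation e f z z' : 0 <= e < 1 -> decaying_approx e f ->
  2 * e / (1 - e) <= 1 ->
  (1 - 2 * e / (1 - e)) * f z <= (1 + 2 * e / (1 - e)) * f z'.
Proof.
move=> e01 af; set d := 2 * e / (1 - e) => d1.
have d0 : 0 <= d.
  have /andP[h0 h1] := e01; apply: divr_ge0; first exact: mulr_ge0.
  by rewrite subr_ge0 ltW.
apply/ler_addgt0Pr => eps eps0.
(* The two errors enter with weights 1 - d and 1 + d, whose sum is 2. *)
have [T [dT fT]] := af (eps / 2) (divr_gt0 eps0 (ltr0Sn _ 1)).
have [c c0 Tc] := decaying_trig_near e01 dT.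
have := Tc z; have := Tc z'; rewrite -/d.
have := fT z; have := fT z'; rewrite !ler_norml.
move=> /andP[a1 a2] /andP[a3 a4] /andP[b1 b2] /andP[b3 b4].
have h1 : (1 - d) * f z <= (1 - d) * ((1 + d) * c + eps / 2).
  by apply: ler_wpM2l; [rewrite subr_ge0|lra].
have h2 : (1 + d) * ((1 - d) * c - eps / 2) <= (1 + d) * f z'.
  by apply: ler_wpM2l; [rewrite addr_ge0|lra].
apply: le_trans h1 _; rewrite -lerBlDr; apply: le_trans h2.
by clearbody d; rewrite le_eqVlt; apply/orP; left; apply/eqP; field.
Qed.

End approximable_functions.

Section potential_weights.
Context {R : realType} (b : nat) (beta : R).
Hypotheses (b_ge2 : (2 <= b)%N) (beta_gt0 : 0 < beta).

Definition pot_weight (k : nat) (z : R) : R := expR (- eff_pot b beta k z).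

Definition pot_rate : R := b%:R * heat_factor beta.

Lemma pot_weight_gt0 k z : 0 < pot_weight k z.
Proof. exact: expR_gt0. Qed.

Lemma pot_weight0 : pot_weight 0 = lattice_theta beta.
Proof.
apply/funext => z.
by rewrite /pot_weight eff_pot0E// opprK lnK// posrE lattice_theta_gt0.
Qed.

Lemma integral_pot_weight k z : bounded_positive (pot_weight k) ->
  (\int[gauss_prob beta]_x (pot_weight k (z + x) ^+ b)%:E =
   (gauss_avg beta (fun z => pot_weight k z ^+ b) z)%:E)%E.
Proof.
move=> bp; have [mf [m [K [m0 fK]]]] := bounded_positiveX b bp.
rewrite (integral_gauss_translate beta_gt0 (f := fun z => pot_weight k z ^+ b) (K := K))//.
by move=> x; have /andP[h1 ->] := fK x; rewrite (le_trans (ltW m0)).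
Qed.

(** Bounds above and away from zero ensure that [fine] and [ln] in [eff_pot] meet a finite positive
    value. *)
Lemma pot_weightS k : bounded_positive (pot_weight k) ->
  pot_weight k.+1 = gauss_avg beta (fun z => pot_weight k z ^+ b).
Proof.
move=> bp; apply/funext => z; rewrite {1}/pot_weight /= opprK.
have -> : ('E_(gauss_law beta)[fun x => expR (- (b%:R * eff_pot b beta k (z + x)))] =
    (gauss_avg beta (fun z => pot_weight k z ^+ b) z)%:E)%E.
  rewrite -integral_pot_weight// integral_gauss_probT.
  - rewrite unlock; apply: eq_integral => x _ /=.
    by rewrite /pot_weight -expRM_natl mulrN.
  - apply/measurable_EFinP; have [mf _] := bounded_positiveX b bp.
    by apply: (measurableT_comp mf); exact: measurable_funD.
  - by move=> x; rewrite lee_fin exprn_ge0// expR_ge0.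
rewrite /= lnK// posrE.
have [mf [m [K [m0 fK]]]] := bounded_positiveX b bp.
by have /andP[h _] := gauss_avg_itv beta_gt0 z mf fK; exact: lt_le_trans h.
Qed.

Lemma pot_weight_bounded k : bounded_positive (pot_weight k).
Proof.
elim: k => [|k IH].
  rewrite pot_weight0; split; first exact: measurable_lattice_theta.
  exists (expR (- (beta / 2))), (2 * (expR (2 * beta) / gauss_peak beta)).
  split=> [|z]; first exact: expR_gt0.
  by rewrite lattice_theta_lb// lattice_theta_ub.
rewrite pot_weightS//; apply: bounded_positive_avg => //.
exact: bounded_positiveX.
Qed.

(** The rate is theta at k = 0; each step multiplies it by b for the power and by theta for the
    average. *)
Lemma pot_weight_approx k :
  decaying_approx (heat_factor beta * pot_rate ^+ k) (pot_weight k).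
Proof.
elim: k => [|k IH].
  by rewrite expr0 mulr1 pot_weight0 => eps; exact: lattice_theta_approx.
rewrite pot_weightS; last exact: pot_weight_bounded.
have -> : heat_factor beta * pot_rate ^+ k.+1 =
    b%:R * (heat_factor beta * pot_rate ^+ k) * heat_factor beta.
  by rewrite exprS /pot_rate; ring.
have e0 : 0 <= heat_factor beta * pot_rate ^+ k.
  by rewrite mulr_ge0 ?exprn_ge0 ?mulr_ge0 ?expR_ge0.
apply: decaying_approx_avg => //; first exact: mulr_ge0.
  apply: bounded_positiveX; exact: pot_weight_bounded.
by apply: decaying_approxX => //; exact: pot_weight_bounded.
Qed.

Lemma pot_rate_gt0 : 0 < pot_rate.
Proof. by rewrite mulr_gt0 ?expR_gt0// ltr0n (leq_trans _ b_ge2). Qed.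

Lemma pot_rate_lt1 : beta < beta_c b -> pot_rate < 1.
Proof.
move=> hb; have b1 : 1 < b%:R :> R by rewrite ltr1n.
have lb : 0 < ln (b%:R : R) by exact: ln_gt0.
rewrite /pot_rate /heat_factor -[X in X * _]lnK ?posrE ?(lt_trans ltr01)//.
rewrite -expRD expR_lt1 subr_lt0 ltr_pdivlMr//.
by move: hb; rewrite /beta_c ltr_pdivlMr// mulrC.
Qed.

(** Serves the finitely many k for which the geometric estimate is not yet small. *)
Lemma pot_weight_ratio_ex k : exists c : R, 0 <= c /\ forall z z',
  pot_weight k z <= expR c * pot_weight k z'.
Proof.
have [_ [m [K [m0 fK]]]] := pot_weight_bounded k.
have mK : m <= K by have /andP[h1 h2] := fK 0; exact: le_trans h1 h2.
have K0 : 0 < K by exact: lt_le_trans mK.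
exists (ln (K / m)); split.
  by apply: ln_ge0; rewrite ler_pdivlMr// mul1r.
move=> z z'; rewrite lnK ?posrE ?divr_gt0//.
have /andP[_ h1] := fK z; have /andP[h2 _] := fK z'.
apply: le_trans h1 _; rewrite mulrAC ler_pdivlMr// ler_pM2l//.
Qed.

(** For e <= 1 / 10 one has d = 2 e / (1 - e) <= 20 e / 9, and then (1 + d) / (1 - d) <= 1 + 6 e;
    this is the origin of the 6. *)
Lemma pot_weight_small k : heat_factor beta * pot_rate ^+ k <= 10^-1 ->
  forall z z', pot_weight k z <=
    expR (6 * heat_factor beta * pot_rate ^+ k) * pot_weight k z'.
Proof.
rewrite -mulrA; set e := heat_factor beta * _ => e10 z z'.
have e0 : 0 <= e by rewrite mulr_ge0 ?exprn_ge0 ?mulr_ge0 ?expR_ge0.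
have e01 : 0 <= e < 1 by lra.
have d2 : 2 * e / (1 - e) <= 20 / 9 * e.
  rewrite ler_pdivrMr; last by lra.
  by have : e * e <= e * 10^-1 by [exact: ler_wpM2l]; clearbody e; lra.
have d1 : 2 * e / (1 - e) <= 1 by lra.
have d0 : 0 <= 2 * e / (1 - e) by apply: divr_ge0; lra.
have := decaying_approx_oscillation z z' e01 (@pot_weight_approx k) d1.
move: d0 d1 d2; set d := 2 * e / _ => d0 d1 d2 h.
apply: (@le_trans _ _ ((1 + 6 * e) * pot_weight k z')); last first.
  by apply: ler_wpM2r; [exact/ltW/pot_weight_gt0|exact: expR_ge1Dx].
have dlt : 0 < 1 - d by lra.
rewrite -(ler_pM2l dlt); apply: le_trans h _; rewrite mulrA.
apply: ler_wpM2r; first exact/ltW/pot_weight_gt0.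
have : d * e <= d * 10^-1 by exact: ler_wpM2l.
clearbody d e; lra.
Qed.

Lemma pot_weight_contraction : beta < beta_c b -> exists2 K : R, 0 < K &
  forall k z z', pot_weight k z <= expR (K * pot_rate ^+ k) * pot_weight k z'.
Proof.
move=> hb; have r0 := pot_rate_gt0; have r1 := pot_rate_lt1 hb.
have [c hc] := choice pot_weight_ratio_ex.
have h0 : 0 < heat_factor beta by exact: expR_gt0.
have [N hN] : exists N : nat, forall k, (N <= k)%N ->
    heat_factor beta * pot_rate ^+ k <= 10^-1.
  have : pot_rate ^+ n @[n --> \oo] --> (0 : R).
    by apply: cvg_expr; rewrite ger0_norm// ltW.
  move=> /cvgr0Pnorm_le /(_ (10^-1 / heat_factor beta)).
  rewrite divr_gt0// => /(_ isT)[N _ hN]; exists N => k Nk.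
  have := hN k Nk; rewrite /= ger0_norm ?exprn_ge0 ?(ltW r0)//.
  by rewrite ler_pdivlMr// mulrC.
(* The first summand serves k >= N; the terms of the sum serve the k < N one by one. *)
pose K := 6 * heat_factor beta + \sum_(k < N) c k / pot_rate ^+ k.
have S0 : 0 <= \sum_(k < N) c k / pot_rate ^+ k.
  by apply: sumr_ge0 => k _; rewrite divr_ge0 ?exprn_ge0 ?(ltW r0)//; have [] := hc k.
exists K; first by rewrite ltr_pwDl// mulr_gt0.
move=> k z z'; have [kN|Nk] := ltnP k N.
  have [_ h] := hc k; apply: le_trans (h z z') _.
  apply: ler_wpM2r; first exact/ltW/pot_weight_gt0.
  rewrite ler_expR -ler_pdivrMr ?exprn_gt0// /K (bigD1 (Ordinal kN))//=.
  rewrite addrCA lerDl addr_ge0 ?mulr_ge0 ?(ltW h0)//.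
  by apply: sumr_ge0 => i _; rewrite divr_ge0 ?exprn_ge0 ?(ltW r0)//; have [] := hc i.
apply: le_trans (pot_weight_small (hN k Nk) z z') _.
apply: ler_wpM2r; first exact/ltW/pot_weight_gt0.
by rewrite ler_expR; apply: ler_wpM2r; rewrite ?exprn_ge0 ?(ltW r0)// lerDl.
Qed.

End potential_weights.

(** The sequence is ln D / k + ln q, with limit ln q < 0. *)
Lemma limn_esup_ln_geometric (R : realType) (D q : R) : 0 < D -> 0 < q < 1 ->
  (limn_esup (fun k : nat => (k%:R^-1 * ln (D * q ^+ k))%:E) < 0)%E.
Proof.
move=> D0 /andP[q0 q1].
have : (fun k : nat => (k%:R^-1 * ln (D * q ^+ k))%:E) @ \oo --> (ln q)%:E.
  apply: cvg_EFin; first by near=> k.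
  have h : (fun n => @harmonic R n * ln D + ln q) @ \oo --> ln q.
    rewrite -[X in _ --> X]add0r -[X in _ --> X + _](mul0r (ln D)).
    apply: cvgD; last exact: cvg_cst.
    by apply: cvgMr_tmp; exact: cvg_harmonic.
  (* The shift avoids k = 0, where the inverse takes its default value. *)
  rewrite -cvg_shiftS; apply: cvg_trans h; apply: near_eq_cvg.
  near=> k; rewrite /= lnM ?posrE ?exprn_gt0// lnXn// -[ln q *+ _]mulr_natl.
  by rewrite mulrDr mulKf// pnatr_eq0.
move=> /cvg_esups /cvg_lim h; rewrite limn_esup_lim h// lte_fin.
by apply: ln_lt0; rewrite q0.
Unshelve. all: by end_near.
Qed.

(** * Maps at a single vertex for all levels, and the conclusion *)

Section step_functions.
Context {R : realType} (b : nat) (beta : R).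
Hypotheses (b_ge2 : (2 <= b)%N) (beta_gt0 : 0 < beta).
Notation f := (pot_weight b beta).

Definition pot_density k phi z :=
  expR (eff_pot b beta k.+1 phi - b%:R * eff_pot b beta k (phi + z)).

Lemma pot_densityE k phi z :
  pot_density k phi z = f k (phi + z) ^+ b / f k.+1 phi.
Proof.
rewrite /pot_density /pot_weight expRD [expR (- - _)]expRN invrK mulrC.
by rewrite -expRM_natl mulrN.
Qed.

Lemma measurable_pot_density k :
  measurable_fun setT (fun y : R * R => pot_density k y.1 y.2).
Proof.
have mf j : measurable_fun setT (f j) by have [] := pot_weight_bounded b beta_gt0 j.
rewrite (_ : (fun y : R * R => _) =
    (fun y : R * R => f k (y.1 + y.2) ^+ b * (f k.+1 y.1)^-1)); last first.
  by apply/funext => y; rewrite pot_densityE.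
apply: measurable_funM.
  apply: measurable_funX; apply: (measurableT_comp (mf k)).
  exact: measurable_funD.
rewrite (_ : (fun y : R * R => _) = (fun y : R * R => expR (- ln (f k.+1 y.1)))); last first.
  by apply/funext => y; rewrite expRN lnK// posrE pot_weight_gt0.
apply: (measurableT_comp (@measurable_expR R)); apply: measurable_funN.
by apply: (measurableT_comp (@measurable_ln R)); apply: (measurableT_comp (mf k.+1)).
Qed.

Lemma integral_pot_density k phi :
  (\int[gauss_prob beta]_z (pot_density k phi z)%:E = 1)%E.
Proof.
have bp := pot_weight_bounded b beta_gt0.
transitivity (\int[gauss_prob beta]_z
    ((f k.+1 phi)^-1%:E * (f k (phi + z) ^+ b)%:E))%E.
  by apply: eq_integral => z _; rewrite pot_densityE EFinM muleC.
rewrite ge0_integralZl//.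
- rewrite integral_pot_weight// -pot_weightS// -EFinM mulVf// gt_eqF//.
  exact: pot_weight_gt0.
- apply/measurable_EFinP; have [mf _] := bounded_positiveX b (bp k).
  by apply: (measurableT_comp mf); exact: measurable_funD.
- by move=> z _; rewrite lee_fin exprn_ge0// ltW// pot_weight_gt0.
- by rewrite lee_fin invr_ge0 ltW// pot_weight_gt0.
Qed.

(** The denominator [f k.+1 phi] is itself an average of values of [f k] to the power b, so it lies
    within a factor [expR (b%:R * c)] of each of them. *)
Lemma pot_density_itv (c : R) k phi z :
  (forall z z', f k z <= expR c * f k z') ->
  expR (- (b%:R * c)) <= pot_density k phi z <= expR (b%:R * c).
Proof.
move=> fc; have bp := pot_weight_bounded b beta_gt0 k.
have fcX x y : f k x ^+ b <= expR (b%:R * c) * f k y ^+ b.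
  rewrite expRM_natl -exprMn; apply: lerXn2r; rewrite ?nnegrE ?mulr_ge0 ?expR_ge0//.
have [mf _] := bounded_positiveX b bp.
have : expR (- (b%:R * c)) * f k (phi + z) ^+ b <= f k.+1 phi <=
    expR (b%:R * c) * f k (phi + z) ^+ b.
  rewrite pot_weightS//; apply: gauss_avg_itv => // x.
  by rewrite fcX expRN mulrC ler_pdivrMr ?expR_gt0// mulrC fcX.
move=> /andP[h1 h2]; rewrite pot_densityE.
rewrite ler_pdivlMr ?pot_weight_gt0// ler_pdivrMr ?pot_weight_gt0//.
rewrite expRN ler_pdivrMl ?expR_gt0// h2/=.
by move: h1; rewrite expRN ler_pdivrMl ?expR_gt0.
Qed.

(** Everything is of order 1 - u: h - u ^ 2 is at least u (1 - u) and at most 1 / u - u ^ 2 <= 3 (1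
    - u) / u, whereas 1 - u ^ 2 = (1 - u) (1 + u). *)
Lemma switch_itv (u K h : R) : 0 < u < 1 -> 3 / u <= K -> u <= h <= u^-1 ->
  (1 - u ^+ 2) / K <= h - u ^+ 2 <= K * (1 - u ^+ 2).
Proof.
move=> /andP[u0 u1] uK /andP[h1 h2].
have K0 : 0 < K by apply: lt_le_trans uK; rewrite divr_gt0.
have Ku : 3 <= K * u by move: uK; rewrite ler_pdivrMr.
have eu : 1 - u ^+ 2 = (1 - u) * (1 + u) by ring.
apply/andP; split.
  rewrite ler_pdivrMr//; apply: (@le_trans _ _ ((1 - u) * (K * u))).
    by rewrite eu; apply: ler_wpM2l; lra.
  rewrite (_ : (1 - u) * (K * u) = (u - u ^+ 2) * K); last by ring.
  by apply: ler_wpM2r; [exact: ltW|rewrite lerD2r].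
apply: (@le_trans _ _ (3 / u * (1 - u))); last first.
  apply: ler_pM => //; [by rewrite divr_ge0// ltW|by lra|].
  by rewrite lerD2l lerN2 expr2 ler_piMl// ltW.
apply: (@le_trans _ _ (u^-1 - u ^+ 2)); first by rewrite lerD2r.
rewrite -(ler_pM2r u0) mulrAC divfK ?gt_eqF// mulrBl mulVf ?gt_eqF//.
rewrite -subr_ge0 (_ : _ - _ = (1 - u) * (2 - u - u ^+ 2)); last by ring.
have : u ^+ 2 <= u by rewrite expr2 ler_piMl// ltW.
by move=> ?; apply: mulr_ge0; lra.
Qed.

Lemma step_functions : beta < beta_c b ->
  exists (C : R) (r : nat -> R) (step : nat -> R -> R * bool -> R),
  [/\ 0 < C, forall k, 0 < r k,
      (limn_esup (fun k : nat => (k%:R^-1 * ln (r k))%:E) < 0)%E &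
  [/\ forall k, measurable_fun setT (fun y : R * (R * bool) => step k y.1 y.2),
      forall k phi A, measurable A ->
        (gauss_prob beta \x bernoulli_prob (expR (- r k)))%E (step k phi @^-1` A) =
        trans_law b beta k phi A,
      forall k phi a, `|step k phi a - a.1| <= C &
      forall k phi z, (1 <= k)%N -> step k phi (z, true) = z]].
Proof.
move=> hb; have q0 := pot_rate_gt0 beta b_ge2; have q1 := pot_rate_lt1 b_ge2 beta_gt0 hb.
have [K K0 hK] := pot_weight_contraction b_ge2 beta_gt0 hb.
have b0 : 0 < b%:R :> R by rewrite ltr0n (leq_trans _ b_ge2).
set q := pot_rate b beta in q0 q1 hK.
(* The density at level k + 1 is built from f_k, whose oscillation is K q ^ k; the division by q
   makes [r k.+1] equal to 2 b K q ^ k. *)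
pose D := 2 * (b%:R * K) / q.
have D0 : 0 < D by rewrite divr_gt0// !mulr_gt0.
pose r k := D * q ^+ k.
have r0 k : 0 < r k by rewrite mulr_gt0// exprn_gt0.
have [C0 C00 steps0] := discrete_step beta_gt0 b.
(* The constant given to [density_step] has to be fixed before k; as q ^ k <= 1, this one bounds 3 /
   u at all levels. *)
have L0 : 0 < 3 * expR (b%:R * K) by rewrite mulr_gt0// expR_gt0.
have [C1 C10 steps1] := density_step beta_gt0 L0.
have stepS k : exists step : R -> R * bool -> R,
    [/\ measurable_fun setT (fun y : R * (R * bool) => step y.1 y.2),
        forall phi A, measurable A ->
          (gauss_prob beta \x bernoulli_prob (expR (- r k)))%E (step phi @^-1` A) =
          trans_law b beta k phi A,
        forall phi a, `|step phi a - a.1| <= C0 + C1 &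
        forall phi z, (1 <= k)%N -> step phi (z, true) = z].
  case: k => [|k].
    have [step [h1 h2 h3]] := steps0 (bernoulli_prob (expR (- r 0))).
    exists step; split=> // phi a; apply: le_trans (h3 phi a) _.
    by rewrite lerDl ltW.
  pose u := expR (- (b%:R * (K * q ^+ k))).
  have u01 : 0 < u < 1.
    by rewrite expR_gt0 expR_lt1 oppr_lt0 !mulr_gt0// exprn_gt0.
  have ur : expR (- r k.+1) = u ^+ 2.
    rewrite /u -expRM_natl /r /D exprS; congr expR; field.
    by rewrite gt_eqF.
  have uL : 3 / u <= 3 * expR (b%:R * K).
    rewrite /u expRN invrK ler_pM2l// ler_expR ler_pM2l//.
    by rewrite ler_piMr ?(ltW K0)// exprn_ile1// ltW.
  have [||||step [h1 h2 h3 h4]] := steps1 (u ^+ 2) (pot_density k).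
  - have /andP[u0 u1] := u01; rewrite exprn_gt0//= exprn_ilt1// ltW//.
  - exact: measurable_pot_density.
  - exact: integral_pot_density.
  - move=> phi z; apply: switch_itv => //.
    by rewrite /u -expRN opprK; apply: pot_density_itv => x y; exact: hK.
  exists step; split=> // [phi A mA|phi a].
    rewrite ur h2// integral_gauss_prob//.
    - apply/measurable_EFinP.
      apply: (measurableT_comp (f := fun y : R * R => pot_density k y.1 y.2)
        (g := fun z => (phi, z))); first exact: measurable_pot_density.
      exact: measurable_fun_pair.
    - by move=> z; rewrite lee_fin expR_ge0.
  by apply: le_trans (h3 phi a) _; rewrite lerDr ltW.
have [step hstep] := choice stepS.
exists (C0 + C1), r, step; split=> //; first exact: addr_gt0.
  by apply: limn_esup_ln_geometric => //; rewrite q0.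
by split=> k; have [] := hstep k.
Qed.

End step_functions.

Theorem theorem3p6 (R : realType) (b : nat) (hb : (2 <= b)%N) (beta : R)
    (beta_gt0 : 0 < beta) (beta_lt : beta < beta_c b) :
  exists (C : R) (r : nat -> R),
    [/\ 0 < C,
        forall k : nat, (1 <= k)%N -> 0 < r k,
        (limn_esup (fun k : nat => (k%:R^-1 * ln (r k))%:E) < 0)%E &
        forall n : nat, (1 <= n)%N ->
        exists (d : measure_display) (Omega : measurableType d)
               (P : probability Omega R)
               (zetaDG zetaGFF : nat -> seq 'I_b -> {RV P >-> R})
               (B : nat -> seq 'I_b -> {RV P >-> bool}),
          let xiDG := increment n zetaDG in
          let xiGFF := increment n zetaGFF in
          (has_dg_law beta n zetaDG /\ has_gff_law beta n zetaGFF) /\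
          [/\ (mutually_independent (switch_index b n)
                 (fun v => B v.1 v.2) /\
               forall (k : nat) (x : seq 'I_b),
                 (1 <= k < n)%N -> size x = (n - k)%N ->
                 P [set w | B k x w = true] = (expR (- r k))%:E),
              independent_families
                (increment_index b n) (fun v => xiGFF v.1 v.2)
                (switch_index b n) (fun v => B v.1 v.2),
              (forall (k : nat) (x : seq 'I_b),
                 (1 <= k < n)%N -> size x = n ->
                 forall w : Omega,
                   B k (iter k (@drop_last 'I_b) x) w = true ->
                   xiDG k x w = xiGFF k x w) &
              (forall (k : nat) (x : seq 'I_b),
                 (k < n)%N -> size x = n ->
                 P [set w | C < `|xiDG k x w - xiGFF k x w|] = 0%E)]].
Proof.
have [C [r [step [C0 r0 hr [mstep law_step step_near step_switch]]]]] :=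
  step_functions hb beta_gt0 beta_lt.
exists C, r; split=> // n _.
exact: (coupling_of_steps mstep law_step step_near step_switch r0).
Qed.
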